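(* Let $\gamma>0$, let $s\ge2$, $T>0$, and let $g\in C^\infty(\mathbb{R})$ satisfy $g(0)=0$, $g(r)\ge\gamma r^2$ for all $r\in\mathbb{R}$, and $g(r)>\gamma r^2$ for all $r\ne0$. Let $u=u(t,x,y)$ be a non-trivial (that is, not identically zero) solution, in the space $C([0,T];X^s(\mathbb{R}^2))\cap C^1([0,T];X^{s-2}(\mathbb{R}^2))$, of the system $$\begin{cases}u_t+\gamma uu_x+G*\partial_x\left(\frac12 g(u)+\frac\gamma2 u_x^2-\frac\gamma2u^2\right)+G*v_y=0,\\ u_y=v_x,\\ u|_{t=0}=u_0,\end{cases}\qquad (x,y)\in\mathbb{R}^2.$$ Then there exists no non-empty open set $W\subseteq[0,T]\times\mathbb{R}$ such that $$u(t,x,y)=0\qquad\text{for all }(t,x)\in W,\ y\in\mathbb{R}.$$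
   Context: All functions are real-valued; $u=u(t,x,y)$, $v=v(t,x,y)$, with $v=\partial_x^{-1}u_y$. $G(x)=\frac12 e^{-|x|}$ for $x\in\mathbb{R}$, and $*$ denotes convolution in the $x$ variable only, $(G*f)(x,y)=\int_{\mathbb{R}}G(x-z)f(z,y)\,\mathrm{d}z$, so that $G*f=(1-\partial_x^2)^{-1}f$. For $s\ge0$, $$X^s(\mathbb{R}^2)=\{u\in H^s(\mathbb{R}^2):\ \partial_x^{-1}u\in H^s(\mathbb{R}^2),\ \partial_xu\in H^s(\mathbb{R}^2)\},$$ with norm $\|u\|_{X^s}=(\|u\|_{H^s}^2+\|\partial_x^{-1}u\|_{H^s}^2+\|\partial_xu\|_{H^s}^2)^{1/2}$, where $\partial_x^{-1}u=\mathcal{F}^{-1}((i\xi)^{-1}\mathcal{F}(u)(\xi,\eta))$, $\mathcal{F}$ is the Fourier transform in $(x,y)$ with dual variables $(\xi,\eta)$, and $\|u\|_{H^s}^2=\int_{\mathbb{R}^2}(1+|\xi|^2+|\eta|^2)^s|\mathcal{F}(u)(\xi,\eta)|^2\,\mathrm{d}\xi\,\mathrm{d}\eta$. *)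

(* Defs.v *)
From HB Require Import structures.
From mathcomp Require Import all_boot all_order all_algebra.
From mathcomp Require Import all_classical all_reals all_analysis.
From mathcomp Require Import complex.

Set Implicit Arguments.
Unset Strict Implicit.
Unset Printing Implicit Defensive.

Import Order.TTheory GRing.Theory Num.Theory.
Import numFieldNormedType.Exports.

Local Open Scope classical_set_scope.
Local Open Scope ring_scope.

Notation plane_measure R :=
  ((@lebesgue_measure R \x @lebesgue_measure R)%E) (only parsing).

(* Elements of L^2(R^2) are represented by measurable functions R * R -> R;
   all identities between them below are almost-everywhere identities. *)
Definition in_L2 (R : realType) (f : R * R -> R) : Prop :=
  f \in Lfun (plane_measure R) 2%:E.

Definition ae_eq2 (R : realType) (S : Type) (f h : R * R -> S) : Prop :=
  {ae plane_measure R, forall p, f p = h p}.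

(* int_([-n, n]^2) f(x, y) exp(- i (x xi + y eta)) dx dy *)
Definition fourier_trunc (R : realType) (f : R * R -> R) (n : nat)
    (k : R * R) : R[i] :=
  let Q := `[- n%:R, n%:R]%classic `*` `[- n%:R, n%:R]%classic in
  Complex
    (\int[plane_measure R]_(p in Q) (f p * cos (p.1 * k.1 + p.2 * k.2)))
    (- \int[plane_measure R]_(p in Q) (f p * sin (p.1 * k.1 + p.2 * k.2))).

(* The Fourier transform on L^2(R^2): the L^2-limit of the Fourier integrals of
   the truncations f 1_([-n, n]^2). *)
Definition is_fourier (R : realType) (f : R * R -> R) (F : R * R -> R[i]) :
    Prop :=
  [/\ in_L2 (fun k => complex.Re (F k)), in_L2 (fun k => complex.Im (F k)) &
    (\int[plane_measure R]_k
       ((ComplexField.Normc.normc (fourier_trunc f n k - F k)) ^+ 2)%:E)%E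
       @[n --> \oo] --> 0%E].

(* A function chosen in the a.e.-class of the transform (nonempty for f in L^2
   by Plancherel's theorem). *)
Definition fourier (R : realType) (f : R * R -> R) : R * R -> R[i] :=
  xget (fun=> 0) [set F | is_fourier f F].

Definition Hnorm (R : realType) (s : R) (f : R * R -> R) : \bar R :=
  ((\int[plane_measure R]_k
      ((1 + k.1 ^+ 2 + k.2 ^+ 2) `^ s
       * ComplexField.Normc.normc (fourier f k) ^+ 2)%:E) `^ 2^-1)%E.

(* Only meant for 0 <= s, where H^s is contained in L^2. *)
Definition in_H (R : realType) (s : R) (f : R * R -> R) : Prop :=
  in_L2 f /\ (Hnorm s f < +oo)%E.

(* h = F^{-1} (m F(f)), for f and h in L^2 *)
Definition is_multiplier (R : realType) (m : R * R -> R[i])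
    (f h : R * R -> R) : Prop :=
  [/\ in_L2 f, in_L2 h & ae_eq2 (fourier h) (fun k => m k * fourier f k)].

(* For f and h in L^2, is_dx f h says that h is the distributional derivative
   of f in x: it has symbol i xi; likewise for is_dy and i eta. *)
Definition is_dx (R : realType) : (R * R -> R) -> (R * R -> R) -> Prop :=
  is_multiplier (fun k => Complex 0 k.1).

Definition is_dy (R : realType) : (R * R -> R) -> (R * R -> R) -> Prop :=
  is_multiplier (fun k => Complex 0 k.2).

Definition is_dxinv (R : realType) : (R * R -> R) -> (R * R -> R) -> Prop :=
  is_multiplier (fun k => (Complex 0 k.1)^-1).

Definition in_X (R : realType) (s : R) (f : R * R -> R) : Prop :=
  [/\ in_H s f, exists2 h, is_dxinv f h & in_H s h &
      exists2 h, is_dx f h & in_H s h].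

(* Used only on X^s, where both xget pick an actual function. *)
Definition Xnorm (R : realType) (s : R) (f : R * R -> R) : \bar R :=
  ((Hnorm s f `^ 2
    + Hnorm s (xget (fun=> 0%R) [set h | is_dxinv f h]) `^ 2
    + Hnorm s (xget (fun=> 0%R) [set h | is_dx f h]) `^ 2) `^ 2^-1)%E.

Definition in_CX (R : realType) (s T : R) (w : R -> R * R -> R) : Prop :=
  forall t, t \in `[0, T] ->
    in_X s (w t) /\
    Xnorm s (fun p => w t' p - w t p) @[t' --> within `[0, T] (nbhs t)]
      --> 0%E.

(* wt is the time derivative of w in X^s, one-sided at t = 0 and t = T. *)
Definition is_dt_X (R : realType) (s T : R) (w wt : R -> R * R -> R) : Prop :=
  forall t, t \in `[0, T] ->
    Xnorm s (fun p => (t' - t)^-1 * (w t' p - w t p) - wt t p)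
      @[t' --> within `[0, T] t^'] --> 0%E.

Definition convG (R : realType) (f : R * R -> R) (p : R * R) : R :=
  \int[@lebesgue_measure R]_z (2^-1 * expR (- `|p.1 - z|) * f (z, p.2)).

Definition smooth (R : realType) (g : R -> R) : Prop :=
  forall n x, derivable (derive1n n g) x 1.

(* u is a solution in C([0,T]; X^s) /\ C^1([0,T]; X^(s-2)), with time
   derivative ut and v = dx^{-1} u_y; the equations hold in L^2(R^2) for every
   t in [0, T].  At each time, ux, uy, vx, vy are the first derivatives and dN
   is dx (g(u)/2 + gamma ux^2/2 - gamma u^2/2). *)
Definition is_solution (R : realType) (gamma : R) (g : R -> R) (s T : R)
    (u0 : R * R -> R) (u v : R -> R * R -> R) : Prop :=
  [/\ in_CX s T u,
      ae_eq2 (u 0) u0 &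
      exists ut : R -> R * R -> R,
        [/\ in_CX (s - 2) T u, in_CX (s - 2) T ut, is_dt_X (s - 2) T u ut &
          forall t, t \in `[0, T] ->
            exists ux uy vx vy dN : R * R -> R,
              [/\ is_dx (u t) ux /\ is_dy (u t) uy,
                  is_dxinv uy (v t),
                  is_dx (v t) vx /\ is_dy (v t) vy,
                  is_dx (fun p => 2^-1 * g (u t p) + gamma / 2 * ux p ^+ 2
                                  - gamma / 2 * u t p ^+ 2) dN &
                  ae_eq2 (fun p => ut t p + gamma * u t p * ux p
                                   + convG dN p + convG vy p) (fun=> 0)
                  /\ ae_eq2 uy vx]]].

(* Main.v *)
Require Import Defs.
From HB Require Import structures.
From mathcomp Require Import all_boot all_order all_algebra.
From mathcomp Require Import all_classical all_reals all_analysis.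
From mathcomp Require Import measurable_realfun complex ring lra.
From mathcomp Require finmap.

(** The solution is controlled by two independent arguments.

    At a fixed time, non-locality forces rigidity.  Write the equation as
    u_t + gamma u u_x + G * (d_x N + v_y) = 0 with the flux
    N = g(u)/2 + gamma u_x^2/2 - gamma u^2/2.  The hypotheses on g make N
    nonnegative, and N = 0 only where u = u_x = 0.  If u vanishes on W, then on a
    strip a < x < b, at a time t0, all of u, u_x, u_t and N vanish, hence so does
    G * (d_x N + v_y).  Take x1 < x2 in (a, b) and subtract the values of that
    convolution at x2 from those at x1: this tests d_x N + v_y against the dipole
    G(x1 - .) - G(x2 - .), which decays on both sides of the strip and is
    increasing on both.  After an integration by parts in x, N only meets the
    slope of the dipole, where it cannot cancel; the term in v_y, tested against a
    slowly decaying cut-off in y, is as small as we please.  Therefore N = 0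
    everywhere (nonlocal_vanish), and u(t0) = 0 (strip_forces_zero).

    Zero persists in time, in both directions.  Let E(t) be the squared norm of
    u and u_x in L^2.  The symbol 1 + xi^2 of E cancels that of G, so that
    E'/2 only involves gamma u u_x, N and v_y (energy_ip_equation).  The term in
    v_y vanishes because u_y = v_x; the other ones are at most K E, where K
    depends on bounds of u and u_x alone (energy_rate).  These bounds come from the
    Sobolev embedding of H^2 of the plane into bounded functions (sobolev_sup),
    which is where s >= 2 enters, and are uniform on [0, T] by continuity in time.
    Gronwall's inequality, forward and backward, propagates E(t0) = 0 to all of
    [0, T] (gronwall_zero).

    Both arguments take place in L^2 of the plane and use weak derivatives given by
    Fourier multipliers.  The first half of the file therefore constructs the
    Fourier transform on L^2: Plancherel's identity on integrable functions by
    Abel summation (plancherel_L1L2), the extension by density (fourier_exists),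
    the action of translations and of G (fourier_translate, fourier_convG), and
    the description of weak derivatives as weak limits of difference quotients
    (deriv_cdiff_cvg), through which all integrations by parts are made. *)

Set Implicit Arguments.
Unset Strict Implicit.
Unset Printing Implicit Defensive.

Import Order.TTheory GRing.Theory Num.Theory.
Import numFieldNormedType.Exports.

Local Open Scope classical_set_scope.
Local Open Scope ring_scope.

(** * Square integrable functions *)

Notation itg mu f := (mu.-integrable setT (EFin \o f)).

Section Integrable.
Context d (T : measurableType d) (R : realType) (mu : {measure set T -> \bar R}).
Implicit Types f g h : T -> R.

Lemma itg_meas f : itg mu f -> measurable_fun setT f.
Proof. by move=> /measurable_int/measurable_EFinP. Qed.

Lemma itgD f g : itg mu f -> itg mu g -> itg mu (fun x => f x + g x).
Proof. exact: integrableD. Qed.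

Lemma itgB f g : itg mu f -> itg mu g -> itg mu (fun x => f x - g x).
Proof. exact: integrableB. Qed.

Lemma itgZ a f : itg mu f -> itg mu (fun x => a * f x).
Proof. exact: integrableZl. Qed.

Lemma itg_le f g : measurable_fun setT f -> (forall x, `|f x| <= g x) ->
  itg mu g -> itg mu f.
Proof.
move=> mf fg; apply: le_integrable => //; first exact/measurable_EFinP.
move=> x _ /=; rewrite lee_fin; exact: le_trans (fg x) (ler_norm _).
Qed.

Lemma itg_ge0P f : measurable_fun setT f -> (forall x, 0 <= f x) ->
  (\int[mu]_x (f x)%:E < +oo)%E -> itg mu f.
Proof.
move=> mf f0 foo; apply/integrableP; split; first exact/measurable_EFinP.
by under eq_integral => x _ do rewrite gee0_abs ?lee_fin//.
Qed.

Lemma Rint_EFin f : itg mu f ->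
  (\int[mu]_x (f x)%:E)%E = (\int[mu]_x f x)%:E.
Proof. by move=> fi; rewrite /Rintegral fineK// integrable_fin_num. Qed.

Lemma itg_ae_eq f g : measurable_fun setT g -> {ae mu, forall x, f x = g x} ->
  itg mu f -> itg mu g.
Proof.
move=> mg fg fi; have mf := itg_meas fi.
move/integrableP: fi => [_ fi]; apply/integrableP; split.
  exact/measurable_EFinP.
rewrite (ae_eq_integral (fun x => `|(f x)%:E|)%E)//.
- by apply: measurableT_comp => //; exact/measurable_EFinP.
- by apply: measurableT_comp => //; exact/measurable_EFinP.
- by apply: filterS fg => x /= ->.
Qed.

Lemma Rint_ae_eq f g : measurable_fun setT f -> measurable_fun setT g ->
  {ae mu, forall x, f x = g x} -> \int[mu]_x f x = \int[mu]_x g x.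
Proof.
move=> mf mg fg; rewrite /Rintegral; congr fine.
apply: ae_eq_integral => //; [exact/measurable_EFinP|exact/measurable_EFinP|].
by apply: filterS fg => x /= ->.
Qed.

Lemma Rint_ge0_eq0 f : itg mu f -> (forall x, 0 <= f x) ->
  \int[mu]_x f x = 0 -> {ae mu, forall x, f x = 0}.
Proof.
move=> fi f0 I0; have mf := itg_meas fi.
have /ae_eq_integral_abs H : measurable_fun setT (EFin \o f).
  exact/measurable_EFinP.
have := H mu measurableT; move=> -[+ _].
have -> : (\int[mu]_x `|(EFin \o f) x|)%E = 0%E.
  under eq_integral => x _ do rewrite /= ger0_norm//.
  by rewrite Rint_EFin// I0.
move=> /(_ erefl); apply: filterS => x /= /(_ I) fx.
by move: fx => [].
Qed.

Lemma Rint_le f g : itg mu f -> itg mu g -> (forall x, f x <= g x) ->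
  \int[mu]_x f x <= \int[mu]_x g x.
Proof. by move=> fi gi fg; apply: le_Rintegral. Qed.

Lemma Rint_ge0 f : (forall x, 0 <= f x) -> 0 <= \int[mu]_x f x.
Proof. by move=> f0; apply: Rintegral_ge0. Qed.

End Integrable.

Section SquareIntegrable.
Context d (T : measurableType d) (R : realType) (mu : {measure set T -> \bar R}).
Implicit Types f g h : T -> R.

Definition sqitg f := measurable_fun setT f /\ itg mu (fun x => f x ^+ 2).

Definition ip f g : R := \int[mu]_x (f x * g x).

Lemma sqitg_Lfun f : f \in Lfun mu 2%:E <-> sqitg f.
Proof.
split=> [Lf|[mf fi]].
  split; last exact: Lfun2_integrable_sqr.
  by move: Lf; rewrite inE => /andP[]; rewrite inE.
rewrite inE; apply/andP; split; rewrite inE//= /finite_norm.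
rewrite unlock /= poweR_lty//.
move/integrableP: fi => [_]; apply: le_lt_trans.
apply: ge0_le_integral => //=.

- apply/measurable_EFinP.
  apply/(@measurableT_comp _ _ _ _ _ _ (fun x : R => x `^ 2)%R) => //.
  exact/measurableT_comp.
- apply/measurable_EFinP; apply: measurableT_comp => //.
  exact: measurable_funX.
- by move=> x _; rewrite lee_fin normrX powR_mulrn.
Qed.

Lemma sqitg_meas f : sqitg f -> measurable_fun setT f.
Proof. by case. Qed.

Lemma sqitg_mul f g : sqitg f -> sqitg g -> itg mu (fun x => f x * g x).
Proof.
move=> [mf fi] [mg gi].
apply: (@itg_le _ _ _ _ _ (fun x => f x ^+ 2 + g x ^+ 2)).
- exact: measurable_funM.
- move=> x; rewrite normrM -[f x ^+ 2]real_normK ?num_real//.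
  rewrite -[g x ^+ 2]real_normK ?num_real//.
  have := sqr_ge0 (`|f x| - `|g x|); have := normr_ge0 (f x).
  have := normr_ge0 (g x); nra.
- exact: itgD.
Qed.

Lemma sqitg_le f g : measurable_fun setT f -> (forall x, `|f x| <= `|g x|) ->
  sqitg g -> sqitg f.
Proof.
move=> mf fg [mg gi]; split=> //.
apply: (itg_le _ _ gi); first exact: measurable_funX.
by move=> x; rewrite normrX -[leRHS]real_normK ?num_real// lerXn2r ?nnegrE.
Qed.

Lemma sqitgD f g : sqitg f -> sqitg g -> sqitg (fun x => f x + g x).
Proof.
move=> sf sg; split.
  exact: measurable_funD (sqitg_meas sf) (sqitg_meas sg).
have -> : (fun x => (f x + g x) ^+ 2) =
    (fun x => f x ^+ 2 + (2 * (f x * g x) + g x ^+ 2)).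
  by apply/funext => x; ring.
by apply: itgD sf.2 _; apply: itgD sg.2; apply: itgZ; exact: sqitg_mul.
Qed.

Lemma sqitgZ a f : sqitg f -> sqitg (fun x => a * f x).
Proof.
move=> [mf fi]; split; first exact: measurable_funM.
have -> : (fun x => (a * f x) ^+ 2) = (fun x => a ^+ 2 * f x ^+ 2).
  by apply/funext => x; ring.
exact: itgZ.
Qed.

Lemma sqitgN f : sqitg f -> sqitg (fun x => - f x).
Proof.
by move=> /(sqitgZ (-1)); under eq_fun do rewrite mulN1r.
Qed.

Lemma sqitgB f g : sqitg f -> sqitg g -> sqitg (fun x => f x - g x).
Proof. by move=> sf sg; apply: sqitgD => //; exact: sqitgN. Qed.

Lemma sqitg0 : sqitg (fun=> 0).
Proof.
split=> //; under eq_fun do rewrite expr0n /=; exact: integrable0.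
Qed.

Lemma sqitgM_bounded (M : R) f g : measurable_fun setT g ->
  (forall x, `|g x| <= M) -> sqitg f -> sqitg (fun x => g x * f x).
Proof.
move=> mg gM sf; apply: (@sqitg_le _ (fun x => M * f x)); last exact: sqitgZ.
  exact: measurable_funM (sqitg_meas sf).
move=> x; rewrite !normrM ler_wpM2r//.
by apply: le_trans (gM x) _; exact: ler_norm.
Qed.

Lemma sqitg_ae_eq f g : measurable_fun setT g -> {ae mu, forall x, f x = g x} ->
  sqitg f -> sqitg g.
Proof.
move=> mg fg [mf fi]; split=> //; apply: itg_ae_eq fi.
  exact: measurable_funX.
by apply: filterS fg => x ->.
Qed.

Lemma sqitg_indic (A : set T) : measurable A -> (mu A < +oo)%E -> sqitg \1_A.
Proof.
move=> mA Aoo; split=> //.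
have -> : (fun x => \1_A x ^+ 2) = \1_A :> (T -> R).
  by apply/funext => x; rewrite indicE; case: (_ \in _); rewrite /= ?expr1n ?expr0n.
apply: itg_ge0P => //.
by rewrite integral_indic// setIT.
Qed.

Lemma ipC f g : ip f g = ip g f.
Proof. by apply: eq_Rintegral => x _; rewrite mulrC. Qed.

Lemma ipDl f g h : sqitg f -> sqitg g -> sqitg h ->
  ip (fun x => f x + g x) h = ip f h + ip g h.
Proof.
move=> sf sg sh; rewrite /ip -RintegralD//; [|exact: sqitg_mul..].
by apply: eq_Rintegral => x _; rewrite mulrDl.
Qed.

Lemma ipZl a f h : sqitg f -> sqitg h -> ip (fun x => a * f x) h = a * ip f h.
Proof.
move=> sf sh; rewrite /ip -RintegralZl//; last exact: sqitg_mul.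
by apply: eq_Rintegral => x _; rewrite mulrA.
Qed.

Lemma ipNl f h : sqitg f -> sqitg h -> ip (fun x => - f x) h = - ip f h.
Proof.
move=> sf sh; rewrite -mulN1r -ipZl//; congr ip.
by apply/funext => x; rewrite mulN1r.
Qed.

Lemma ipBl f g h : sqitg f -> sqitg g -> sqitg h ->
  ip (fun x => f x - g x) h = ip f h - ip g h.
Proof. by move=> sf sg sh; rewrite ipDl ?ipNl//; exact: sqitgN. Qed.

Lemma ipDr f g h : sqitg f -> sqitg g -> sqitg h ->
  ip h (fun x => f x + g x) = ip h f + ip h g.
Proof. by move=> *; rewrite ipC ipDl// !(ipC h). Qed.

Lemma ipZr a f h : sqitg f -> sqitg h -> ip h (fun x => a * f x) = a * ip h f.
Proof. by move=> *; rewrite ipC ipZl// (ipC h). Qed.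

Lemma ipNr f h : sqitg f -> sqitg h -> ip h (fun x => - f x) = - ip h f.
Proof. by move=> *; rewrite ipC ipNl// (ipC h). Qed.

Lemma ipBr f g h : sqitg f -> sqitg g -> sqitg h ->
  ip h (fun x => f x - g x) = ip h f - ip h g.
Proof. by move=> *; rewrite ipC ipBl// !(ipC h). Qed.

Lemma ip_ge0 f : 0 <= ip f f.
Proof. by apply: Rint_ge0 => x; rewrite -expr2 sqr_ge0. Qed.

Lemma ipE f : ip f f = \int[mu]_x (f x ^+ 2).
Proof. by apply: eq_Rintegral => x _. Qed.

Lemma ip_EFin f : sqitg f -> (\int[mu]_x (f x ^+ 2)%:E)%E = (ip f f)%:E.
Proof. by move=> sf; rewrite ipE -Rint_EFin//; exact: sf.2. Qed.

Lemma ip_ae f g f' g' : sqitg f -> sqitg g -> sqitg f' -> sqitg g' ->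
  {ae mu, forall x, f x = f' x} -> {ae mu, forall x, g x = g' x} ->
  ip f g = ip f' g'.
Proof.
move=> sf sg sf' sg' ff' gg'; apply: Rint_ae_eq.
- exact: measurable_funM (sqitg_meas sf) (sqitg_meas sg).
- exact: measurable_funM (sqitg_meas sf') (sqitg_meas sg').
- by apply: filterS2 ff' gg' => x -> ->.
Qed.

Lemma ip_eq0 f : sqitg f -> ip f f = 0 -> {ae mu, forall x, f x = 0}.
Proof.
move=> sf; rewrite ipE => /(Rint_ge0_eq0 sf.2 (fun x => sqr_ge0 (f x))).
by apply: filterS => x /eqP; rewrite sqrf_eq0 => /eqP.
Qed.

(** The discriminant of the nonnegative quadratic t -> |f + t g|^2. *)
Lemma ip_CS f g : sqitg f -> sqitg g -> ip f g ^+ 2 <= ip f f * ip g g.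
Proof.
move=> sf sg.
have Q t : 0 <= ip f f + 2 * t * ip f g + t ^+ 2 * ip g g.
  have stg := sqitgZ t sg.
  have := ip_ge0 (fun x => f x + t * g x).
  rewrite ipDl// ?ipDr// ?ipZl// ?ipZr//; last exact: sqitgD.
  by rewrite (ipC g f); lra.
have [g0|g0] := eqVneq (ip g g) 0.
  rewrite g0 mulr0; have [->|fg0] := eqVneq (ip f g) 0; first by rewrite expr0n.
  have := Q (- (ip f f + 1) / (2 * ip f g)).
  rewrite g0 mulr0 addr0.
  have -> : 2 * (- (ip f f + 1) / (2 * ip f g)) * ip f g = - (ip f f + 1).
    by field; rewrite fg0.
  by lra.
have g1 : 0 < ip g g by rewrite lt_neqAle eq_sym g0 ip_ge0.
have := Q (- ip f g / ip g g).
have -> : ip f f + 2 * (- ip f g / ip g g) * ip f g +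
    (- ip f g / ip g g) ^+ 2 * ip g g = (ip f f * ip g g - ip f g ^+ 2) / ip g g.
  by field; rewrite g0.
by rewrite pmulr_lge0 ?invr_gt0// subr_ge0.
Qed.

Lemma ip_AMGM f g : sqitg f -> sqitg g -> 2 * `|ip f g| <= ip f f + ip g g.
Proof.
move=> sf sg; have := ip_CS sf sg; have := ip_ge0 f; have := ip_ge0 g.
rewrite -[ip f g ^+ 2]real_normK ?num_real//.
move: (ip f f) (ip g g) => a b b0 a0 H.
rewrite -ler_sqr ?nnegrE ?addr_ge0 ?mulr_ge0//.
rewrite exprMn; have := sqr_ge0 (a - b); nra.
Qed.

Lemma ip_add_le f g : sqitg f -> sqitg g ->
  ip (fun x => f x + g x) (fun x => f x + g x) <= 2 * ip f f + 2 * ip g g.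
Proof.
move=> sf sg; rewrite ipDl// ?ipDr//; last exact: sqitgD.
have := ip_AMGM sf sg; have := ler_norm (ip f g); rewrite (ipC g f); lra.
Qed.

Lemma ip_le f g : sqitg f -> sqitg g -> (forall x, `|f x| <= `|g x|) ->
  ip f f <= ip g g.
Proof.
move=> sf sg fg; rewrite !ipE; apply: Rint_le; [exact: sf.2|exact: sg.2|].
move=> x; rewrite -[leRHS]real_normK ?num_real// -[leLHS]real_normK ?num_real//.
by rewrite lerXn2r ?nnegrE.
Qed.

(** Cauchy-Schwarz: mean-square convergence implies weak convergence. *)
Lemma ip_cvg (I : Type) (F : set_system I) (FF : Filter F) (fn : I -> T -> R)
    f g : sqitg f -> sqitg g -> (\forall n \near F, sqitg (fn n)) ->
  ip (fun x => fn n x - f x) (fun x => fn n x - f x) @[n --> F] --> 0 ->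
  ip (fn n) g @[n --> F] --> ip f g.
Proof.
move=> sf sg sfn cf; apply/cvgrPdist_lt => e e0.
have g1 : 0 < ip g g + 1 by rewrite ltr_wpDl// ip_ge0.
have e1 : 0 < e ^+ 2 / (ip g g + 1) by rewrite divr_gt0// exprn_gt0.
move/cvgrPdist_lt/(_ _ e1): cf; apply: filterS2 sfn => n sn.
rewrite sub0r normrN ger0_norm ?ip_ge0// => H.
rewrite distrC -ipBl//.
rewrite -ltr_sqr ?nnegrE//; last exact: ltW.
rewrite real_normK ?num_real//.
apply: le_lt_trans (ip_CS (sqitgB sn sf) sg) _.
move: H; rewrite ltr_pdivlMr// => H; apply: le_lt_trans H.
by rewrite ler_wpM2l ?ip_ge0// lerDl.
Qed.

End SquareIntegrable.

(** * Completeness *)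

Section Completeness.
Context d (T : measurableType d) (R : realType) (mu : {measure set T -> \bar R}).
Implicit Types f g h : T -> R.

Lemma sum_half_le2 (n : nat) : \sum_(0 <= k < n) (2^-1 : R) ^+ k <= 2.
Proof.
suff -> : \sum_(0 <= k < n) (2^-1 : R) ^+ k = 2 - 2 * 2^-1 ^+ n.
  by rewrite gerBl mulr_ge0// exprn_ge0.
elim: n => [|n IH]; first by rewrite big_geq// expr0 mulr1 subrr.
by rewrite big_nat_recr//= IH exprS; lra.
Qed.

Lemma limn_einf_le (u : nat -> \bar R) (C : \bar R) :
  (forall n, u n <= C)%E -> (limn_einf u <= C)%E.
Proof.
move=> uC; rewrite limn_einf_lim; apply: lime_le.
  exact: is_cvg_einfs.
apply: nearW => n; apply: le_trans (uC n).
by apply: ereal_inf_lbound; exists n => /=.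
Qed.

(** Fatou's lemma for the squares. *)
Lemma fatou_sq (fn : nat -> T -> R) f (C : R) : (forall n, sqitg mu (fn n)) ->
  (forall n, ip mu (fn n) (fn n) <= C) ->
  (forall x, fn ^~ x @ \oo --> f x) -> sqitg mu f /\ ip mu f f <= C.
Proof.
move=> sfn fnC fnf.
have mf : measurable_fun setT f.
  by apply: (@measurable_fun_cvg _ _ _ _ fn) => // m; exact: sqitg_meas (sfn m).
have fC : (\int[mu]_x (f x ^+ 2)%:E <= C%:E)%E.
  have fE x : limn_einf (fun n => (fn n x ^+ 2)%:E) = (f x ^+ 2)%:E.
    apply: (cvg_limn_einf_sup _).1; apply: cvg_EFin; first exact: nearW.
    by apply: cvgM; exact: fnf.
  under eq_integral => x _ do rewrite -fE.
  apply: le_trans (fatou mu measurableT _ _) _.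
  - by move=> n; apply/measurable_EFinP; exact: measurable_funX (sqitg_meas (sfn n)).
  - by move=> n x _; rewrite lee_fin sqr_ge0.
  by apply: limn_einf_le => n; rewrite ip_EFin// lee_fin.
have sf : sqitg mu f.
  split=> //; apply: itg_ge0P; first exact: measurable_funX.
    by move=> x; exact: sqr_ge0.
  by apply: le_lt_trans fC _; rewrite ltry.
by split=> //; rewrite -lee_fin -ip_EFin.
Qed.

(** The increments D k satisfy |D k| <= 2^-k + 2^k (D k)^2, and the sum of the
    second terms has a finite integral. *)
Lemma rapid_cauchy_ae_cvg (h : nat -> T -> R) : (forall n, sqitg mu (h n)) ->
  (forall n, ip mu (fun x => h n.+1 x - h n x) (fun x => h n.+1 x - h n x)
     <= 4^-1 ^+ n) ->
  exists2 A : set T, measurable A /\ mu (~` A) = 0%E &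
    forall x, A x -> cvgn (h ^~ x).
Proof.
move=> sh hD; pose D k x := h k.+1 x - h k x.
have sD k : sqitg mu (D k) by apply: sqitgB; exact: sh.
pose S x := (\sum_(0 <= k <oo) (2 ^+ k * D k x ^+ 2)%:E)%E.
have mt k : measurable_fun setT (fun x => (2 ^+ k * D k x ^+ 2)%:E).
  apply/measurable_EFinP; apply: measurable_funM => //.
  exact: measurable_funX (sqitg_meas (sD k)).
have t0 k x : (0 <= (2 ^+ k * D k x ^+ 2)%:E)%E.
  by rewrite lee_fin; apply: mulr_ge0; [exact: exprn_ge0|exact: sqr_ge0].
have mS : measurable_fun setT S.
  by apply: ge0_emeasurable_sum => [k x _ _|k _]; [exact: t0|exact: mt].
have IS : (\int[mu]_x S x <= 2%:E)%E.
  rewrite integral_nneseries//; apply: lime_le.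
    by apply: is_cvg_nneseries => n _ _; exact: integral_ge0.
  apply: nearW => n.
  apply: (@le_trans _ _ (\sum_(0 <= k < n) (2^-1 ^+ k)%:E)%E); last first.
    by rewrite sumEFin lee_fin sum_half_le2.
  apply: lee_sum => k _; under eq_integral => x _ do rewrite EFinM.
  rewrite ge0_integralZl//; last 2 first.
  - by apply/measurable_EFinP; exact: measurable_funX (sqitg_meas (sD k)).
  - by move=> x _; rewrite lee_fin sqr_ge0.
  rewrite ip_EFin// -EFinM lee_fin; apply: le_trans (_ : 2 ^+ k * 4^-1 ^+ k <= _).
    by rewrite ler_wpM2l ?exprn_ge0//; exact: hD.
  by rewrite -exprMn (_ : 2 * 4^-1 = 2^-1) //; lra.
have iS : mu.-integrable setT S.
  apply/integrableP; split=> //.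
  under eq_integral => x _ do rewrite gee0_abs ?nneseries_ge0//.
  by apply: le_lt_trans IS _; rewrite ltry.
have mA : measurable [set x | S x \is a fin_num].
  by rewrite -[X in measurable X]setTI; exact: emeasurable_fin_num.
exists [set x | S x \is a fin_num]; first split=> //.
  apply/negligibleP; first exact: measurableC.
  have := integrable_ae measurableT iS; apply: negligibleS => x /= Sx /(_ I).
  exact: Sx.
move=> x /= Sx.
have -> : h ^~ x = (fun n => h 0%N x + series (D ^~ x) n).
  apply/funext => n; rewrite (eq_sum_telescope (h ^~ x) n).
  by [].
apply: is_cvgD; first exact: is_cvg_cst.
apply: normed_cvg; apply: nondecreasing_is_cvgn.
  by apply: nondecreasing_series => k _ _ /=.
exists (2 + fine (S x)) => _ [n _ <-] /=.
rewrite /series /=.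
apply: (@le_trans _ _ (\sum_(0 <= k < n) (2^-1 ^+ k + 2 ^+ k * D k x ^+ 2))).
  apply: ler_sum => k _.
  have : 0 <= (1 - 2 ^+ k * `|D k x|) ^+ 2 / 2 ^+ k.
    by apply: divr_ge0; [exact: sqr_ge0|exact: exprn_ge0].
  have -> : (1 - 2 ^+ k * `|D k x|) ^+ 2 / 2 ^+ k =
     2^-1 ^+ k + 2 ^+ k * D k x ^+ 2 - 2 * `|D k x|.
    rewrite -[D k x ^+ 2]real_normK ?num_real// exprVn.
    by field; rewrite expf_neq0.
  by have := normr_ge0 (D k x); lra.
rewrite big_split/=; apply: lerD; first exact: sum_half_le2.
rewrite -lee_fin -sumEFin fineK//.
by apply: nneseries_lim_ge.
Qed.

Lemma ae_of_null (A : set T) (P : T -> Prop) : measurable A -> mu (~` A) = 0%E ->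
  (forall x, A x -> P x) -> {ae mu, forall x, P x}.
Proof.
move=> mA A0 AP; exists (~` A); split=> //; first exact: measurableC.
by move=> x /= nP Ax; apply: nP; exact: AP.
Qed.

(** The limit is the pointwise one, and Fatou's lemma bounds the distance to it.
    Multiplying by the indicator of the set of convergence makes the convergence
    hold everywhere. *)
Lemma rapid_cauchy_cvg (h : nat -> T -> R) : (forall n, sqitg mu (h n)) ->
  (forall n m, (n <= m)%N ->
    ip mu (fun x => h m x - h n x) (fun x => h m x - h n x) <= 4^-1 ^+ n) ->
  exists2 f, sqitg mu f & forall n,
    ip mu (fun x => h n x - f x) (fun x => h n x - f x) <= 4^-1 ^+ n.
Proof.
move=> sh hD.
have [A [mA A0] Ah] := rapid_cauchy_ae_cvg sh (fun n => hD n n.+1 (leqnSn n)).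
pose h' n x := \1_A x * h n x.
have sh' n : sqitg mu (h' n).
  apply: (@sqitgM_bounded _ _ _ _ 1) => //.
  by move=> x; rewrite indicE; case: (_ \in _); rewrite /= ?normr1 ?normr0.
have hh' n : {ae mu, forall x, h n x = h' n x}.
  apply: (ae_of_null mA A0) => x Ax.
  by rewrite /h' indicE mem_set//= mul1r.
pose f x : R := limn (h' ^~ x).
have h'f x : h' ^~ x @ \oo --> f x.
  rewrite /f /h' indicE; have [xA|xA] := boolP (x \in A) => /=.
    under eq_fun do rewrite mul1r.
    by have := Ah x (set_mem xA).
  by under eq_fun do rewrite mul0r; exact: is_cvg_cst.
have key n : sqitg mu (fun x => h' n x - f x) /\
    ip mu (fun x => h' n x - f x) (fun x => h' n x - f x) <= 4^-1 ^+ n.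
  apply: (@fatou_sq (fun m x => h' n x - h' (m + n)%N x)).
  - by move=> m; exact: sqitgB.
  - move=> m; rewrite (@ip_ae _ _ _ _ _ _ (fun x => h n x - h (m + n)%N x)
      (fun x => h n x - h (m + n)%N x)); first last.
    + by apply: filterS2 (hh' n) (hh' (m + n)%N) => x -> ->.
    + by apply: filterS2 (hh' n) (hh' (m + n)%N) => x -> ->.
    1-4: by apply: sqitgB.
    apply: le_trans (hD n (m + n)%N (leq_addl _ _)).
    rewrite le_eqVlt; apply/orP; left; apply/eqP; apply: eq_Rintegral => x _.
    by ring.
  - move=> x; apply: cvgB; first exact: cvg_cst.
    by have := h'f x; rewrite -(cvg_shiftn n).
exists f.
  have -> : f = (fun x => h' 0%N x - (h' 0%N x - f x)).
    by apply/funext => x; ring.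
  by apply: sqitgB => //; exact: (key 0%N).1.
have sf : sqitg mu f.
  have -> : f = (fun x => h' 0%N x - (h' 0%N x - f x)).
    by apply/funext => x; ring.
  by apply: sqitgB => //; exact: (key 0%N).1.
move=> n; rewrite (@ip_ae _ _ _ _ _ _ (fun x => h' n x - f x)
      (fun x => h' n x - f x)); first exact: (key n).2.
1-4: by apply: sqitgB.
all: by apply: filterS (hh' n) => x ->.
Qed.

(** Riesz-Fischer: a Cauchy sequence has a rapidly Cauchy subsequence, and
    converges to the limit of the latter. *)
Lemma sqitg_complete (fn : nat -> T -> R) (r : nat -> R) :
  (forall n, sqitg mu (fn n)) -> r @ \oo --> 0 ->
  (forall n m, (n <= m)%N ->
    ip mu (fun x => fn m x - fn n x) (fun x => fn m x - fn n x) <= r n) ->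
  exists2 f, sqitg mu f &
    ip mu (fun x => fn n x - f x) (fun x => fn n x - f x) @[n --> \oo] --> 0.
Proof.
move=> sfn r0 fr.
have N k : exists N, forall n, (N <= n)%N -> r n <= 4^-1 ^+ k.
  have e0 : 0 < 4^-1 ^+ k :> R by rewrite exprn_gt0.
  have [M _ HM] := (cvgrPdist_le _ _).1 r0 _ e0.
  exists M => n Mn; apply: le_trans (ler_norm _) _.
  by have := HM n Mn; rewrite /= sub0r normrN.
have [N0 HN0] := choice N.
pose nk k := (\max_(j < k.+1) N0 j)%N.
have nkN k : (N0 k <= nk k)%N by exact: (leq_bigmax (ord_max : 'I_k.+1)).
have nkm k l : (k <= l)%N -> (nk k <= nk l)%N.
  move=> kl; apply/bigmax_leqP => i _.
  have il : (i < l.+1)%N by apply: leq_trans (ltn_ord i) _.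
  exact: (leq_bigmax (Ordinal il)).
have [|n m nm|f sf Hf] := @rapid_cauchy_cvg (fun k => fn (nk k)).
- by move=> k; exact: sfn.
- by apply: le_trans (fr _ _ (nkm _ _ nm)) _; apply: HN0; exact: nkN.
exists f => //; apply/cvgrPdist_le => e e0.
(* 4 accounts for 2 |fn n - fn (nk k)|^2 + 2 |fn (nk k) - f|^2. *)
have [k Hk] : exists k, 4 * 4^-1 ^+ k <= e.
  have /cvgrPdist_le/(_ _ e0)[k _ Hk] : geometric (4 : R) 4^-1 @ \oo --> 0.
    by apply: cvg_geometric; rewrite ger0_norm//; lra.
  exists k; apply: le_trans (ler_norm _) _.
  by have := Hk k (leqnn k); rewrite /= sub0r normrN.
exists (nk k) => // n /= kn; rewrite sub0r normrN ger0_norm ?ip_ge0//.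
apply: le_trans Hk.
have -> : (fun x => fn n x - f x) =
  (fun x => (fn n x - fn (nk k) x) + (fn (nk k) x - f x)).
  by apply/funext => x; ring.
apply: le_trans (ip_add_le (sqitgB (sfn _) (sfn _)) (sqitgB (sfn _) sf)) _.
have := fr _ _ kn; have := Hf k; have := HN0 k (nk k) (nkN k); lra.
Qed.

End Completeness.

(** * Fubini's theorem and measure preserving maps *)

(** Partial integrals take values in the extended reals and are finite only almost
    everywhere; this lemma brings them back to real-valued functions. *)
Lemma integrable_fine d (T : measurableType d) (R : realType)
    (mu : {measure set T -> \bar R}) (F : T -> \bar R) : mu.-integrable setT F ->
  itg mu (fine \o F) /\ fine (\int[mu]_x F x)%E = \int[mu]_x fine (F x).
Proof.
move=> Fi; have mF := measurable_int mu Fi.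
have mfF : measurable_fun setT (EFin \o (fine \o F)).
  by apply/measurable_EFinP; exact: measurableT_comp.
have FE : {ae mu, forall x, setT x -> F x = (EFin \o (fine \o F)) x}.
  have := integrable_ae measurableT Fi; apply: filterS => x /= Fx _.
  by rewrite fineK//; exact: Fx.
split.
  move/integrableP: Fi => [_ Foo]; apply/integrableP; split=> //.
  rewrite (ae_eq_integral (fun x => `|F x|)%E)//.
  - exact: measurableT_comp.
  - exact: measurableT_comp.
  - by apply: filterS FE => x H xT; rewrite -H.
by rewrite /Rintegral; congr fine; exact: ae_eq_integral.
Qed.

Section RealFubini.
Context d1 d2 (T1 : measurableType d1) (T2 : measurableType d2) (R : realType).
Variable m1 : {sigma_finite_measure set T1 -> \bar R}.
Variable m2 : {sigma_finite_measure set T2 -> \bar R}.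
Implicit Type h : T1 * T2 -> R.

Lemma fubini_ae1 h : itg (m1 \x m2)%E h ->
  {ae m1, forall x, itg m2 (fun y => h (x, y))}.
Proof. exact: ae_integrable1. Qed.

Lemma fubini_ae2 h : itg (m1 \x m2)%E h ->
  {ae m2, forall y, itg m1 (fun x => h (x, y))}.
Proof. exact: ae_integrable2. Qed.

Lemma fubini_itg1 h : itg (m1 \x m2)%E h -> itg m1 (fun x => \int[m2]_y h (x, y)).
Proof. by move=> /integrable_fubini_F /integrable_fine[]. Qed.

Lemma integrable_fubini_G h : itg (m1 \x m2)%E h ->
  m2.-integrable setT (fun y => \int[m1]_x (h (x, y))%:E)%E.
Proof.
move=> hi; have mh := measurable_int _ hi.
apply/integrableP; split; first exact: measurable_fubini_G hi.
apply: le_lt_trans ((integrable21ltyP m1 m2 mh).1 hi).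
apply: ge0_le_integral => //.
- by apply: measurableT_comp => //; exact: measurable_fubini_G hi.
- apply: (@measurable_fun_fubini_tonelli_G _ _ _ _ _ m1 (fun p => `|(h p)%:E|%E)) => //.
  exact: measurableT_comp.
- move=> y _; apply: le_abse_integral => //.
  exact: (measurableT_comp mh (pair2_measurable y)).
Qed.

Lemma fubini_itg2 h : itg (m1 \x m2)%E h -> itg m2 (fun y => \int[m1]_x h (x, y)).
Proof. by move=> /integrable_fubini_G /integrable_fine[]. Qed.

Lemma Rfubini1 h : itg (m1 \x m2)%E h ->
  \int[(m1 \x m2)%E]_p h p = \int[m1]_x \int[m2]_y h (x, y).
Proof.
move=> hi; have /integrable_fine[_ <-] := integrable_fubini_F hi.
by rewrite /Rintegral (integral12_prod_meas1 hi).
Qed.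

Lemma Rfubini2 h : itg (m1 \x m2)%E h ->
  \int[(m1 \x m2)%E]_p h p = \int[m2]_y \int[m1]_x h (x, y).
Proof.
move=> hi; have /integrable_fine[_ <-] := integrable_fubini_G hi.
by rewrite /Rintegral (integral21_prod_meas1 hi).
Qed.

Lemma itg_prod (f : T1 -> R) (g : T2 -> R) : itg m1 f -> itg m2 g ->
  itg (m1 \x m2)%E (fun p => f p.1 * g p.2).
Proof.
move=> fi gi; have mfg : measurable_fun setT (fun p : T1 * T2 => f p.1 * g p.2).
  by apply: measurable_funM; apply: measurableT_comp => //;
    [exact: itg_meas fi|exact: itg_meas gi].
apply/(@integrable12ltyP _ _ _ _ _ m1 m2 (EFin \o _)); first exact/measurable_EFinP.
have gE : (\int[m2]_y `|(g y)%:E|)%E = (\int[m2]_y `|g y|)%:E.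
  rewrite -Rint_EFin; last exact: integrable_norm.
  by [].
rewrite (eq_integral (fun x => (\int[m2]_y `|g y|)%:E * `|(f x)%:E|)%E).
  rewrite ge0_integralZl//; last 2 first.
  - by apply: measurableT_comp => //; exact: measurable_int fi.
  - by rewrite lee_fin; apply: Rint_ge0 => y.
  rewrite lte_mul_pinfty//; first by rewrite lee_fin; apply: Rint_ge0 => y.
  by move/integrableP: fi => [].
move=> x _ /=; rewrite -gE muleC -ge0_integralZl//; last first.
  by apply: measurableT_comp => //; exact: measurable_int gi.
by apply: eq_integral => y _; rewrite normrM EFinM.
Qed.

Lemma Rint_prod (f : T1 -> R) (g : T2 -> R) : itg m1 f -> itg m2 g ->
  \int[(m1 \x m2)%E]_p (f p.1 * g p.2) = \int[m1]_x f x * \int[m2]_y g y.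
Proof.
move=> fi gi; rewrite (Rfubini1 (itg_prod fi gi)) -RintegralZr//.
by apply: eq_Rintegral => x _ /=; rewrite RintegralZl.
Qed.

Lemma Rfubini h : itg (m1 \x m2)%E h ->
  \int[m1]_x \int[m2]_y h (x, y) = \int[m2]_y \int[m1]_x h (x, y).
Proof. by move=> hi; rewrite -Rfubini1// Rfubini2. Qed.

(** P fails inside a null set, the measures of whose sections have integral zero. *)
Lemma ae_prod1 (P : T1 * T2 -> Prop) : {ae (m1 \x m2)%E, forall p, P p} ->
  {ae m1, forall x, {ae m2, forall y, P (x, y)}}.
Proof.
move=> [A [mA A0 PA]].
have mx := measurable_fun_xsection m2 mA.
have : {ae m1, forall x, setT x -> (m2 \o xsection A) x = 0%E}.
  apply/(ae_eq_integral_abs m1 measurableT (f := (m2 \o xsection A)))=> //.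
  by under eq_integral => x _ do rewrite gee0_abs//.
apply: filterS => x /(_ I) /= Ax; exists (xsection A x); split=> //.
  exact: measurable_xsection.
by move=> y nP; rewrite /xsection /= inE; apply: PA.
Qed.

End RealFubini.

Section MeasurePreserving.
Context d (T : measurableType d) (R : realType) (m : {measure set T -> \bar R}).
Variables (phi : T -> T) (mphi : measurable_fun setT phi).
Hypothesis mphiE : forall A, measurable A -> m (phi @^-1` A) = m A.

Lemma ge0_integral_preserving (f : T -> \bar R) : measurable_fun setT f ->
  (forall x, 0 <= f x)%E -> (\int[m]_x f (phi x) = \int[m]_x f x)%E.
Proof.
move=> mf f0; rewrite -[LHS](ge0_integral_pushforward mphi m measurableT)//.
  by apply: eq_measure_integral => A mA _; exact: mphiE.
Qed.

Lemma itg_preserving (f : T -> R) : itg m f -> itg m (fun x => f (phi x)).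
Proof.
move=> fi; have mf := measurable_int _ fi.
apply/integrableP; split; first exact: measurableT_comp mf mphi.
rewrite (ge0_integral_preserving (f := fun x => `|(f x)%:E|%E))//.
  by move/integrableP: fi => [].
exact: measurableT_comp.
Qed.

Lemma Rint_preserving (f : T -> R) : measurable_fun setT f ->
  \int[m]_x f (phi x) = \int[m]_x f x.
Proof.
move=> /measurable_EFinP mf; rewrite /Rintegral; congr fine.
rewrite integralE [RHS]integralE; congr (_ - _)%E.
  rewrite -[RHS]ge0_integral_preserving//; last exact: measurable_funepos.
  by apply: eq_integral => x _; rewrite !funeposE.
rewrite -[RHS]ge0_integral_preserving//; last exact: measurable_funeneg.
by apply: eq_integral => x _; rewrite !funenegE.
Qed.

End MeasurePreserving.

Section Plane.
Context (R : realType).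
Local Notation mu := (@lebesgue_measure R).
Local Notation mu2 := (plane_measure R).

(** Lebesgue measure is determined by the length of intervals, which translations
    and the reflection preserve. *)
Lemma lebesgue_translate (a : R) (A : set R) : measurable A ->
  mu ((fun x => x + a) @^-1` A) = mu A.
Proof.
have mf : measurable_fun (setT : set (measurableTypeR R)) (fun x : R => x + a : measurableTypeR R).
  exact: measurable_funD.
pose mf' := isMeasurableFun.Build _ _ _ _ _ mf.
pose F : {mfun measurableTypeR R >-> measurableTypeR R} := HB.pack (fun x : R => x + a : measurableTypeR R) mf'.
move=> mA; apply/esym; apply: (@lebesgue_measure_unique _ (pushforward mu F)) => //.
move=> X [[b c] _ <-]; rewrite /pushforward.
rewrite [X in _ = mu X](_ : _ = `](b - a), (c - a)]%classic); last first.
  by apply/seteqP; split => x /=; rewrite !in_itv/= ltrBlDr lerBrDr.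
rewrite !lebesgue_measure_itv/= !lte_fin ltrD2r; case: ifP => // _.
by congr (_%:E); ring.
Qed.

Lemma lebesgue_reflect (A : set R) : measurable A ->
  mu ((fun x => - x) @^-1` A) = mu A.
Proof.
have mf : measurable_fun (setT : set (measurableTypeR R)) (fun x : R => - x : measurableTypeR R).
  exact: measurable_funN.
pose mf' := isMeasurableFun.Build _ _ _ _ _ mf.
pose F : {mfun measurableTypeR R >-> measurableTypeR R} := HB.pack (fun x : R => - x : measurableTypeR R) mf'.
move=> mA; apply/esym; apply: (@lebesgue_measure_unique _ (pushforward mu F)) => //.
move=> X [[b c] _ <-]; rewrite /pushforward.
rewrite [X in _ = mu X](_ : _ = `[- c, - b[%classic); last first.
  by apply/seteqP; split => x /=; rewrite !in_itv/= ltrNr lerNl andbC.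
rewrite !lebesgue_measure_itv/= !lte_fin ltrN2; case: ifP => // _.
by congr (_%:E); ring.
Qed.

Definition shift2 (a p : R * R) : R * R := (p.1 + a.1, p.2 + a.2).

Let T2 := (measurableTypeR R * measurableTypeR R)%type.

Lemma measurable_shift2 a : measurable_fun (setT : set T2) (shift2 a : T2 -> T2).
Proof.
apply/measurable_fun_pairP; split; rewrite /comp /=.
  by apply: measurable_funD => //; exact: measurable_fst.
by apply: measurable_funD => //; exact: measurable_snd.
Qed.

Lemma plane_translate (a : R * R) (A : set T2) : measurable A ->
  mu2 (shift2 a @^-1` A) = mu2 A.
Proof.
move=> mA; apply/esym; have mf := measurable_shift2 a.
pose mf' := isMeasurableFun.Build _ _ T2 T2 (shift2 a) mf.
pose F : {mfun T2 >-> T2} := HB.pack (shift2 a : T2 -> T2) mf'.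
apply: (@product_measure_unique _ _ _ _ R mu mu (@pushforward _ _ T2 T2 R mu2 F)) => //.
move=> B C mB mC; rewrite /pushforward.
have mt (b : R) (D : set (measurableTypeR R)) : measurable D ->
    measurable ((fun x : measurableTypeR R => x + b) @^-1` D).
  move=> mD; rewrite -[X in measurable X]setTI.
  by apply: (@measurable_funD _ (measurableTypeR R) R setT) => //.
rewrite -[LHS]/(mu2 (((fun x => x + a.1) @^-1` B) `*` ((fun x => x + a.2) @^-1` C))).
rewrite (product_measure1E mu mu (mt a.1 B mB) (mt a.2 C mC)).
by congr (_ * _)%E; exact: lebesgue_translate.
Qed.

Lemma itg_translate (a : R * R) (f : R * R -> R) : itg mu2 f ->
  itg mu2 (fun p => f (shift2 a p)).
Proof. exact: (itg_preserving (measurable_shift2 a) (@plane_translate a)). Qed.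

Lemma Rint_translate (a : R * R) (f : R * R -> R) : itg mu2 f ->
  \int[mu2]_p f (shift2 a p) = \int[mu2]_p f p.
Proof.
move=> /itg_meas mf.
exact: (Rint_preserving (measurable_shift2 a) (@plane_translate a) mf).
Qed.

Lemma Rint_reflect (f : R -> R) : itg mu f ->
  \int[mu]_x f (- x) = \int[mu]_x f x.
Proof.
move=> /itg_meas mf.
apply: (Rint_preserving (T := measurableTypeR R) _ lebesgue_reflect mf).
exact: (@measurable_funN _ (measurableTypeR R) R setT).
Qed.

End Plane.

(** * Density of step functions *)

Section Density.
Import HBNNSimple.
Context d (T : measurableType d) (R : realType) (m : {measure set T -> \bar R}).

Lemma Rint_dct (fn : nat -> T -> R) (f g : T -> R) :
  (forall n, measurable_fun setT (fn n)) -> itg m g ->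
  (forall n x, `|fn n x| <= g x) -> (forall x, fn ^~ x @ \oo --> f x) ->
  itg m f /\ (\int[m]_x fn n x @[n --> \oo] --> \int[m]_x f x).
Proof.
move=> mfn gi fg fnf.
have mf : measurable_fun setT f by apply: (@measurable_fun_cvg _ _ _ _ fn).
have [|||||fi _ cv] := @dominated_convergence _ _ _ m setT measurableT
  (fun n => EFin \o fn n) (EFin \o f) (EFin \o g).
- by move=> n; exact/measurable_EFinP.
- exact/measurable_EFinP.
- by apply: nearW => x _; apply: cvg_EFin; [exact: nearW|exact: fnf].
- exact: gi.
- by apply: nearW => x n _ /=; rewrite lee_fin.
split=> //; apply: fine_cvg; rewrite /= in cv *.
by rewrite -Rint_EFin.
Qed.

(** The squares |fn n - f|^2 are dominated by 4 g^2. *)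
Lemma sq_dct (fn : nat -> T -> R) (f g : T -> R) :
  (forall n, measurable_fun setT (fn n)) -> sqitg m g ->
  (forall n x, `|fn n x| <= `|g x|) -> (forall x, fn ^~ x @ \oo --> f x) ->
  sqitg m f /\ ip m (fun x => fn n x - f x) (fun x => fn n x - f x) @[n --> \oo] --> 0.
Proof.
move=> mfn sg fg fnf.
have mf : measurable_fun setT f by apply: (@measurable_fun_cvg _ _ _ _ fn).
have fg' x : `|f x| <= `|g x|.
  by apply: (cvgr_to_le (cvg_norm (fnf x))); apply: nearW => n; exact: fg.
have sf : sqitg m f by exact: sqitg_le sg.
split=> //.
have [||||] := @Rint_dct (fun n x => (fn n x - f x) * (fn n x - f x)) (fun=> 0)
  (fun x => 4 * g x ^+ 2).
- by move=> n; apply: measurable_funM; exact: measurable_funB.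
- by apply: itgZ; exact: sg.2.
- move=> n x; rewrite -expr2 normrX.
  have -> : 4 * g x ^+ 2 = (`|g x| + `|g x|) ^+ 2.
    by rewrite -[g x ^+ 2]real_normK ?num_real//; ring.
  rewrite lerXn2r ?nnegrE ?addr_ge0//.
  by apply: le_trans (ler_normB _ _) _; apply: lerD.
- move=> x; rewrite -[X in _ --> X](mulr0 0).
  have fx0 : fn n x - f x @[n --> \oo] --> 0.
    by rewrite -(subrr (f x)); apply: cvgB; [exact: fnf|exact: cvg_cst].
  exact: cvgM.
move=> _; rewrite (_ : \int[m]_x (fun=> 0 : R) x = 0)//.
by rewrite Rintegral_cst// mul0r.
Qed.

Variables (G : set (set T)) (Q : nat -> set T).
Hypothesis GI : setI_closed G.
Hypothesis Gm : @measurable _ T = <<s G>>.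
Hypotheses (GQ : forall n, G (Q n)) (Qoo : forall n, (m (Q n) < +oo)%E).
Hypotheses (Qnd : nondecreasing_seq Q) (QT : \bigcup_n Q n = setT).

Lemma cvg_indic_bigcup (F : nat -> set T) x : nondecreasing_seq F ->
  \1_(F n) x @[n --> \oo] --> (\1_(\bigcup_n F n) x : R).
Proof.
move=> ndF; rewrite indicE; have [|xF] := boolP (x \in _).
  rewrite inE => -[k _ Fkx]; apply: (@cvg_trans _ (1 @[n --> \oo])); last exact: cvg_cst.
  apply: near_eq_cvg; exists k => // n /= kn.
  by rewrite indicE mem_set//; move/ndF/subsetPset: kn; apply.
apply: (@cvg_trans _ (0 @[n --> \oo])); last exact: cvg_cst.
apply: near_eq_cvg; apply: nearW => n /=; rewrite indicE memNset// => Fnx.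
by move: xF; rewrite notin_setE; apply; exists n.
Qed.

Lemma indic_le1 (A : set T) x : `|\1_A x| <= 1 :> R.
Proof. by rewrite indicE; case: (_ \in _); rewrite /= ?normr1 ?normr0. Qed.

(** The sets whose indicator, cut by Q n, satisfies P form a lambda-system, so that
    the pi-system G is enough to reach all measurable sets; step functions follow by
    linearity, nonnegative functions by monotone approximation, and all functions
    by splitting into positive and negative parts. *)
Lemma sqitg_ind (P : (T -> R) -> Prop) :
  (forall f g, sqitg m f -> sqitg m g -> P f -> P g -> P (fun x => f x + g x)) ->
  (forall a f, sqitg m f -> P f -> P (fun x => a * f x)) ->
  (forall fn f, (forall n, sqitg m (fn n)) -> (forall n, P (fn n)) ->
     sqitg m f ->
     ip m (fun x => fn n x - f x) (fun x => fn n x - f x) @[n --> \oo] --> 0 ->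
     P f) ->
  (forall A, G A -> (m A < +oo)%E -> P \1_A) ->
  forall f, sqitg m f -> P f.
Proof.
move=> PD PZ Plim PG.
have Gmeas A : G A -> measurable A by move=> GA; rewrite Gm; exact: sub_sigma_algebra.
have QI_oo n E : measurable E -> (m (E `&` Q n) < +oo)%E.
  move=> mE; apply: le_lt_trans (Qoo n); apply: le_measure; rewrite ?inE//.
  - by apply: measurableI => //; exact: Gmeas.
  - exact: Gmeas.
have sEQ n E : measurable E -> sqitg m \1_(E `&` Q n).
  by move=> mE; apply: sqitg_indic; [apply: measurableI => //; exact: Gmeas|exact: QI_oo].
have PE n E : measurable E -> P \1_(E `&` Q n).
  move=> mE; pose H := [set E | measurable E /\ P \1_(E `&` Q n)].
  suff : <<s G>> `<=` H by rewrite -Gm => /(_ _ mE)[].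
  apply: (lambda_system_subset GI) => //; last first.
    move=> A GA; split; first exact: Gmeas.
    by apply: PG; [exact: GI|apply: QI_oo; exact: Gmeas].
  split => //.
  - by split=> //; rewrite setTI; exact: PG.
  - move=> A B BA [mA PA] [mB PB]; split; first exact: measurableD.
    rewrite (_ : \1_((A `\` B) `&` Q n) =
      fun x => \1_(A `&` Q n) x + (-1) * \1_(B `&` Q n) x).
      apply: PD; [exact: sEQ|by apply: sqitgZ; exact: sEQ|exact: PA|].
      by apply: PZ => //; exact: sEQ.
    apply/funext => x; rewrite !indicE (in_setI x (A `\` B)) in_setD !in_setI.
    have BAx : x \in B -> x \in A by rewrite !inE; exact: BA.
    case: (x \in B) BAx => [/(_ isT) ->|_]; case: (x \in Q n); case: (x \in A) => /=;
      by ring.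
  - move=> F ndF HF; have mU : measurable (\bigcup_i F i).
      by apply: bigcup_measurable => i _; exact: (HF i).1.
    split=> //; apply: (Plim (fun i => \1_(F i `&` Q n))).
    + by move=> i; apply: sEQ; exact: (HF i).1.
    + by move=> i; exact: (HF i).2.
    + exact: sEQ.
    apply: (sq_dct (g := \1_(Q n)) _ _ _ _).2.
    + by move=> i; apply: sqitg_meas; apply: sEQ; exact: (HF i).1.
    + by rewrite -(setTI (Q n)); exact: sEQ.
    + move=> i x; rewrite !indicE in_setI; case: (_ \in F i) => //=.
      by rewrite normr0.
    + move=> x; rewrite setI_bigcupl; apply: cvg_indic_bigcup => i j ij.
      by apply/subsetPset; apply: setSI; apply/subsetPset; exact: ndF.
have Psum (s : seq R) (F : R -> T -> R) : (forall i, sqitg m (F i)) ->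
    (forall i, P (F i)) ->
    sqitg m (fun x => \sum_(i <- s) F i x) /\ P (fun x => \sum_(i <- s) F i x).
  move=> sF PF; elim: s => [|k s IH].
    under eq_fun do rewrite big_nil.
    split; first exact: sqitg0.
    rewrite (_ : (fun=> 0) = fun x => 0 * \1_(set0 `&` Q 0%N) x :> R); last first.
      by apply/funext => x; rewrite mul0r.
    by apply: PZ; [exact: sEQ|exact: PE].
  under eq_fun do rewrite big_cons.
  have [sI PI] := IH.
  by split; [exact: sqitgD|exact: PD].
have Pnn f : (forall x, 0 <= f x) -> sqitg m f -> P f.
  move=> f0 sf; have mf : measurable_fun setT (EFin \o f).
    by apply/measurable_EFinP; exact: sqitg_meas sf.
  pose ph := nnsfun_approx measurableT mf.
  have phf x : ph n x @[n --> \oo] --> f x.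
    have := cvg_nnsfun_approx measurableT mf (fun x _ => f0 x : (0 <= (EFin \o f) x)%E) (I : setT x).
    by move=> /fine_cvg; exact.
  have phle n x : `|ph n x| <= f x.
    rewrite ger0_norm//; rewrite -(cvg_lim (@Rhausdorff R) (phf x)).
    apply: (@nondecreasing_cvgn_le _ (fun n => ph n x)).
      by move=> i j ij; exact/lefP/nd_nnsfun_approx.
    by apply/cvg_ex; exists (f x).
  have Pph n : P (fun x => ph n x * \1_(Q n) x).
    rewrite (_ : (fun x => _) = fun x => \sum_(y <- finmap.enum_fset (fset_set (range (ph n))))
      (y * \1_(ph n @^-1` [set y] `&` Q n) x)); last first.
      apply/funext => x; rewrite [in LHS]fimfunE fsbig_finite//= mulr_suml.
      by apply: eq_bigr => i _; rewrite -mulrA indicI.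
    by apply: (Psum _ _ _ _).2 => i; [apply: sqitgZ; exact: sEQ|apply: PZ; [exact: sEQ|exact: PE]].
  have dct := @sq_dct (fun n x => ph n x * \1_(Q n) x) f f.
  have mQ n : measurable_fun setT (fun x => ph n x * \1_(Q n) x).
    by apply: measurable_funM => //; apply: measurable_indic; exact: Gmeas.
  have bQ n x : `|ph n x * \1_(Q n) x| <= `|f x|.
    rewrite normrM (ger0_norm (f0 x)); apply: le_trans (phle n x).
    by rewrite ler_piMr// indic_le1.
  apply: (Plim (fun n x => ph n x * \1_(Q n) x)) => //.
    by move=> n; apply: sqitg_le sf.
  apply: (dct _ _ _ _).2 => //.
  move=> x; have Q1 : \1_(\bigcup_n Q n) x = 1 :> R by rewrite QT indicT.
  by rewrite -[f x]mulr1 -Q1; apply: cvgM; [exact: phf|exact: cvg_indic_bigcup].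
move=> f sf.
rewrite (_ : f = fun x => Num.max (f x) 0 + (-1) * Num.max (- f x) 0); last first.
  apply/funext => x; have /orP[h|h] := le_total 0 (f x).
    by rewrite (max_l h) max_r ?oppr_le0//; ring.
  by rewrite (max_r h) max_l ?oppr_ge0//; ring.
have smax g : sqitg m g -> sqitg m (fun x => Num.max (g x) 0).
  move=> sg; apply: (sqitg_le _ _ sg); first exact: measurable_maxr (sqitg_meas sg) _.
  by move=> x; rewrite /Num.max; case: ltP => _; rewrite ?normr0.
have sN := sqitgN sf.
apply: PD; [exact: smax|by apply: sqitgZ; exact: smax| |apply: PZ; [exact: smax|]].
  by apply: Pnn; [move=> x; rewrite le_max lexx orbT|exact: smax].
by apply: Pnn; [move=> x; rewrite le_max lexx orbT|exact: smax].
Qed.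

End Density.

(** * The plane: rectangles and continuity of translations *)

Section PlaneDensity.
Context (R : realType).
Local Notation mu := (@lebesgue_measure R).
Local Notation mu2 := (plane_measure R).
Let T2 := (measurableTypeR R * measurableTypeR R)%type.

Let rect : set (set T2) := [set A `*` B | A in @ocitv R & B in @ocitv R].

Let square (n : nat) : set T2 :=
  [set` `]- n%:R, n%:R : R]] `*` [set` `]- n%:R, n%:R : R]].

Lemma bigcup_square : \bigcup_n square n = setT.
Proof.
apply/seteqP; split => // p _.
exists (Num.truncn (`|p.1| + `|p.2|)).+1 => //.
have H : `|p.1| + `|p.2| < (Num.truncn (`|p.1| + `|p.2|)).+1%:R.
  by apply: truncnS_gt; rewrite addr_ge0.
have H1 := ler_norm p.1; have H2 := ler_norm (- p.1).
have H3 := ler_norm p.2; have H4 := ler_norm (- p.2).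
rewrite !normrN in H2 H4; have := normr_ge0 p.1; have := normr_ge0 p.2.
by split => /=; rewrite in_itv/=; apply/andP; split; lra.
Qed.

Lemma square_lty n : (mu2 (square n) < +oo)%E.
Proof.
have fin : (mu ([set` `]- n%:R, n%:R : R]%R] : set R) < +oo)%E.
  by rewrite lebesgue_measure_itv/=; case: ifP => _; rewrite ?ltry.
rewrite [X in (X < _)%E](product_measure1E mu mu)//.
by apply: lte_mul_pinfty => //; rewrite ge0_fin_numE.
Qed.

(** A name for the plane measure that carries its sigma-finiteness, as the products
    of planes below require. *)
Definition plane : set T2 -> \bar R := mu2.

HB.instance Definition _ := Measure.copy plane mu2.

Lemma plane_sigma_finite : sigma_finite setT plane.
Proof.
exists square; first by rewrite bigcup_square.
by move=> n; split; [exact: measurableX|exact: square_lty].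
Qed.

HB.instance Definition _ :=
  Measure_isSigmaFinite.Build _ T2 R plane plane_sigma_finite.

(** A set A x B is the intersection of A x R and R x B, and a band A x R over a
    half-open interval A is a countable union of half-open rectangles. *)
Lemma measurable_rect : @measurable _ T2 = <<s rect>>.
Proof.
have [S0 SC SU] := smallest_sigma_algebra setT rect.
have SI A B : <<s rect>> A -> <<s rect>> B -> <<s rect>> (A `&` B).
  move=> SA SB; rewrite -(setCK (A `&` B)) -(setTD (~` _)); apply: (SC _).
  rewrite setCI -bigcup2E; apply: (SU _) => -[|[|n]]; rewrite /bigcup2/=.
  - by rewrite -setTD; apply: (SC _).
  - by rewrite -setTD; apply: (SC _).
  - exact: S0.
have sq : \bigcup_n ([set` `]- n%:R, n%:R : R]] : set R) = setT.
  apply/seteqP; split => // x _.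
  have : setT (x, 0 : R) by [].
  by rewrite -bigcup_square => -[n _ [nx _]]; exists n.
apply/seteqP; split; last first.
  apply: smallest_sub; first exact: sigma_algebra_measurable.
  move=> _ [A oA [B oB <-]]; apply: measurableX.
    exact: sub_sigma_algebra.
  exact: sub_sigma_algebra.
rewrite measurable_prod_measurableType; apply: smallest_sub.
  exact: smallest_sigma_algebra.
move=> _ [A mA [B mB <-]].
rewrite (_ : A `*` B = (A `*` setT) `&` (setT `*` B)); last first.
  by rewrite -setXI setIT setTI.
apply: (SI _ _).
- suff : <<s @ocitv R>> `<=` [set A | <<s rect>> (A `*` setT)] by move=> /(_ _ mA).
  apply: smallest_sub; first split.
  + by rewrite /= set0X.
  + move=> C SC'; rewrite /= (_ : _ `*` _ = setT `\` (C `*` setT)); first exact: (SC _).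
    by apply/seteqP; split => p /=; tauto.
  + by move=> F SF; rewrite /= setX_bigcupl; apply: (SU _) => i; exact: SF.
  + move=> C oC; rewrite /= -sq setX_bigcupr; apply: (SU _) => n.
    by apply: sub_sigma_algebra; exists C => //; exists [set` `]- n%:R, n%:R]] => //; exact: is_ocitv.
- suff : <<s @ocitv R>> `<=` [set A | <<s rect>> (setT `*` A)] by move=> /(_ _ mB).
  apply: smallest_sub; first split.
  + by rewrite /= setX0.
  + move=> C SC'; rewrite /= (_ : _ `*` _ = setT `\` (setT `*` C)); first exact: (SC _).
    by apply/seteqP; split => p /=; tauto.
  + by move=> F SF; rewrite /= setX_bigcupr; apply: (SU _) => i; exact: SF.
  + move=> C oC; rewrite /= -sq setX_bigcupl; apply: (SU _) => n.
    by apply: sub_sigma_algebra; exists [set` `]- n%:R, n%:R]]; [exact: is_ocitv|exists C].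
Qed.

(** The half-open rectangles are a pi-system that generates the measurable sets. *)
Lemma plane_sqitg_ind (P : (R * R -> R) -> Prop) :
  (forall f g : R * R -> R, sqitg mu2 f -> sqitg mu2 g -> P f -> P g -> P (fun x => f x + g x)) ->
  (forall a (f : R * R -> R), sqitg mu2 f -> P f -> P (fun x => a * f x)) ->
  (forall (fn : nat -> R * R -> R) (f : R * R -> R), (forall n, sqitg mu2 (fn n)) -> (forall n, P (fn n)) ->
     sqitg mu2 f ->
     ip mu2 (fun x => fn n x - f x) (fun x => fn n x - f x) @[n --> \oo] --> 0 ->
     P f) ->
  (forall a b c d : R, P \1_([set` `]a, b]] `*` [set` `]c, d]])) ->
  forall f, sqitg mu2 f -> P f.
Proof.
move=> PD PZ Plim PR; apply: (@sqitg_ind _ T2 R mu2 rect square) => //.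
- move=> _ _ [A oA [B oB <-]] [A' oA' [B' oB' <-]].
  exists (A `&` A'); first exact: ocitvI.
  by exists (B `&` B'); [exact: ocitvI|rewrite setXI].
- exact: measurable_rect.
- move=> n; exists `]- n%:R, n%:R]%classic; first by exists (- n%:R, n%:R).
  by exists `]- n%:R, n%:R]%classic => //; exists (- n%:R, n%:R).
- exact: square_lty.
- move=> i j ij; apply/subsetPset; have ij' : i%:R <= j%:R :> R by rewrite ler_nat.
  by move=> p [/= /[!in_itv]/= /andP[? ?] /andP[? ?]]; split;
    rewrite /= in_itv/=; apply/andP; split; lra.
- exact: bigcup_square.
- by move=> _ [A [[a b] _ <-] [B [[c d] _ <-] <-]] _; exact: PR.
Qed.

Lemma sqitg_translate (a : R * R) (f : R * R -> R) : sqitg mu2 f ->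
  sqitg mu2 (fun p => f (shift2 a p)).
Proof.
move=> [mf fi]; split; last exact: (itg_translate a fi).
exact: (measurableT_comp mf (@measurable_shift2 R a)).
Qed.

Lemma ip_translate (a : R * R) (f g : R * R -> R) : sqitg mu2 f -> sqitg mu2 g ->
  ip mu2 (fun p => f (shift2 a p)) (fun p => g (shift2 a p)) = ip mu2 f g.
Proof. by move=> sf sg; exact: (Rint_translate a (sqitg_mul sf sg)). Qed.

Lemma Rint_indic_itv (a b : R) : a <= b -> \int[mu]_x \1_([set` `]a, b]] : set R) x = b - a.
Proof.
move=> ab; rewrite /Rintegral integral_indic// setIT.
transitivity (fine (mu ([set` `]a, b]] : set R))) => //.
rewrite lebesgue_measure_itv/= lte_fin.
by move: ab; rewrite le_eqVlt => /predU1P[->|->//]; rewrite ltxx subrr.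
Qed.

Lemma itg_indic_itv (a b : R) : itg mu (\1_([set` `]a, b]] : set R) : R -> R).
Proof. exact: integrable_indic_itv. Qed.

Lemma indic_translate_le (a b h e x : R) : `|h| <= e ->
  `|\1_([set` `]a, b]] : set R) (x + h) - \1_([set` `]a, b]] : set R) x| <=
  \1_([set` `](a - e), (a + e)]] : set R) x + \1_([set` `](b - e), (b + e)]] : set R) x :> R.
Proof.
rewrite ler_norml => /andP[h1 h2].
rewrite !indicE !mem_setE !in_itv/=.
have [H1|H1] := boolP (a < x + h <= b); have [H2|H2] := boolP (a < x <= b).
- by rewrite subrr normr0 addr_ge0.
- rewrite subr0 normr1; move/andP: H1 => [H1 H1'].
  move: H2; rewrite negb_and -leNgt -ltNge => /orP[H2|H2].
    by rewrite (_ : a - e < x <= a + e) ?lerDl//; apply/andP; split; lra.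
  by rewrite (_ : b - e < x <= b + e) ?lerDr//; apply/andP; split; lra.
- rewrite sub0r normrN normr1; move/andP: H2 => [H2 H2'].
  move: H1; rewrite negb_and -leNgt -ltNge => /orP[H1|H1].
    by rewrite (_ : a - e < x <= a + e) ?lerDl//; apply/andP; split; lra.
  by rewrite (_ : b - e < x <= b + e) ?lerDr//; apply/andP; split; lra.
- by rewrite subrr normr0 addr_ge0.
Qed.

Definition mean_continuous (f : R * R -> R) := forall e : R, 0 < e ->
  exists2 r, 0 < r & forall a : R * R, `|a.1| <= r -> `|a.2| <= r ->
    ip mu2 (fun p => f (shift2 a p) - f p) (fun p => f (shift2 a p) - f p) <= e.

Lemma Rint_indic_itv_le (a b : R) :
  \int[mu]_x \1_([set` `]a, b]] : set R) x <= `|b - a|.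
Proof.
have [ab|ba] := leP a b; first by rewrite Rint_indic_itv// ler_norm.
rewrite set_itv_ge; last by rewrite bnd_simp -leNgt ltW.
by rewrite indic0 (_ : \int[mu]_x _ = 0)// (Rintegral_cst mu measurableT 0) mul0r.
Qed.

Lemma itv_collar_le (a e : R) : 0 <= e ->
  \int[mu]_x \1_([set` `](a - e), (a + e)]] : set R) x <= 2 * e.
Proof.
move=> e0; apply: le_trans (Rint_indic_itv_le _ _) _.
have -> : a + e - (a - e) = 2 * e by ring.
by rewrite ger0_norm// mulr_ge0.
Qed.

(** Translating a rectangle by at most r in each direction changes its indicator
    only within r of its sides. *)
Lemma mean_continuous_rect (a b c d : R) :
  mean_continuous \1_([set` `]a, b]] `*` [set` `]c, d]]).
Proof.
move=> e e0; pose A : set R := [set` `]a, b]]; pose B : set R := [set` `]c, d]].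
have RE p : \1_([set` `]a, b]] `*` [set` `]c, d]]) p = \1_A p.1 * \1_B p.2 :> R.
  by rewrite !indicE in_setX -natrM mulnb.
pose K := `|d - c| + `|b - a| + 2; have K0 : 0 < K.
  by rewrite ltr_wpDl// addr_ge0.
have K8 : 0 < 8 * K by rewrite mulr_gt0.
pose r := Num.min 1 (e / (8 * K)).
have r0 : 0 < r by rewrite lt_min ltr01 divr_gt0.
have r1 : r <= 1 by rewrite ge_min lexx.
have re : r * (8 * K) <= e by rewrite -ler_pdivlMr// ge_min lexx orbT.
exists r => // h h1 h2.
pose ind x y : R -> R := \1_([set` `]x, y]] : set R).
pose u x : R := ind (a - r) (a + r) x + ind (b - r) (b + r) x.
pose z y : R := ind (c - r) (c + r) y + ind (d - r) (d + r) y.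
pose v := ind (c - r) (d + r).
have iu : itg mu u by apply: itgD; exact: itg_indic_itv.
have iz : itg mu z by apply: itgD; exact: itg_indic_itv.
have iv : itg mu v by exact: itg_indic_itv.
have iw : itg mu (ind a b) by exact: itg_indic_itv.
have i01 (C : set R) x : \1_C x ^+ 2 = \1_C x :> R.
  by rewrite indicE; case: (_ \in _); rewrite /= ?expr1n ?expr0n.
have abs1 (C C' : set R) x y : (\1_C x - \1_C' y) ^+ 2 = `|\1_C x - \1_C' y| :> R.
  by rewrite !indicE; case: (_ \in _); case: (_ \in _); rewrite /= ?subrr ?subr0 ?sub0r ?normrN ?sqrrN ?expr1n ?expr0n ?normr0 ?normr1.
have vB y : \1_B (y + h.2) <= v y.
  rewrite /v /ind !indicE !mem_setE !in_itv/=; move: h2; rewrite ler_norml => /andP[h2 h2'].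
  case: (boolP (c < y + h.2 <= d)) => // /andP[H H'].
  by rewrite (_ : c - r < y <= d + r)//; apply/andP; split; lra.
have ile (C : set R) x : \1_C x <= 1 :> R by rewrite indicE; case: (_ \in _).
rewrite ipE; apply: (@le_trans _ _ (\int[mu2]_p (2 * (u p.1 * v p.2) + 2 * (ind a b p.1 * z p.2)))).
  apply: Rint_le.
  - have sR : sqitg mu2 (\1_([set` `]a, b]] `*` [set` `]c, d]]) : R * R -> R).
      split; first by apply: measurable_indic; exact: measurableX.
      rewrite (_ : (fun x => _ ^+ 2) = fun p => ind a b p.1 * ind c d p.2).
        by apply: itg_prod; exact: itg_indic_itv.
      by apply/funext => p; rewrite RE exprMn !i01.
    by apply: (sqitgB (sqitg_translate h sR) sR).2.
  - by apply: itgD; apply: itgZ; exact: itg_prod.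
  - move=> p; rewrite !RE /shift2 /=.
    have D1 := indic_translate_le a b p.1 h1; have D2 := indic_translate_le c d p.2 h2.
    rewrite -/A -/B in D1 D2; rewrite -!/(ind _ _ _) -/(u _) -/(z _) in D1 D2.
    rewrite -abs1 in D1; rewrite -abs1 in D2.
    have vB2 := vB p.2; have iB := i01 B (p.2 + h.2); have iA := i01 A p.1.
    have B0 : 0 <= \1_B (p.2 + h.2) :> R by [].
    have A0 : 0 <= \1_A p.1 :> R by [].
    rewrite -/A -/B; rewrite /ind -/A in D1 D2 *.
    move: (\1_A (p.1 + h.1) : R) (\1_A p.1 : R) (\1_B (p.2 + h.2) : R)
      (\1_B p.2 : R) (u p.1) (z p.2) (v p.2) D1 D2 vB2 iB iA B0 A0.
    move=> A1 A0 B1 B0 U Z V D1 D2 vB2 iB iA B1_ge0 A0_ge0.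
    have -> : A1 * B1 - A0 * B0 = (A1 - A0) * B1 + A0 * (B1 - B0) by ring.
    apply: (@le_trans _ _ (2 * ((A1 - A0) ^+ 2 * B1) + 2 * (A0 * (B1 - B0) ^+ 2))).
      rewrite -[X in _ * (_ * X) + _]iB -[X in _ + _ * (X * _)]iA -!exprMn.
      by have := sqr_ge0 ((A1 - A0) * B1 - A0 * (B1 - B0)); lra.
    by apply: lerD; rewrite ler_wpM2l//; apply: ler_pM => //; exact: sqr_ge0.
rewrite RintegralD//; [|by apply: itgZ; exact: itg_prod|by apply: itgZ; exact: itg_prod].
rewrite !RintegralZl//; [|exact: itg_prod|exact: itg_prod].
rewrite !Rint_prod//.
have Iu : \int[mu]_x u x <= 4 * r.
  rewrite RintegralD//; [|exact: itg_indic_itv|exact: itg_indic_itv].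
  by have := itv_collar_le a (ltW r0); have := itv_collar_le b (ltW r0); rewrite /ind; lra.
have Iz : \int[mu]_x z x <= 4 * r.
  rewrite RintegralD//; [|exact: itg_indic_itv|exact: itg_indic_itv].
  by have := itv_collar_le c (ltW r0); have := itv_collar_le d (ltW r0); rewrite /ind; lra.
have Iv : \int[mu]_x v x <= `|d - c| + 2.
  apply: le_trans (Rint_indic_itv_le _ _) _.
  rewrite (_ : _ - _ = (d - c) + 2 * r); last by ring.
  apply: le_trans (ler_normD _ _) _; rewrite lerD2l ger0_norm; last by rewrite mulr_ge0// ltW.
  by lra.
have Iw : \int[mu]_x ind a b x <= `|b - a| by exact: Rint_indic_itv_le.
have P1 : (\int[mu]_x u x) * (\int[mu]_x v x) <= 4 * r * (`|d - c| + 2).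
  apply: ler_pM => //; apply: Rint_ge0 => x; rewrite /v /ind ?indicE// /u /ind addr_ge0//.
have P2 : (\int[mu]_x ind a b x) * (\int[mu]_x z x) <= `|b - a| * (4 * r).
  apply: ler_pM => //; apply: Rint_ge0 => x; rewrite /z /ind ?indicE// addr_ge0//.
apply: le_trans re; move: P1 P2; rewrite /K; nra.
Qed.

(** Translations are isometries, hence the functions along whose translates the
    mean square is continuous form a closed subspace; it contains the rectangles. *)
Lemma sqitg_mean_continuous (f : R * R -> R) : sqitg mu2 f -> mean_continuous f.
Proof.
apply: plane_sqitg_ind; last exact: mean_continuous_rect.
- move=> {}f g sf sg cf cg e e0; have e4 : 0 < e / 4 by rewrite divr_gt0.
  have [r r0 Hr] := cf _ e4; have [q q0 Hq] := cg _ e4.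
  exists (Num.min r q); first by rewrite lt_min r0.
  move=> a; rewrite !le_min => /andP[a1 a1'] /andP[a2 a2'].
  rewrite (_ : (fun p => _) = fun p => (f (shift2 a p) - f p) + (g (shift2 a p) - g p)).
    have sfa := sqitgB (sqitg_translate a sf) sf; have sga := sqitgB (sqitg_translate a sg) sg.
    apply: le_trans (ip_add_le sfa sga) _.
    by have := Hr a a1 a2; have := Hq a a1' a2'; lra.
  by apply/funext => p; ring.
- move=> k {}f sf cf e e0.
  have ek : 0 < e / (k ^+ 2 + 1) by rewrite divr_gt0// ltr_wpDl// sqr_ge0.
  have [r r0 Hr] := cf _ ek; exists r => // a a1 a2.
  rewrite (_ : (fun p => _) = fun p => k * (f (shift2 a p) - f p)).
    have sfa := sqitgB (sqitg_translate a sf) sf.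
    rewrite ipZl//; last exact: sqitgZ.
    rewrite ipZr// mulrA -expr2.
    have := Hr a a1 a2; rewrite ler_pdivlMr ?ltr_wpDl ?sqr_ge0//.
    by have := ip_ge0 mu2 (fun p => f (shift2 a p) - f p); nra.
  by apply/funext => p; ring.
- move=> fn {}f sfn cfn sf cv e e0; have e16 : 0 < e / 16 by rewrite divr_gt0.
  have [N _ HN] := (cvgrPdist_le _ _).1 cv _ e16.
  have := HN N (leqnn N); rewrite /= sub0r normrN ger0_norm ?ip_ge0// => HN'.
  have [r r0 Hr] := cfn N _ e16; exists r => // a a1 a2.
  have sD := sqitgB (sfn N) sf; have sDa := sqitg_translate a sD.
  have sNa := sqitgB (sqitg_translate a (sfn N)) (sfn N).
  rewrite (_ : (fun p => _) = fun p => ((fn N (shift2 a p) - fn N p)) +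
      ((fn N p - f p) + (-1) * (fn N (shift2 a p) - f (shift2 a p)))); last first.
    by apply/funext => p; ring.
  apply: le_trans (ip_add_le sNa (sqitgD sD (sqitgZ (-1) sDa))) _.
  have := ip_add_le sD (sqitgZ (-1) sDa).
  rewrite ipZl//; last exact: sqitgZ.
  rewrite ipZr// (ip_translate a sD sD); have := Hr a a1 a2; lra.
Qed.

End PlaneDensity.

(** * Two-sided exponentials and the Poisson kernel *)

Section Laplace.
Context (R : realType).
Local Notation mu := (@lebesgue_measure R).

Definition two_sided_exp (e x : R) : R := expR (- (e * `|x|)).

Lemma normr_cos_le1 (x : R) : `|cos x| <= 1.
Proof. by rewrite ler_norml cos_geN1 cos_le1. Qed.

Lemma normr_sin_le1 (x : R) : `|sin x| <= 1.
Proof. by rewrite ler_norml sin_geN1 sin_le1. Qed.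

(** An antiderivative of exp(-e x) (1 + cos(a x)).  The 1 makes the integrand
    nonnegative, so that the fundamental theorem of calculus applies on a half line;
    the integral of the cosine term is then a difference. *)
Let F (e a x : R) : R := - (e^-1 * expR (- (e * x))) +
  expR (- (e * x)) * ((e ^+ 2 + a ^+ 2)^-1 * (a * sin (a * x) - e * cos (a * x))).

Let dF (e a x : R) : 0 < e ->
  is_derive x 1 (F e a) (expR (- (e * x)) * (1 + cos (a * x))).
Proof.
move=> e0; have ea : e ^+ 2 + a ^+ 2 != 0.
  by rewrite gt_eqF// ltr_pwDl ?sqr_ge0// exprn_gt0.
apply: is_derive_eq.
rewrite /GRing.scale /=.
by field; rewrite ea gt_eqF.
Qed.

Lemma expR_lin_cvg0 (e : R) : 0 < e -> expR (- (e * x)) @[x --> +oo] --> (0 : R).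
Proof.
move=> e0; apply: (@cvg_comp _ _ _ (fun x => e * x) (fun x => expR (- x)) _ +oo); last exact: cvgr_expR.
exact: gt0_cvgMry.
Qed.

Let F_cvg (e a : R) : 0 < e -> F e a x @[x --> +oo] --> (0 : R).
Proof.
move=> e0; rewrite -[X in _ --> X](addr0 0); apply: cvgD.
  rewrite -oppr0 -(mulr0 e^-1); apply: cvgN; apply: cvgMr.
  exact: expR_lin_cvg0.
pose C := (e ^+ 2 + a ^+ 2)^-1 * (`|a| + e).
have Ccvg (k : R) : k * expR (- (e * x)) @[x --> +oo] --> (0 : R).
  by rewrite -(mulr0 k); apply: cvgMr; exact: expR_lin_cvg0.
apply: (squeeze_cvgr _ (Ccvg (- C)) (Ccvg C)); apply: nearW => x.
rewrite mulNr -ler_norml normrM (ger0_norm (expR_ge0 _)) mulrC.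
rewrite ler_wpM2r ?expR_ge0// normrM ger0_norm; last first.
  by rewrite invr_ge0 addr_ge0 ?sqr_ge0.
rewrite ler_wpM2l ?invr_ge0 ?addr_ge0 ?sqr_ge0//.
apply: le_trans (ler_normB _ _) _; rewrite !normrM (gtr0_norm e0).
by apply: lerD; rewrite ler_piMr ?normr_sin_le1 ?normr_cos_le1// ltW.
Qed.

Lemma continuous_two_sided_exp e : continuous (two_sided_exp e).
Proof.
move=> x; apply: (@continuous_comp _ _ _ (fun x => - (e * `|x|)) expR).
  by apply: cvgN; apply: cvgMr; exact: cvg_norm.
exact: continuous_expR.
Qed.

Lemma continuous_cos_lin a : continuous (fun x : R => cos (a * x)).
Proof.
move=> x; apply: (@continuous_comp _ _ _ (fun x => a * x) cos).
  exact: cvgMr.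
exact: continuous_cos.
Qed.

Lemma continuous_sin_lin a : continuous (fun x : R => sin (a * x)).
Proof.
move=> x; apply: (@continuous_comp _ _ _ (fun x => a * x) sin).
  exact: cvgMr.
exact: continuous_sin.
Qed.

Lemma two_sided_exp_ge0 e x : 0 <= two_sided_exp e x.
Proof. exact: expR_ge0. Qed.

Let onecos e a x := two_sided_exp e x * (1 + cos (a * x)).

Let onecos_ge0 e a x : 0 <= onecos e a x.
Proof. by rewrite mulr_ge0 ?expR_ge0// -lerBlDl sub0r cos_geN1. Qed.

Let onecos_cont e a : continuous (onecos e a).
Proof.
move=> x; apply: cvgM; first exact: continuous_two_sided_exp.
by apply: cvgD; [exact: cvg_cst|exact: continuous_cos_lin].
Qed.

Let onecos_int e a : 0 < e ->
  (\int[mu]_x (onecos e a x)%:E)%E = (2 / e + 2 * e / (e ^+ 2 + a ^+ 2))%:E.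
Proof.
move=> e0.
have onecosN : onecos e a =1 onecos e a \o -%R.
  by move=> x /=; rewrite /onecos /two_sided_exp normrN mulrN cosN.
rewrite (ge0_symfun_integralT (onecos_ge0 e a) (@onecos_cont e a) onecosN).
rewrite (_ : [set x | _] = `[0, +oo[%classic); last first.
  by apply/seteqP; split => x /=; rewrite in_itv/= andbT.
rewrite (@ge0_continuous_FTC2y _ (onecos e a) (F e a) 0 0).
- rewrite /F !mulr0 oppr0 expR0 sin0 cos0 sub0e -EFinN -EFinM.
  by congr (_%:E); ring.
- by move=> x _; exact: onecos_ge0.
- by apply: continuous_subspaceT; exact: onecos_cont.
- exact: F_cvg.
- by move=> x _; have := dF a x e0 => -[].
- apply: cvg_at_right_filter; apply: differentiable_continuous.
  by apply/derivable1_diffP; have := dF a 0 e0 => -[].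
- move=> x; rewrite in_itv/= andbT => x0; rewrite derive1E.
  have [_ ->] := dF a x e0; by rewrite /onecos /two_sided_exp gtr0_norm.
Qed.

Lemma itg_onecos e a : 0 < e -> itg mu (onecos e a).
Proof.
move=> e0; apply: itg_ge0P => //.
  by apply: continuous_measurable_fun; exact: onecos_cont.
by rewrite onecos_int// ltry.
Qed.

Lemma itg_two_sided_exp e : 0 < e -> itg mu (two_sided_exp e).
Proof.
move=> e0; have := itgZ 2^-1 (itg_onecos 0 e0); apply: eq_integrable => // x _ /=.
by rewrite /onecos mul0r cos0; congr (_%:E); field.
Qed.

Lemma Rint_two_sided_exp e : 0 < e -> \int[mu]_x two_sided_exp e x = 2 / e.
Proof.
move=> e0; rewrite (_ : (fun x => _) = fun x => 2^-1 * onecos e 0 x); last first.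
  by apply/funext => x; rewrite /onecos mul0r cos0; field.
rewrite RintegralZl//; last exact: itg_onecos.
rewrite [X in _ * X](_ : _ = 2 / e + 2 * e / (e ^+ 2 + 0 ^+ 2)); last first.
  by rewrite /Rintegral onecos_int.
by field; rewrite gt_eqF.
Qed.

Lemma itg_two_sided_expM e (h : R -> R) : 0 < e -> measurable_fun setT h ->
  (forall x, `|h x| <= 1) -> itg mu (fun x => two_sided_exp e x * h x).
Proof.
move=> e0 mh h1; apply: itg_le (itg_two_sided_exp e0).
  apply: measurable_funM => //; apply: continuous_measurable_fun.
  exact: continuous_two_sided_exp.
by move=> x; rewrite normrM ger0_norm ?two_sided_exp_ge0// ler_piMr ?two_sided_exp_ge0.
Qed.

Lemma Rint_exp_cos e a : 0 < e ->
  \int[mu]_x (two_sided_exp e x * cos (a * x)) = 2 * e / (e ^+ 2 + a ^+ 2).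
Proof.
move=> e0; rewrite (_ : (fun x => _) = fun x => onecos e a x - two_sided_exp e x); last first.
  by apply/funext => x; rewrite /onecos; ring.
rewrite RintegralB//; [|exact: itg_onecos|exact: itg_two_sided_exp].
rewrite Rint_two_sided_exp// [X in X - _](_ : _ = 2 / e + 2 * e / (e ^+ 2 + a ^+ 2)); last first.
  by rewrite /Rintegral onecos_int.
by ring.
Qed.

Lemma Rint_exp_sin e a : 0 < e ->
  \int[mu]_x (two_sided_exp e x * sin (a * x)) = 0.
Proof.
move=> e0; have i : itg mu (fun x => two_sided_exp e x * sin (a * x)).
  apply: itg_two_sided_expM => //; last by move=> x; exact: normr_sin_le1.
  by apply: continuous_measurable_fun; exact: continuous_sin_lin.
have := Rint_reflect i.
rewrite (_ : (fun x => _ (- x) * _) = fun x => (-1) * (two_sided_exp e x * sin (a * x))).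
  by rewrite RintegralZl//; lra.
by apply/funext => x; rewrite /two_sided_exp normrN mulrN sinN; ring.
Qed.

(** The Poisson kernel, normalized to have total mass 2 pi. *)
Definition poisson (e x : R) : R := 2 * e / (e ^+ 2 + x ^+ 2).

Lemma poisson_ge0 e x : 0 < e -> 0 <= poisson e x.
Proof.
move=> e0; rewrite /poisson divr_ge0 ?mulr_ge0 ?ltW//.
by rewrite ltr_pwDl ?sqr_ge0// exprn_gt0.
Qed.

Lemma continuous_poisson e : 0 < e -> continuous (poisson e).
Proof.
move=> e0 x; rewrite /poisson; apply: cvgMr; apply: cvgV.
  by rewrite gt_eqF// ltr_pwDl ?sqr_ge0// exprn_gt0.
by apply: cvgD; [exact: cvg_cst|exact: exprn_continuous].
Qed.

Let poisson_int e : 0 < e -> (\int[mu]_x (poisson e x)%:E)%E = (2 * pi)%:E.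
Proof.
move=> e0; have poissonN : poisson e =1 poisson e \o -%R.
  by move=> x /=; rewrite /poisson sqrrN.
rewrite (ge0_symfun_integralT (fun x => poisson_ge0 x e0) (continuous_poisson e0) poissonN).
rewrite (_ : [set x | _] = `[0, +oo[%classic); last first.
  by apply/seteqP; split => x /=; rewrite in_itv/= andbT.
pose A (x : R) : R := 2 * atan (e^-1 * x).
have dA (x : R) : is_derive x 1 A (poisson e x).
  apply: is_derive_eq; rewrite /GRing.scale /= /poisson.
  have ex : e ^+ 2 + x ^+ 2 != 0 by rewrite gt_eqF// ltr_pwDl ?sqr_ge0// exprn_gt0.
  by field; rewrite ex gt_eqF.
rewrite (@ge0_continuous_FTC2y R (poisson e) A 0 pi).
- by rewrite /A mulr0 atan0 mulr0 sube0 -EFinM.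
- by move=> x _; exact: poisson_ge0.
- by apply: continuous_subspaceT; exact: continuous_poisson.
- rewrite [X in _ --> X](_ : _ = 2 * (pi / 2)); last by field.
  apply: cvgMr; apply: (@cvg_comp _ _ _ (fun x => e^-1 * x) (@atan R) _ +oo).
    by apply: gt0_cvgMry; [rewrite invr_gt0|exact: cvg_id].
  exact: cvgy_atan.
- by move=> x _; have := dA x => -[].
- apply: cvg_at_right_filter; apply: differentiable_continuous.
  by apply/derivable1_diffP; have := dA 0 => -[].
- by move=> x _; rewrite derive1E; have [_ ->] := dA x.
Qed.

Lemma itg_poisson e : 0 < e -> itg mu (poisson e).
Proof.
move=> e0; apply: itg_ge0P.
- by apply: continuous_measurable_fun; exact: continuous_poisson.
- by move=> x; exact: poisson_ge0.
- by rewrite poisson_int// ltry.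
Qed.

Lemma Rint_poisson e : 0 < e -> \int[mu]_x poisson e x = 2 * pi.
Proof. by move=> e0; rewrite /Rintegral poisson_int. Qed.

End Laplace.

(** * Fourier integrals of integrable functions *)

Section Plancherel.
Context (R : realType).
Local Notation mu := (@lebesgue_measure R).
Local Notation mu2 := (plane_measure R).
Local Notation mu4 := (@plane R \x @plane R)%E.
Local Notation T2 := (measurableTypeR R * measurableTypeR R)%type.
Implicit Types (f h : R * R -> R) (p k z : R * R).

Definition dot p k : R := p.1 * k.1 + p.2 * k.2.

(** The Fourier integral of f is ct f - i st f. *)
Definition ct f k : R := \int[mu2]_p (f p * cos (dot p k)).
Definition st f k : R := \int[mu2]_p (f p * sin (dot p k)).

Lemma measurable_dotr p : measurable_fun (setT : set T2) (dot p).
Proof.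
apply: (@measurable_funD _ T2 R setT).
  by apply: (@measurable_funM _ T2 R setT) => //; exact: measurable_fst.
by apply: (@measurable_funM _ T2 R setT) => //; exact: measurable_snd.
Qed.

Lemma dotC p k : dot p k = dot k p.
Proof. by rewrite /dot !(mulrC p.1) !(mulrC p.2). Qed.

Lemma measurable_dotl k : measurable_fun (setT : set T2) (dot ^~ k).
Proof. by under eq_fun do rewrite dotC; exact: measurable_dotr. Qed.

Lemma measurable_dot : measurable_fun (setT : set (T2 * T2)) (fun w => dot w.1 w.2).
Proof.
have m1 : measurable_fun (setT : set (T2 * T2)) (fst : T2 * T2 -> T2) by exact: measurable_fst.
have m2 : measurable_fun (setT : set (T2 * T2)) (snd : T2 * T2 -> T2) by exact: measurable_snd.
have f1 : measurable_fun (setT : set T2) (fst : T2 -> R) by exact: measurable_fst.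
have f2 : measurable_fun (setT : set T2) (snd : T2 -> R) by exact: measurable_snd.
apply: (@measurable_funD _ (T2 * T2)%type R setT).
  by apply: (@measurable_funM _ (T2 * T2)%type R setT); [exact: measurableT_comp f1 m1|exact: measurableT_comp f1 m2].
by apply: (@measurable_funM _ (T2 * T2)%type R setT); [exact: measurableT_comp f2 m1|exact: measurableT_comp f2 m2].
Qed.

Lemma measurable_cosR : measurable_fun setT (@cos R).
Proof. by apply: continuous_measurable_fun; exact: continuous_cos. Qed.

Lemma measurable_sinR : measurable_fun setT (@sin R).
Proof. by apply: continuous_measurable_fun; exact: continuous_sin. Qed.

Lemma itg_bounded (m : {measure set T2 -> \bar R}) f h : itg m f -> measurable_fun setT h ->
  (forall p, `|h p| <= 1) -> itg m (fun p => f p * h p).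
Proof.
move=> fi mh h1; apply: (itg_le _ _ (integrable_norm fi)).
  by apply: measurable_funM => //; exact: itg_meas fi.
by move=> p /=; rewrite normrM ler_piMr.
Qed.

Lemma itg_cos f k : itg mu2 f -> itg mu2 (fun p => f p * cos (dot p k)).
Proof.
move=> fi; apply: itg_bounded => //; last by move=> p; exact: normr_cos_le1.
exact: measurableT_comp measurable_cosR (measurable_dotl k).
Qed.

Lemma itg_sin f k : itg mu2 f -> itg mu2 (fun p => f p * sin (dot p k)).
Proof.
move=> fi; apply: itg_bounded => //; last by move=> p; exact: normr_sin_le1.
exact: measurableT_comp measurable_sinR (measurable_dotl k).
Qed.

(** The factor of Abel summation, and poisson2 its Fourier transform. *)
Definition rho (e : R) k : R := two_sided_exp e k.1 * two_sided_exp e k.2.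
Definition poisson2 (e : R) z : R := poisson e z.1 * poisson e z.2.

Lemma itg_rho e : 0 < e -> itg mu2 (rho e).
Proof. by move=> e0; apply: itg_prod; exact: itg_two_sided_exp. Qed.

Lemma itg_poisson2 e : 0 < e -> itg mu2 (poisson2 e).
Proof. by move=> e0; apply: itg_prod; exact: itg_poisson. Qed.

Lemma Rint_rho_cos e z : 0 < e ->
  \int[mu2]_k (rho e k * cos (dot z k)) = poisson2 e z.
Proof.
move=> e0.
have ic a : itg mu (fun x => two_sided_exp e x * cos (a * x)).
  apply: itg_two_sided_expM => //; last by move=> x; exact: normr_cos_le1.
  by apply: continuous_measurable_fun; exact: continuous_cos_lin.
have isn a : itg mu (fun x => two_sided_exp e x * sin (a * x)).
  apply: itg_two_sided_expM => //; last by move=> x; exact: normr_sin_le1.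
  by apply: continuous_measurable_fun; exact: continuous_sin_lin.
rewrite (_ : (fun k => _) = fun k =>
  (two_sided_exp e k.1 * cos (z.1 * k.1)) * (two_sided_exp e k.2 * cos (z.2 * k.2)) -
  (two_sided_exp e k.1 * sin (z.1 * k.1)) * (two_sided_exp e k.2 * sin (z.2 * k.2))).
  have i1 := itg_prod (ic z.1) (ic z.2); have i2 := itg_prod (isn z.1) (isn z.2).
  rewrite RintegralB// (Rint_prod (ic z.1) (ic z.2)) (Rint_prod (isn z.1) (isn z.2)).
  by rewrite !Rint_exp_cos// !Rint_exp_sin// mul0r subr0.
by apply/funext => k; rewrite /rho /dot cosD; ring.
Qed.

Lemma itg_wave (c : R -> R) f h : measurable_fun setT c -> (forall x, `|c x| <= 1) ->
  itg mu2 h -> itg mu2 f ->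
  itg mu4 (fun w => h w.1 * (f w.2 * c (dot w.2 w.1))).
Proof.
move=> mc c1 hi fi.
have m1 : measurable_fun (setT : set (T2 * T2)) (fst : T2 * T2 -> T2) by exact: measurable_fst.
have m2 : measurable_fun (setT : set (T2 * T2)) (snd : T2 * T2 -> T2) by exact: measurable_snd.
have H : itg mu4 (fun w => `|h w.1| * `|f w.2|).
  exact: (@itg_prod _ _ T2 T2 R (@plane R) (@plane R) _ _ (integrable_norm hi) (integrable_norm fi)).
apply: (itg_le _ _ H).
  apply: measurable_funM; first exact: measurableT_comp (itg_meas hi) m1.
  apply: measurable_funM; first exact: measurableT_comp (itg_meas fi) m2.
  apply: (measurableT_comp mc).
  by under eq_fun do rewrite dotC; exact: measurable_dot.
by move=> w /=; rewrite !normrM ler_wpM2l// ler_piMr.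
Qed.

(** Measurability in k comes from Fubini's theorem, which wants an integrand that is
    summable in k too: hence the factor rho, divided out afterwards. *)
Lemma measurable_wave (c : R -> R) f : measurable_fun setT c ->
  (forall x, `|c x| <= 1) -> itg mu2 f ->
  measurable_fun setT (fun k => \int[mu2]_p (f p * c (dot p k))).
Proof.
move=> mc c1 fi; have e0 : (0 : R) < 1 by [].
have H := itg_meas (fubini_itg1 (itg_wave mc c1 (itg_rho e0) fi)).
pose r k : R := expR (`|k.1| + `|k.2|).
have rrho k : r k * rho 1 k = 1.
  by rewrite /rho /r /two_sided_exp -!expRD !mul1r -opprD subrr expR0.
rewrite (_ : (fun k => _) = fun k => r k *
    \int[mu2]_p (rho 1 k * (f p * c (dot p k)))).
  apply: measurable_funM => //; apply: (measurableT_comp (@measurable_expR R)).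
  apply: (@measurable_funD _ T2 R setT); apply: (measurableT_comp (@normr_measurable R setT)).
    exact: measurable_fst.
  exact: measurable_snd.
apply/funext => k; rewrite RintegralZl//; first by rewrite mulrA rrho mul1r.
apply: itg_bounded => //; exact: measurableT_comp mc (measurable_dotl k).
Qed.

Lemma measurable_ct f : itg mu2 f -> measurable_fun setT (ct f).
Proof. by apply: measurable_wave; [exact: measurable_cosR|exact: normr_cos_le1]. Qed.

Lemma measurable_st f : itg mu2 f -> measurable_fun setT (st f).
Proof. by apply: measurable_wave; [exact: measurable_sinR|exact: normr_sin_le1]. Qed.

End Plancherel.

(** * Plancherel's identity *)

Section PlancherelCore.
Context (R : realType).
Local Notation mu := (@lebesgue_measure R).
Local Notation mu2 := (plane_measure R).
Local Notation mu4 := (@plane R \x @plane R)%E.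
Local Notation T2 := (measurableTypeR R * measurableTypeR R)%type.
Implicit Types (f h : R * R -> R) (p k z : R * R).

Lemma shift2C p z : shift2 p z = shift2 z p.
Proof. by rewrite /shift2 (addrC p.1) (addrC p.2). Qed.

Lemma dot_shift2 p z k : dot (shift2 p z) k = dot z k + dot p k.
Proof. by rewrite /dot /shift2 /=; ring. Qed.

Lemma measurable_add2 :
  measurable_fun (setT : set (T2 * T2)) (fun w => shift2 w.1 w.2 : T2).
Proof.
have m1 : measurable_fun (setT : set (T2 * T2)) (fst : T2 * T2 -> T2) by exact: measurable_fst.
have m2 : measurable_fun (setT : set (T2 * T2)) (snd : T2 * T2 -> T2) by exact: measurable_snd.
have f1 : measurable_fun (setT : set T2) (fst : T2 -> R) by exact: measurable_fst.
have f2 : measurable_fun (setT : set T2) (snd : T2 -> R) by exact: measurable_snd.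
apply/measurable_fun_pairP; split; rewrite /comp /=.
  apply: (@measurable_funD _ (T2 * T2)%type R setT).
    exact: measurableT_comp f1 m2.
  exact: measurableT_comp f1 m1.
apply: (@measurable_funD _ (T2 * T2)%type R setT).
  exact: measurableT_comp f2 m2.
exact: measurableT_comp f2 m1.
Qed.

Lemma itg_corr f h : itg mu2 f -> itg mu2 h ->
  itg mu4 (fun w => f w.1 * h (shift2 w.1 w.2)).
Proof.
move=> fi hi.
have m1 : measurable_fun (setT : set (T2 * T2)) (fst : T2 * T2 -> T2) by exact: measurable_fst.
apply/(@integrable12ltyP _ _ _ _ _ (@plane R) (@plane R) (EFin \o _)).
  apply/measurable_EFinP; apply: measurable_funM.
    exact: measurableT_comp (itg_meas fi) m1.
  exact: (measurableT_comp (itg_meas hi) measurable_add2).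
rewrite /=.
rewrite (eq_integral (fun q : T2 => (`|f q| * \int[mu2]_z `|h z|)%:E)).
  have : itg mu2 (fun q => `|f q| * \int[mu2]_z `|h z|).
    by under eq_fun do rewrite mulrC; apply: itgZ; exact: integrable_norm.
  by move=> i; rewrite (Rint_EFin i) ltry.
move=> q _ /=; rewrite -(Rint_translate q (integrable_norm hi)) -RintegralZl//; last first.
  exact: (itg_translate q (integrable_norm hi)).
rewrite -Rint_EFin; last by apply: itgZ; exact: (itg_translate q (integrable_norm hi)).
by apply: eq_integral => z _; rewrite normrM shift2C.
Qed.

(** The autocorrelation of f. *)
Definition corr f z : R := ip mu2 f (fun q => f (shift2 z q)).

Lemma itg_corr_fun f : itg mu2 f -> itg mu2 (corr f).
Proof.
move=> fi; have := fubini_itg2 (itg_corr fi fi).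
by congr (itg _ _); apply/funext => z; apply: eq_Rintegral => q _; rewrite shift2C.
Qed.

(** The squared modulus of the transform is the transform of the
    autocorrelation: expand the product of two integrals and substitute the
    difference of the variables. *)
Lemma sq_transform f k : itg mu2 f -> sqitg mu2 f ->
  ct f k ^+ 2 + st f k ^+ 2 = \int[mu2]_z (corr f z * cos (dot z k)).
Proof.
move=> fi sf; apply/esym.
have i4 : itg mu4 (fun w => f w.1 * f (shift2 w.1 w.2) * cos (dot w.2 k)).
  have := itg_corr fi fi.
  move=> i; apply: (itg_le _ _ (integrable_norm i)).
    apply: measurable_funM; first exact: itg_meas i.
    apply: (measurableT_comp (@measurable_cosR R)).
    apply: (measurableT_comp (measurable_dotl k)).
    exact: measurable_snd.
  by move=> w /=; rewrite normrM ler_piMr// normr_cos_le1.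
transitivity (\int[mu2]_z \int[mu2]_q (f q * f (shift2 q z) * cos (dot z k))).
  apply: eq_Rintegral => z _.
  rewrite -RintegralZr//; last first.
    exact: (sqitg_mul sf (sqitg_translate z sf)).
  by apply: eq_Rintegral => q _; rewrite (shift2C q).
rewrite -(Rfubini i4).
transitivity (\int[mu2]_q (f q * cos (dot q k) * ct f k + f q * sin (dot q k) * st f k)).
  apply: eq_Rintegral => q _.
  have ic := itg_cos k fi; have isn := itg_sin k fi.
  pose g p := f q * cos (dot q k) * (f p * cos (dot p k)) + f q * sin (dot q k) * (f p * sin (dot p k)).
  have gi : itg mu2 g by apply: itgD; apply: itgZ.
  transitivity (\int[mu2]_z g (shift2 q z)).
    apply: eq_Rintegral => z _; rewrite /g dot_shift2.
    rewrite cosD sinD; set c := cos (dot q k); set s := sin (dot q k).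
    have cs : c ^+ 2 + s ^+ 2 = 1 by exact: cos2Dsin2.
    rewrite -[in LHS](mulr1 (cos _)) -cs; ring.
  rewrite Rint_translate// RintegralD//; [|exact: itgZ|exact: itgZ].
  by rewrite !RintegralZl.
have ic := itg_cos k fi; have isn := itg_sin k fi.
rewrite RintegralD//; last 2 first.
- by under eq_fun do rewrite mulrC; exact: itgZ.
- by under eq_fun do rewrite mulrC; exact: itgZ.
by rewrite !RintegralZr// -!expr2.
Qed.

(** Fubini's theorem moves the transform from the autocorrelation to the summation
    factor. *)
Lemma weighted_plancherel e f : 0 < e -> itg mu2 f -> sqitg mu2 f ->
  itg mu2 (fun k => rho e k * (ct f k ^+ 2 + st f k ^+ 2)) /\
  \int[mu2]_k (rho e k * (ct f k ^+ 2 + st f k ^+ 2)) =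
  \int[mu2]_z (corr f z * poisson2 e z).
Proof.
move=> e0 fi sf; have ai := itg_corr_fun fi.
have i4 := itg_wave (@measurable_cosR R) (@normr_cos_le1 R) (itg_rho e0) ai.
have E k : rho e k * (ct f k ^+ 2 + st f k ^+ 2) =
    \int[mu2]_z (rho e k * (corr f z * cos (dot z k))).
  by rewrite sq_transform// RintegralZl//; exact: itg_cos.
under eq_fun do rewrite E; split; first exact: fubini_itg1 i4.
rewrite (Rfubini i4); apply: eq_Rintegral => z _.
rewrite -Rint_rho_cos// -RintegralZl//.
  by apply: eq_Rintegral => k _ /=; ring.
apply: itg_bounded; first exact: itg_rho.
  exact: measurableT_comp (@measurable_cosR R) (measurable_dotr z).
by move=> k; exact: normr_cos_le1.
Qed.

Lemma corr_le f z : sqitg mu2 f -> `|corr f z| <= ip mu2 f f.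
Proof.
move=> sf; have := ip_AMGM sf (sqitg_translate z sf).
by rewrite (ip_translate z sf sf) /corr; lra.
Qed.

(** Cauchy-Schwarz and the continuity of translations in mean square. *)
Lemma corr_cont0 f (e : R) : sqitg mu2 f -> 0 < e ->
  exists2 r, 0 < r & forall z, `|z.1| <= r -> `|z.2| <= r ->
    `|corr f z - ip mu2 f f| <= e.
Proof.
move=> sf e0; have A0 := ip_ge0 mu2 f; have A1 : 0 < ip mu2 f f + 1 by rewrite ltr_wpDl.
have [|r r0 Hr] := sqitg_mean_continuous sf (e := e ^+ 2 / (ip mu2 f f + 1)).
  by rewrite divr_gt0// exprn_gt0.
exists r => // z z1 z2; have := Hr z z1 z2.
have sz := sqitg_translate z sf.
rewrite ler_pdivlMr// => H; rewrite /corr -ipBr//.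
rewrite -ler_sqr ?nnegrE//; last exact: ltW.
rewrite real_normK ?num_real//.
apply: le_trans (ip_CS sf (sqitgB sz sf)) _.
have := ip_ge0 mu2 (fun q => f (shift2 z q) - f q).
move: H A0; set D := ip mu2 (fun q => _ - _) _; set A := ip mu2 f f.
by clearbody D A; nra.
Qed.

(** Away from the origin, the kernel is O(e) times a fixed summable function. *)
Lemma poisson_tail (r e x : R) : 0 < r -> 0 < e -> r < `|x| ->
  poisson e x <= (1 + (r ^+ 2)^-1) * e * poisson 1 x.
Proof.
move=> r0 e0 rx; rewrite /poisson.
have r2 : 0 < r ^+ 2 by rewrite exprn_gt0.
have x2 : r ^+ 2 < x ^+ 2.
  rewrite -[x ^+ 2]real_normK ?num_real// ltr_pXn2r ?nnegrE//; exact: ltW.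
have e2 : 0 < e ^+ 2 by rewrite exprn_gt0.
rewrite expr1n mulr1 ler_pdivrMr; last by lra.
have -> : (1 + (r ^+ 2)^-1) * e * (2 / (1 + x ^+ 2)) * (e ^+ 2 + x ^+ 2) =
    2 * e * ((1 + (r ^+ 2)^-1) * (e ^+ 2 + x ^+ 2) / (1 + x ^+ 2)).
  by field; rewrite !gt_eqF//; lra.
rewrite ler_pMr; last by rewrite mulr_gt0.
rewrite ler_pdivlMr; last by lra.
rewrite mul1r mulrDl mul1r.
have : 1 <= (r ^+ 2)^-1 * x ^+ 2 by rewrite mulrC ler_pdivlMr// mul1r ltW.
have : 0 <= (r ^+ 2)^-1 * e ^+ 2 by rewrite mulr_ge0 ?invr_ge0// ltW.
rewrite mulrDr; lra.
Qed.

(** The Poisson kernels are an approximate identity: near the origin corr f is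
    close to its value there, and the rest of the plane carries a mass O(e). *)
Lemma poisson_mean_cvg f : itg mu2 f -> sqitg mu2 f ->
  \int[mu2]_z (corr f z * poisson2 n.+1%:R^-1 z) @[n --> \oo] -->
  (2 * pi) ^+ 2 * ip mu2 f f.
Proof.
move=> fi sf; have A0 := ip_ge0 mu2 f; set A := ip mu2 f f in A0 *.
pose e_ n : R := n.+1%:R^-1; have e_gt0 n : 0 < e_ n by rewrite invr_gt0.
have pi0 : 0 < (2 * pi : R) ^+ 2 by rewrite exprn_gt0// mulr_gt0// pi_gt0.
have IP e : 0 < e -> \int[mu2]_z poisson2 e z = (2 * pi) ^+ 2.
  by move=> e0; rewrite /poisson2 (Rint_prod (itg_poisson e0) (itg_poisson e0)) !Rint_poisson.
have mcorr := itg_meas (itg_corr_fun fi).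
have ciP e : 0 < e -> itg mu2 (fun z => corr f z * poisson2 e z).
  move=> e0; apply: (itg_le _ _ (itgZ A (itg_poisson2 e0))).
    by apply: measurable_funM => //; exact: itg_meas (itg_poisson2 e0).
  move=> z; have p0 : 0 <= poisson2 e z by rewrite mulr_ge0 ?poisson_ge0.
  by rewrite normrM (ger0_norm p0) ler_wpM2r// corr_le.
apply/cvgrPdist_le => eta eta0.
have [|r r0 Hr] := corr_cont0 sf (e := eta / (2 * (2 * pi) ^+ 2)).
  by rewrite divr_gt0// mulr_gt0.
pose C := 1 + (r ^+ 2)^-1; have C0 : 0 < C by rewrite addr_gt0// invr_gt0 exprn_gt0.
pose D := 2 * A * (2 * C * (2 * pi) ^+ 2).
have [N HN] : exists N, forall n, (N <= n)%N -> D * e_ n <= eta / 2.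
  have : D * e_ n @[n --> \oo] --> (0 : R).
    by rewrite -(mulr0 D); apply: cvgMr; exact: cvg_harmonic.
  have eta2 : 0 < eta / 2 by rewrite divr_gt0.
  move=> /cvgrPdist_le/(_ _ eta2)[N _ HN]; exists N => n Nn.
  by have := HN n Nn; rewrite /= sub0r normrN; apply: le_trans; exact: ler_norm.
exists N => // n /HN HD; have e0 := e_gt0 n; set e := e_ n in HD e0.
rewrite -[X in X * A](IP e e0) -RintegralZr//; last exact: itg_poisson2.
have iA : itg mu2 (fun z => poisson2 e z * A).
  by under eq_fun do rewrite mulrC; apply: itgZ; exact: itg_poisson2.
rewrite distrC -RintegralB//; last exact: ciP.
apply: le_trans (le_normr_Rintegral _ _) _ => //.
  by apply: (itgB (ciP e e0) iA).
pose eta' := eta / (2 * (2 * pi) ^+ 2).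
pose B z := eta' * poisson2 e z + 2 * A * (C * e * (poisson 1 z.1 * poisson e z.2) +
   C * e * (poisson e z.1 * poisson 1 z.2)).
have i1 : itg mu2 (fun z => C * e * (poisson 1 z.1 * poisson e z.2)).
  by apply: itgZ; apply: itg_prod; exact: itg_poisson.
have i2 : itg mu2 (fun z => C * e * (poisson e z.1 * poisson 1 z.2)).
  by apply: itgZ; apply: itg_prod; exact: itg_poisson.
have i3 : itg mu2 (fun z => eta' * poisson2 e z) by apply: itgZ; exact: itg_poisson2.
have iB : itg mu2 B by apply: (itgD i3); apply: itgZ; exact: itgD.
apply: (@le_trans _ _ (\int[mu2]_z B z)).
  apply: Rint_le => //.
    exact: (integrable_norm (itgB (ciP e e0) iA)).
  move=> z.
  have -> : corr f z * poisson2 e z - poisson2 e z * A = poisson2 e z * (corr f z - A) by ring.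
  have p0 x : 0 <= poisson e x by rewrite poisson_ge0.
  have p10 x : 0 <= poisson (1 : R) x by rewrite poisson_ge0.
  have P0 : 0 <= poisson2 e z by rewrite mulr_ge0.
  have Ce : 0 <= C * e by apply: mulr_ge0; exact: ltW.
  have t1 : 0 <= C * e * (poisson 1 z.1 * poisson e z.2) by rewrite mulr_ge0// mulr_ge0.
  have t2 : 0 <= C * e * (poisson e z.1 * poisson 1 z.2) by rewrite mulr_ge0// mulr_ge0.
  have t3 : 0 <= eta' by apply: ltW; rewrite divr_gt0// mulr_gt0.
  rewrite normrM (ger0_norm P0) /B.
  have far : `|corr f z - A| <= 2 * A.
    apply: le_trans (ler_normB _ _) _; rewrite (ger0_norm A0).
    by have := corr_le z sf; rewrite -/A; lra.
  (* If a coordinate is farther than r from 0, poisson_tail applies to it. *)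
  have [z1|z1] := leP `|z.1| r; last first.
    apply: ler_wpDl; first by rewrite mulr_ge0.
    rewrite mulrC; apply: ler_pM => //; apply: ler_wpDr => //.
    rewrite mulrA; apply: ler_wpM2r => //; exact: poisson_tail.
  have [z2|z2] := leP `|z.2| r; last first.
    apply: ler_wpDl; first by rewrite mulr_ge0.
    rewrite mulrC; apply: ler_pM => //; apply: ler_wpDl => //.
    rewrite mulrCA; apply: ler_wpM2l => //; exact: poisson_tail.
  apply: ler_wpDr; first by rewrite mulr_ge0 ?mulr_ge0// addr_ge0.
  by rewrite mulrC ler_wpM2r//; exact: Hr.
have iQ1 := itg_prod (itg_poisson (ltr01 : 0 < 1 :> R)) (itg_poisson e0).
have iQ2 := itg_prod (itg_poisson e0) (itg_poisson (ltr01 : 0 < 1 :> R)).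
rewrite (RintegralD measurableT i3 (itgZ (2 * A) (itgD i1 i2))).
rewrite (RintegralZl eta' measurableT (itg_poisson2 e0)) (IP e e0).
rewrite (RintegralZl (2 * A) measurableT (itgD i1 i2)).
rewrite (RintegralD measurableT i1 i2).
rewrite (RintegralZl (C * e) measurableT iQ1) (RintegralZl (C * e) measurableT iQ2).
rewrite (Rint_prod (itg_poisson ltr01) (itg_poisson e0)).
rewrite (Rint_prod (itg_poisson e0) (itg_poisson ltr01)).
rewrite !Rint_poisson// /eta'.
have -> : eta / (2 * (2 * pi) ^+ 2) * (2 * pi) ^+ 2 = eta / 2.
  have := lt0r_neq0 pi0; move: ((2 * pi) ^+ 2) => q q0.
  by field.
by move: HD; rewrite /D; lra.
Qed.

(** As e decreases to 0 the factor rho increases to 1: monotone convergence on the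
    left of weighted_plancherel, the approximate identity on the right. *)
Lemma plancherel_L1L2 f : itg mu2 f -> sqitg mu2 f ->
  [/\ sqitg mu2 (ct f), sqitg mu2 (st f) &
      ip mu2 (ct f) (ct f) + ip mu2 (st f) (st f) = (2 * pi) ^+ 2 * ip mu2 f f].
Proof.
move=> fi sf; pose g k := ct f k ^+ 2 + st f k ^+ 2.
have mct := measurable_ct fi; have mst := measurable_st fi.
have g0 k : 0 <= g k by rewrite addr_ge0 ?sqr_ge0.
have mg : measurable_fun setT g by apply: measurable_funD; exact: measurable_funX.
have e0 n : 0 < n.+1%:R^-1 :> R by rewrite invr_gt0.
pose t k : R := `|k.1| + `|k.2|.
have t0 k : 0 <= t k by rewrite addr_ge0.
have rhoE e k : rho e k = expR (- (e * t k)).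
  by rewrite /rho /two_sided_exp -expRD /t mulrDr opprD.
have Ig : (\int[mu2]_k (g k)%:E)%E = ((2 * pi) ^+ 2 * ip mu2 f f)%:E.
  pose G n k := (rho n.+1%:R^-1 k * g k)%:E.
  have -> : (\int[mu2]_k (g k)%:E)%E = (\int[mu2]_k (limn (G ^~ k)))%E.
    apply: eq_integral => k _; apply/esym/cvg_lim => //.
    apply: cvg_EFin; first exact: nearW.
    rewrite -[X in _ --> X]mul1r; apply: cvgMl.
    have : expR (- (n.+1%:R^-1 * t k)) @[n --> \oo] --> expR (- (0 * t k)).
      apply: continuous_cvg; first exact: continuous_expR.
      by apply: cvgN; apply: cvgM; [exact: cvg_harmonic|exact: cvg_cst].
    by rewrite mul0r oppr0 expR0; under eq_fun do rewrite -rhoE.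
  have mono := @cvg_monotone_convergence _ _ _ mu2 setT measurableT G.
  apply: (@cvg_unique _ _ (fmap (fun n => (\int[mu2]_k G n k)%E) \oo)).
  - exact: ereal_hausdorff.
  - apply: mono.
    + move=> n; apply/measurable_EFinP; apply: measurable_funM => //.
      exact: itg_meas (itg_rho (e0 n)).
    + by move=> n k _; rewrite lee_fin mulr_ge0// mulr_ge0 ?expR_ge0.
    + move=> k _ n m nm; rewrite lee_fin ler_wpM2r// !rhoE ler_expR lerN2.
      by rewrite ler_wpM2r// lef_pV2 ?posrE// ler_nat.
  - rewrite (_ : (fun n => _) = EFin \o (fun n =>
        \int[mu2]_z (corr f z * poisson2 n.+1%:R^-1 z))).
      apply: cvg_EFin; first exact: nearW.
      exact: poisson_mean_cvg.
    apply/funext => n /=; have [iw <-] := weighted_plancherel (e0 n) fi sf.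
    by rewrite -(Rint_EFin iw).
have gi : itg mu2 g by apply: itg_ge0P => //; rewrite Ig ltry.
have sc : sqitg mu2 (ct f).
  split=> //; apply: itg_le gi; first exact: measurable_funX.
  by move=> k; rewrite ger0_norm ?sqr_ge0// lerDl sqr_ge0.
have ss : sqitg mu2 (st f).
  split=> //; apply: itg_le gi; first exact: measurable_funX.
  by move=> k; rewrite ger0_norm ?sqr_ge0// lerDr sqr_ge0.
split=> //; rewrite !ipE -RintegralD//; [|exact: sc.2|exact: ss.2].
by rewrite /Rintegral Ig.
Qed.

End PlancherelCore.

(** * The Fourier transform of square integrable functions *)

Section AlmostEverywhere.
Context d (T : measurableType d) (R : realType) (m : {measure set T -> \bar R}).
Implicit Types P Q S : T -> Prop.

Lemma aeS P Q : (forall x, P x -> Q x) -> {ae m, forall x, P x} -> {ae m, forall x, Q x}.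
Proof. by move=> PQ; apply: filterS. Qed.

Lemma aeS2 P Q S : (forall x, P x -> Q x -> S x) -> {ae m, forall x, P x} ->
  {ae m, forall x, Q x} -> {ae m, forall x, S x}.
Proof. by move=> PQS; apply: filterS2. Qed.

Lemma aeT P : (forall x, P x) -> {ae m, forall x, P x}.
Proof. by move=> HP; apply: nearW. Qed.

End AlmostEverywhere.

Section FourierL2.
Context (R : realType).
Local Notation mu := (@lebesgue_measure R).
Local Notation mu2 := (plane_measure R).
Local Notation T2 := (measurableTypeR R * measurableTypeR R)%type.
Implicit Types (f h : R * R -> R) (p k z : R * R).

Let box (n : nat) : set (R * R) :=
  `[- n%:R, n%:R]%classic `*` `[- n%:R, n%:R]%classic.

Definition cutoff f n p : R := \1_(box n) p * f p.

Lemma measurable_box n : measurable (box n : set T2).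
Proof. by apply: measurableX. Qed.

Lemma box_sub m n : (m <= n)%N -> box m `<=` box n.
Proof.
move=> mn; have mn' : m%:R <= n%:R :> R by rewrite ler_nat.
move=> p [/= /[!in_itv]/= /andP[? ?] /andP[? ?]]; split;
  rewrite /= in_itv/=; apply/andP; split; lra.
Qed.

Lemma bigcup_box : \bigcup_n box n = setT.
Proof.
apply/seteqP; split => // p _.
exists (Num.truncn (`|p.1| + `|p.2|)).+1 => //.
have H : `|p.1| + `|p.2| < (Num.truncn (`|p.1| + `|p.2|)).+1%:R.
  by apply: truncnS_gt; rewrite addr_ge0.
have H1 := ler_norm p.1; have H2 := ler_norm (- p.1).
have H3 := ler_norm p.2; have H4 := ler_norm (- p.2).
rewrite !normrN in H2 H4; have := normr_ge0 p.1; have := normr_ge0 p.2.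
by split => /=; rewrite in_itv/=; apply/andP; split; lra.
Qed.

Lemma box_lty n : (mu2 (box n) < +oo)%E.
Proof.
have fin : (mu ([set` `[- n%:R, n%:R : R]%R] : set R) < +oo)%E.
  by rewrite lebesgue_measure_itv/=; case: ifP => _; rewrite ?ltry.
rewrite [X in (X < _)%E](product_measure1E mu mu)//.
by apply: lte_mul_pinfty => //; rewrite ge0_fin_numE.
Qed.

Lemma cutoff_cvg f p : cutoff f n p @[n --> \oo] --> f p.
Proof.
have b1 : \1_(\bigcup_n box n) p = 1 :> R by rewrite bigcup_box indicT.
rewrite -[X in _ --> X]mul1r -b1; apply: cvgM; last exact: cvg_cst.
apply: cvg_indic_bigcup => m n mn; apply/subsetPset; exact: box_sub.
Qed.

Lemma cutoff_le f n p : `|cutoff f n p| <= `|f p|.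
Proof. by rewrite normrM ler_piMl// indic_le1. Qed.

Lemma measurable_cutoff f n : measurable_fun setT f -> measurable_fun setT (cutoff f n).
Proof.
by move=> mf; apply: measurable_funM => //; apply: measurable_indic; exact: measurable_box.
Qed.

Lemma sqitg_cutoff f n : sqitg mu2 f -> sqitg mu2 (cutoff f n).
Proof.
move=> sf; apply: (sqitg_le _ _ sf); first exact: measurable_cutoff (sqitg_meas sf).
by move=> p; exact: cutoff_le.
Qed.

Lemma itg_cutoff f n : sqitg mu2 f -> itg mu2 (cutoff f n).
Proof.
move=> sf; apply: sqitg_mul => //.
by apply: sqitg_indic; [exact: measurable_box|exact: box_lty].
Qed.

Lemma cutoff_mean_cvg f : sqitg mu2 f ->
  ip mu2 (fun p => cutoff f n p - f p) (fun p => cutoff f n p - f p) @[n --> \oo] --> 0.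
Proof.
move=> sf; have [|||_ //] := @sq_dct _ T2 R mu2 (cutoff f) f f _ sf.
- by move=> n; exact: measurable_cutoff (sqitg_meas sf).
- by move=> n p; exact: cutoff_le.
- by move=> p; exact: cutoff_cvg.
Qed.

Lemma ctB f h k : itg mu2 f -> itg mu2 h -> ct (fun p => f p - h p) k = ct f k - ct h k.
Proof.
move=> fi hi; rewrite /ct -RintegralB//; [|exact: itg_cos..].
by apply: eq_Rintegral => p _; rewrite mulrBl.
Qed.

Lemma stB f h k : itg mu2 f -> itg mu2 h -> st (fun p => f p - h p) k = st f k - st h k.
Proof.
move=> fi hi; rewrite /st -RintegralB//; [|exact: itg_sin..].
by apply: eq_Rintegral => p _; rewrite mulrBl.
Qed.

Lemma ctB_le f h : itg mu2 f -> itg mu2 h -> sqitg mu2 f -> sqitg mu2 h ->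
  ip mu2 (fun k => ct f k - ct h k) (fun k => ct f k - ct h k) <=
  (2 * pi) ^+ 2 * ip mu2 (fun p => f p - h p) (fun p => f p - h p).
Proof.
move=> fi hi sf sh; have [_ _ <-] := plancherel_L1L2 (itgB fi hi) (sqitgB sf sh).
under [X in ip _ X _ <= _]eq_fun do rewrite -ctB//.
by under [X in ip _ _ X <= _]eq_fun do rewrite -ctB//; rewrite lerDl ip_ge0.
Qed.

Lemma stB_le f h : itg mu2 f -> itg mu2 h -> sqitg mu2 f -> sqitg mu2 h ->
  ip mu2 (fun k => st f k - st h k) (fun k => st f k - st h k) <=
  (2 * pi) ^+ 2 * ip mu2 (fun p => f p - h p) (fun p => f p - h p).
Proof.
move=> fi hi sf sh; have [_ _ <-] := plancherel_L1L2 (itgB fi hi) (sqitgB sf sh).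
under [X in ip _ X _ <= _]eq_fun do rewrite -stB//.
by under [X in ip _ _ X <= _]eq_fun do rewrite -stB//; rewrite lerDr ip_ge0.
Qed.

Lemma fourier_truncE f n k :
  fourier_trunc f n k = Complex (ct (cutoff f n) k) (- st (cutoff f n) k).
Proof.
rewrite /fourier_trunc /ct /st; congr (Complex _ (- _)).
  rewrite Rintegral_mkcond; apply: eq_Rintegral => p _.
  rewrite patchE /cutoff indicE; case: (_ \in _); first by rewrite mul1r.
  by rewrite !mul0r.
rewrite Rintegral_mkcond; apply: eq_Rintegral => p _.
rewrite patchE /cutoff indicE; case: (_ \in _); first by rewrite mul1r.
by rewrite !mul0r.
Qed.

Lemma normc_sq (z : R[i]) :
  ComplexField.Normc.normc z ^+ 2 = complex.Re z ^+ 2 + complex.Im z ^+ 2.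
Proof. by case: z => a b /=; rewrite sqr_sqrtr// addr_ge0 ?sqr_ge0. Qed.

Definition mean_cvg (fn : nat -> R * R -> R) f : Prop :=
  ip mu2 (fun p => fn n p - f p) (fun p => fn n p - f p) @[n --> \oo] --> 0.

Lemma is_fourierP f (F : R * R -> R[i]) : sqitg mu2 f ->
  is_fourier f F <->
  [/\ sqitg mu2 (fun k => complex.Re (F k)), sqitg mu2 (fun k => complex.Im (F k)),
      mean_cvg (fun n k => ct (cutoff f n) k) (fun k => complex.Re (F k)) &
      mean_cvg (fun n k => - st (cutoff f n) k) (fun k => complex.Im (F k))].
Proof.
move=> sf.
have E (A B : R * R -> R) (FE : forall k, F k = Complex (A k) (B k)) n :
    sqitg mu2 A -> sqitg mu2 B ->
   (\int[mu2]_k ((ComplexField.Normc.normc (fourier_trunc f n k - F k)) ^+ 2)%:E)%E =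
   (ip mu2 (fun k => ct (cutoff f n) k - A k) (fun k => ct (cutoff f n) k - A k) +
    ip mu2 (fun k => - st (cutoff f n) k - B k) (fun k => - st (cutoff f n) k - B k))%:E.
  move=> sA sB.
  have [sc ss _] := plancherel_L1L2 (itg_cutoff n sf) (sqitg_cutoff n sf).
  have s1 := sqitgB sc sA; have s2 := sqitgB (sqitgN ss) sB.
  rewrite EFinD -!ip_EFin//.
  rewrite -integralD_EFin//; [|exact: s1.2|exact: s2.2].
  by apply: eq_integral => k _; rewrite fourier_truncE FE normc_sq.
have FE k : F k = Complex (complex.Re (F k)) (complex.Im (F k)) by case: (F k).
split.
- move=> [/sqitg_Lfun sA /sqitg_Lfun sB cv].
  have cv' : ip mu2 (fun k => ct (cutoff f n) k - complex.Re (F k)) (fun k => ct (cutoff f n) k - complex.Re (F k)) +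
    ip mu2 (fun k => - st (cutoff f n) k - complex.Im (F k)) (fun k => - st (cutoff f n) k - complex.Im (F k)) @[n --> \oo] --> (0 : R).
    have := fine_cvg (cv : _ --> (0 : R)%:E); rewrite /comp.
    under eq_fun => n do rewrite (E _ _ FE n sA sB) /=.
    by move=> H; exact: H.
  split=> //.
  + apply: (squeeze_cvgr _ (cvg_cst 0) cv'); apply: nearW => n.
    by rewrite ip_ge0 lerDl ip_ge0.
  + apply: (squeeze_cvgr _ (cvg_cst 0) cv'); apply: nearW => n.
    by rewrite ip_ge0 lerDr ip_ge0.
- move=> [sA sB cA cB]; split; [exact/sqitg_Lfun|exact/sqitg_Lfun|].
  under eq_fun => n do rewrite (E _ _ FE n sA sB).
  apply: cvg_EFin; first exact: nearW.
  by rewrite -[X in _ --> X](addr0 0); apply: cvgD.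
Qed.

Lemma mean_cvg_unique (fn : nat -> R * R -> R) f h :
  (forall n, sqitg mu2 (fn n)) -> sqitg mu2 f -> sqitg mu2 h ->
  mean_cvg fn f -> mean_cvg fn h -> {ae mu2, forall p, f p = h p}.
Proof.
move=> sfn sf sh cf ch.
have sD := sqitgB sf sh.
suff D0 : ip mu2 (fun p => f p - h p) (fun p => f p - h p) = 0.
  by apply: aeS (ip_eq0 sD D0) => p /subr0_eq.
apply/eqP; rewrite eq_le ip_ge0 andbT.
have c : 2 * ip mu2 (fun p => fn n p - f p) (fun p => fn n p - f p) +
    2 * ip mu2 (fun p => fn n p - h p) (fun p => fn n p - h p) @[n --> \oo] --> 2 * 0 + 2 * (0 : R).
  by apply: cvgD; apply: cvgMr.
rewrite mulr0 addr0 in c; apply: (cvgr_to_ge c); apply: nearW => n.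
have -> : (fun p => f p - h p) = (fun p => - (fn n p - f p) + (fn n p - h p)).
  by apply/funext => p; ring.
have s1 := sqitgB (sfn n) sf; have s2 := sqitgB (sfn n) sh.
apply: le_trans (ip_add_le (sqitgN s1) s2) _.
by rewrite ipNl ?ipNr ?opprK//; exact: sqitgN.
Qed.

Lemma mean_cvg_ip (fn : nat -> R * R -> R) f :
  (forall n, sqitg mu2 (fn n)) -> sqitg mu2 f -> mean_cvg fn f ->
  ip mu2 (fn n) (fn n) @[n --> \oo] --> ip mu2 f f.
Proof.
move=> sfn sf cf.
have c1 : ip mu2 (fn n) f @[n --> \oo] --> ip mu2 f f.
  by apply: ip_cvg => //; exact: nearW.
have c : ip mu2 (fun p => fn n p - f p) (fun p => fn n p - f p) + 2 * ip mu2 (fn n) f - ip mu2 f f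
   @[n --> \oo] --> 0 + 2 * ip mu2 f f - ip mu2 f f.
  by apply: cvgB; [apply: cvgD => //; exact: cvgMr|exact: cvg_cst].
have -> : ip mu2 f f = 0 + 2 * ip mu2 f f - ip mu2 f f by ring.
apply: cvg_trans c; apply: near_eq_cvg; apply: nearW => n /=.
rewrite ipBl//; last exact: sqitgB.
by rewrite !ipBr// (ipC mu2 f (fn n)); ring.
Qed.

(** By Plancherel's identity the transforms of the cutoffs form a Cauchy sequence. *)
Lemma fourier_exists f : sqitg mu2 f -> exists F, is_fourier f F.
Proof.
move=> sf; pose r n := (2 * pi) ^+ 2 *
   ip mu2 (fun p => cutoff f n p - f p) (fun p => cutoff f n p - f p).
have r0 : r @ \oo --> 0.
  rewrite -(mulr0 ((2 * pi) ^+ 2)); apply: cvgMr; exact: cutoff_mean_cvg.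
have cutB n m : (n <= m)%N -> (2 * pi) ^+ 2 *
   ip mu2 (fun p => cutoff f m p - cutoff f n p) (fun p => cutoff f m p - cutoff f n p) <= r n.
  move=> nm; rewrite ler_wpM2l ?sqr_ge0//; apply: ip_le.
  - by apply: sqitgB; exact: sqitg_cutoff.
  - by apply: sqitgB => //; exact: sqitg_cutoff.
  move=> p; rewrite /cutoff !indicE; have [pn|pn] := boolP (p \in box n).
    by rewrite (mem_set (box_sub nm (set_mem pn))) !mul1r subrr normr0.
  rewrite !mul0r subr0 sub0r normrN normrM ler_piMl//.
  by case: (_ \in _); rewrite /= ?normr1 ?normr0.
have sct n := plancherel_L1L2 (itg_cutoff n sf) (sqitg_cutoff n sf).
have [|n m nm|A sA cA] := @sqitg_complete _ _ _ mu2 (fun n => ct (cutoff f n)) r _ r0.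
- by move=> n; have [] := sct n.
- apply: le_trans (cutB _ _ nm).
  by apply: ctB_le; (try exact: itg_cutoff); exact: sqitg_cutoff.
have [|n m nm|B sB cB] := @sqitg_complete _ _ _ mu2 (fun n => st (cutoff f n)) r _ r0.
- by move=> n; have [] := sct n.
- apply: le_trans (cutB _ _ nm).
  by apply: stB_le; (try exact: itg_cutoff); exact: sqitg_cutoff.
exists (fun k => Complex (A k) (- B k)); apply/is_fourierP => //; split=> //=.
  exact: sqitgN.
apply: cvg_trans cB; apply: near_eq_cvg; apply: nearW => n.
by rewrite !ipE; apply: eq_Rintegral => k _; rewrite -sqrrN; congr (_ ^+ 2); ring.
Qed.

End FourierL2.

(** Both parts are opaque: a transform is only determined up to null sets, so that
    nothing about its values is meaningful beyond fourierP. *)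
HB.lock Definition fr (R : realType) (f : R * R -> R) (k : R * R) : R :=
  complex.Re (fourier f k).
HB.lock Definition fi (R : realType) (f : R * R -> R) (k : R * R) : R :=
  complex.Im (fourier f k).

Section FourierReIm.
Context (R : realType).
Local Notation mu2 := (plane_measure R).
Implicit Types (f h : R * R -> R) (p k z : R * R).

Lemma fourierE f k : fourier f k = Complex (fr f k) (fi f k).
Proof. by rewrite fr.unlock fi.unlock; case: (fourier f k). Qed.

Lemma fourierP f : sqitg mu2 f ->
  [/\ sqitg mu2 (fr f), sqitg mu2 (fi f),
      mean_cvg (fun n k => ct (cutoff f n) k) (fr f) &
      mean_cvg (fun n k => - st (cutoff f n) k) (fi f)].
Proof.
rewrite fr.unlock fi.unlock => sf; apply/(is_fourierP _ sf).
exact: (xgetPex (fun=> 0) (fourier_exists sf)).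
Qed.

Lemma sqitg_fr f : sqitg mu2 f -> sqitg mu2 (fr f).
Proof. by case/fourierP. Qed.

Lemma sqitg_fi f : sqitg mu2 f -> sqitg mu2 (fi f).
Proof. by case/fourierP. Qed.

Lemma sqitg_ct f : itg mu2 f -> sqitg mu2 f -> sqitg mu2 (ct f).
Proof. by move=> fi0 sf; have [] := plancherel_L1L2 fi0 sf. Qed.

Lemma sqitg_st f : itg mu2 f -> sqitg mu2 f -> sqitg mu2 (st f).
Proof. by move=> fi0 sf; have [] := plancherel_L1L2 fi0 sf. Qed.

Lemma plancherel f : sqitg mu2 f ->
  ip mu2 (fr f) (fr f) + ip mu2 (fi f) (fi f) = (2 * pi) ^+ 2 * ip mu2 f f.
Proof.
move=> sf; have [sA sB cA cB] := fourierP sf.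
have ic n := itg_cutoff n sf; have sc n := sqitg_cutoff n sf.
have sst n : sqitg mu2 (fun k => - st (cutoff f n) k) by apply: sqitgN; exact: sqitg_st.
have c1 := mean_cvg_ip (fun n => sqitg_ct (ic n) (sc n)) sA cA.
have c2 := mean_cvg_ip sst sB cB.
have c3 : (2 * pi) ^+ 2 * ip mu2 (cutoff f n) (cutoff f n) @[n --> \oo] --> (2 * pi) ^+ 2 * ip mu2 f f.
  by apply: cvgMr; apply: mean_cvg_ip => //; exact: cutoff_mean_cvg.
apply: (@cvg_unique R _ (fmap (fun n => ip mu2 (ct (cutoff f n)) (ct (cutoff f n)) +
   ip mu2 (fun k => - st (cutoff f n) k) (fun k => - st (cutoff f n) k)) \oo)) => //.
- exact: cvgD.
apply: cvg_trans c3; apply: near_eq_cvg; apply: nearW => n.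
have [_ _ <-] := plancherel_L1L2 (ic n) (sc n).
have s1 := sqitg_st (ic n) (sc n).
by rewrite ipNl ?ipNr ?opprK//; exact: sqitgN.
Qed.

End FourierReIm.

(** * Parseval, linearity, translations *)

Section FourierCalculus.
Context (R : realType).
Local Notation mu := (@lebesgue_measure R).
Local Notation mu2 := (plane_measure R).
Local Notation T2 := (measurableTypeR R * measurableTypeR R)%type.
Implicit Types (f g h A B : R * R -> R) (p k z : R * R).
Local Notation "f =ae g" := {ae mu2, forall p, f p = g p} (at level 70).

Lemma ctZD a f h k : itg mu2 f -> itg mu2 h ->
  ct (fun p => a * f p + h p) k = a * ct f k + ct h k.
Proof.
move=> fi0 hi; rewrite /ct -RintegralZl//; last exact: itg_cos.
rewrite -RintegralD//; [|by apply: itgZ; exact: itg_cos|exact: itg_cos].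
by apply: eq_Rintegral => p _; rewrite mulrDl mulrA.
Qed.

Lemma stZD a f h k : itg mu2 f -> itg mu2 h ->
  st (fun p => a * f p + h p) k = a * st f k + st h k.
Proof.
move=> fi0 hi; rewrite /st -RintegralZl//; last exact: itg_sin.
rewrite -RintegralD//; [|by apply: itgZ; exact: itg_sin|exact: itg_sin].
by apply: eq_Rintegral => p _; rewrite mulrDl mulrA.
Qed.

Lemma mean_cvgZD a (fn hn : nat -> R * R -> R) f h :
  (forall n, sqitg mu2 (fn n)) -> (forall n, sqitg mu2 (hn n)) ->
  sqitg mu2 f -> sqitg mu2 h -> mean_cvg fn f -> mean_cvg hn h ->
  mean_cvg (fun n p => a * fn n p + hn n p) (fun p => a * f p + h p).
Proof.
move=> sfn shn sf sh cf ch.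
have c : 2 * (a ^+ 2 * ip mu2 (fun p => fn n p - f p) (fun p => fn n p - f p)) +
    2 * ip mu2 (fun p => hn n p - h p) (fun p => hn n p - h p) @[n --> \oo] -->
    2 * (a ^+ 2 * 0) + 2 * (0 : R).
  by apply: cvgD; apply: cvgMr => //; exact: cvgMr.
rewrite !mulr0 addr0 in c; apply: (squeeze_cvgr _ (cvg_cst 0) c).
apply: nearW => n; rewrite ip_ge0 /=.
have s1 := sqitgB (sfn n) sf; have s2 := sqitgB (shn n) sh.
have -> : (fun p => a * fn n p + hn n p - (a * f p + h p)) =
  (fun p => a * (fn n p - f p) + (hn n p - h p)) by apply/funext => p; ring.
apply: le_trans (ip_add_le (sqitgZ a s1) s2) _.
by rewrite ipZl ?ipZr ?mulrA//; exact: sqitgZ.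
Qed.

Lemma mean_cvgM (g : R * R -> R) (fn : nat -> R * R -> R) f :
  measurable_fun setT g -> (forall p, `|g p| <= 1) ->
  (forall n, sqitg mu2 (fn n)) -> sqitg mu2 f -> mean_cvg fn f ->
  mean_cvg (fun n p => g p * fn n p) (fun p => g p * f p).
Proof.
move=> mg g1 sfn sf cf; apply: (squeeze_cvgr _ (cvg_cst 0) cf).
apply: nearW => n; rewrite ip_ge0 /=.
have sD := sqitgB (sfn n) sf.
have -> : (fun p => g p * fn n p - g p * f p) = (fun p => g p * (fn n p - f p)).
  by apply/funext => p; ring.
apply: ip_le => //; first exact: sqitgM_bounded sD.
by move=> p; rewrite normrM ler_piMl.
Qed.

Lemma fourier_unique f A B : sqitg mu2 f -> sqitg mu2 A -> sqitg mu2 B ->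
  mean_cvg (fun n k => ct (cutoff f n) k) A ->
  mean_cvg (fun n k => - st (cutoff f n) k) B -> fr f =ae A /\ fi f =ae B.
Proof.
move=> sf sA sB cA cB; have [sr si cr ci] := fourierP sf.
have ic n := itg_cutoff n sf; have sc n := sqitg_cutoff n sf.
split.
  by apply: (mean_cvg_unique _ sr sA cr cA) => n; exact: sqitg_ct.
by apply: (mean_cvg_unique _ si sB ci cB) => n; apply: sqitgN; exact: sqitg_st.
Qed.

Lemma fourierZD a f h : sqitg mu2 f -> sqitg mu2 h ->
  fr (fun p => a * f p + h p) =ae (fun k => a * fr f k + fr h k) /\
  fi (fun p => a * f p + h p) =ae (fun k => a * fi f k + fi h k).
Proof.
move=> sf sh; have [srf sif crf cif] := fourierP sf.
have [srh sih crh cih] := fourierP sh.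
have icf n := itg_cutoff n sf; have scf n := sqitg_cutoff n sf.
have ich n := itg_cutoff n sh; have sch n := sqitg_cutoff n sh.
have cutoffE n : cutoff (fun p => a * f p + h p) n = (fun p => a * cutoff f n p + cutoff h n p).
  by apply/funext => p; rewrite /cutoff; ring.
have E1 : (fun (n : nat) k => ct (cutoff (fun p => a * f p + h p) n) k) =
    (fun n k => a * ct (cutoff f n) k + ct (cutoff h n) k).
  by apply/funext => n; apply/funext => k; rewrite cutoffE ctZD.
have E2 : (fun (n : nat) k => - st (cutoff (fun p => a * f p + h p) n) k) =
    (fun n k => a * - st (cutoff f n) k + - st (cutoff h n) k).
  by apply/funext => n; apply/funext => k; rewrite cutoffE stZD//; ring.
have c1 := mean_cvgZD a (fun n => sqitg_ct (icf n) (scf n))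
  (fun n => sqitg_ct (ich n) (sch n)) srf srh crf crh.
have c2 := mean_cvgZD a (fun n => sqitgN (sqitg_st (icf n) (scf n)))
  (fun n => sqitgN (sqitg_st (ich n) (sch n))) sif sih cif cih.
rewrite -E1 in c1; rewrite -E2 in c2.
exact: (fourier_unique (sqitgD (sqitgZ a sf) sh) (sqitgD (sqitgZ a srf) srh)
  (sqitgD (sqitgZ a sif) sih) c1 c2).
Qed.

(** Polarization of Plancherel's identity. *)
Lemma parseval f h : sqitg mu2 f -> sqitg mu2 h ->
  ip mu2 (fr f) (fr h) + ip mu2 (fi f) (fi h) = (2 * pi) ^+ 2 * ip mu2 f h.
Proof.
move=> sf sh; have sD := sqitgD (sqitgZ 1 sf) sh.
have [er ei] := fourierZD 1 sf sh.
have srf := sqitg_fr sf; have sif := sqitg_fi sf.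
have srh := sqitg_fr sh; have sih := sqitg_fi sh.
have s1 := sqitgD (sqitgZ 1 srf) srh; have s2 := sqitgD (sqitgZ 1 sif) sih.
have pD := plancherel sD; have pf := plancherel sf; have ph := plancherel sh.
have R1 := ip_ae (sqitg_fr sD) (sqitg_fr sD) s1 s1 er er.
have R2 := ip_ae (sqitg_fi sD) (sqitg_fi sD) s2 s2 ei ei.
have Q A B (sA : sqitg mu2 A) (sB : sqitg mu2 B) :
    ip mu2 (fun p => 1 * A p + B p) (fun p => 1 * A p + B p) =
    ip mu2 A A + 2 * ip mu2 A B + ip mu2 B B.
  have s1A := sqitgZ 1 sA; have sAB := sqitgD s1A sB.
  rewrite (ipDl s1A sB sAB) (ipZl 1 sA sAB) (ipDr s1A sB sA) (ipDr s1A sB sB).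
  by rewrite (ipZr 1 sA sA) (ipZr 1 sA sB) (ipC mu2 B A); ring.
rewrite R1 in pD.
rewrite R2 in pD.
rewrite (Q _ _ sf sh) in pD.
rewrite (Q _ _ srf srh) in pD.
rewrite (Q _ _ sif sih) in pD.
move: (ip mu2 (fr f) (fr f)) (ip mu2 (fi f) (fi f)) (ip mu2 (fr h) (fr h))
  (ip mu2 (fi h) (fi h)) (ip mu2 (fr f) (fr h)) (ip mu2 (fi f) (fi h))
  (ip mu2 f f) (ip mu2 f h) (ip mu2 h h) ((2 * pi) ^+ 2) pD pf ph.
by move=> {Q R1 R2} x1 x2 x3 x4 x5 x6 y1 y2 y3 c; lra.
Qed.

Lemma fourier_L1L2 f : itg mu2 f -> sqitg mu2 f ->
  fr f =ae ct f /\ fi f =ae (fun k => - st f k).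
Proof.
move=> ifi sf; have sc := sqitg_ct ifi sf; have ss := sqitg_st ifi sf.
have ic n := itg_cutoff n sf; have sct n := sqitg_cutoff n sf.
have cv : (2 * pi) ^+ 2 * ip mu2 (fun p => cutoff f n p - f p) (fun p => cutoff f n p - f p)
    @[n --> \oo] --> (0 : R).
  by rewrite -(mulr0 ((2 * pi) ^+ 2)); apply: cvgMr; exact: cutoff_mean_cvg.
apply: fourier_unique => //; first exact: sqitgN.
- apply: (squeeze_cvgr _ (cvg_cst 0) cv); apply: nearW => n.
  by rewrite ip_ge0 /=; exact: ctB_le.
- apply: (squeeze_cvgr _ (cvg_cst 0) cv); apply: nearW => n.
  rewrite ip_ge0 /=; apply: le_trans (stB_le (ic n) ifi (sct n) sf).
  rewrite !ipE le_eqVlt; apply/orP; left; apply/eqP; apply: eq_Rintegral => k _.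
  by rewrite -sqrrN; congr (_ ^+ 2); ring.
Qed.

Lemma fourierB f h : sqitg mu2 f -> sqitg mu2 h ->
  fr (fun p => f p - h p) =ae (fun k => fr f k - fr h k) /\
  fi (fun p => f p - h p) =ae (fun k => fi f k - fi h k).
Proof.
move=> sf sh; have [er ei] := fourierZD (-1) sh sf.
rewrite (_ : (fun p => _ - _) = fun p => -1 * h p + f p); last first.
  by apply/funext => p; ring.
by split; [apply: aeS er => k ->; ring|apply: aeS ei => k ->; ring].
Qed.

Lemma fr_le f : sqitg mu2 f -> ip mu2 (fr f) (fr f) <= (2 * pi) ^+ 2 * ip mu2 f f.
Proof. by move=> sf; rewrite -plancherel// lerDl ip_ge0. Qed.

Lemma fi_le f : sqitg mu2 f -> ip mu2 (fi f) (fi f) <= (2 * pi) ^+ 2 * ip mu2 f f.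
Proof. by move=> sf; rewrite -plancherel// lerDr ip_ge0. Qed.

Lemma fourier_ae f h : sqitg mu2 f -> sqitg mu2 h -> f =ae h ->
  fr f =ae fr h /\ fi f =ae fi h.
Proof.
move=> sf sh fh; have sD := sqitgB sf sh.
have D0 : ip mu2 (fun p => f p - h p) (fun p => f p - h p) = 0.
  rewrite (ip_ae (f' := fun=> 0) (g' := fun=> 0) sD sD (sqitg0 _) (sqitg0 _)).
  - by have := ipZl 0 (sqitg0 mu2) (sqitg0 mu2); under eq_fun do rewrite mul0r; move=> ->; rewrite mul0r.
  - by apply: aeS fh => p ->; rewrite subrr.
  - by apply: aeS fh => p ->; rewrite subrr.
have [er ei] := fourierB sf sh.
have r0 : ip mu2 (fr (fun p => f p - h p)) (fr (fun p => f p - h p)) = 0.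
  by apply/eqP; rewrite eq_le ip_ge0 andbT; have := fr_le sD; rewrite D0 mulr0.
have i0 : ip mu2 (fi (fun p => f p - h p)) (fi (fun p => f p - h p)) = 0.
  by apply/eqP; rewrite eq_le ip_ge0 andbT; have := fi_le sD; rewrite D0 mulr0.
split.
  by apply: aeS2 er (ip_eq0 (sqitg_fr sD) r0) => k -> /subr0_eq.
by apply: aeS2 ei (ip_eq0 (sqitg_fi sD) i0) => k -> /subr0_eq.
Qed.

Lemma fourier_mean_cvg (fn : nat -> R * R -> R) f :
  (forall n, sqitg mu2 (fn n)) -> sqitg mu2 f -> mean_cvg fn f ->
  mean_cvg (fun n => fr (fn n)) (fr f) /\ mean_cvg (fun n => fi (fn n)) (fi f).
Proof.
move=> sfn sf cf.
have cv : (2 * pi) ^+ 2 * ip mu2 (fun p => fn n p - f p) (fun p => fn n p - f p)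
    @[n --> \oo] --> (0 : R).
  by rewrite -(mulr0 ((2 * pi) ^+ 2)); apply: cvgMr.
split; apply: (squeeze_cvgr _ (cvg_cst 0) cv); apply: nearW => n; rewrite ip_ge0 /=.
- apply: le_trans (fr_le (sqitgB (sfn n) sf)).
  have [er _] := fourierB (sfn n) sf.
  have s1 := sqitg_fr (sqitgB (sfn n) sf).
  have s2 := sqitgB (sqitg_fr (sfn n)) (sqitg_fr sf).
  by rewrite (ip_ae s1 s1 s2 s2 er er).
- apply: le_trans (fi_le (sqitgB (sfn n) sf)).
  have [_ ei] := fourierB (sfn n) sf.
  have s1 := sqitg_fi (sqitgB (sfn n) sf).
  have s2 := sqitgB (sqitg_fi (sfn n)) (sqitg_fi sf).
  by rewrite (ip_ae s1 s1 s2 s2 ei ei).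
Qed.

(** A bounded operator that acts as a multiplier on the Fourier integrals of
    functions that are also integrable does so on every transform, since the
    cutoffs are dense. *)
Lemma fourier_density (L : (R * R -> R) -> R * R -> R) (a b : R * R -> R) :
  (forall f, sqitg mu2 f -> sqitg mu2 (L f)) ->
  (forall f n, sqitg mu2 f ->
    ip mu2 (fun p => L (cutoff f n) p - L f p) (fun p => L (cutoff f n) p - L f p) <=
    ip mu2 (fun p => cutoff f n p - f p) (fun p => cutoff f n p - f p)) ->
  measurable_fun setT a -> measurable_fun setT b ->
  (forall k, `|a k| <= 1) -> (forall k, `|b k| <= 1) ->
  (forall f, itg mu2 f -> sqitg mu2 f ->
    fr (L f) =ae (fun k => a k * ct f k + b k * st f k) /\
    fi (L f) =ae (fun k => b k * ct f k - a k * st f k)) ->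
  forall f, sqitg mu2 f ->
    fr (L f) =ae (fun k => a k * fr f k - b k * fi f k) /\
    fi (L f) =ae (fun k => b k * fr f k + a k * fi f k).
Proof.
move=> sL LB ma mb a1 b1 L12 f sf.
have ic n := itg_cutoff n sf; have sc n := sqitg_cutoff n sf.
have cL : mean_cvg (fun n => L (cutoff f n)) (L f).
  apply: (squeeze_cvgr _ (cvg_cst 0) (cutoff_mean_cvg sf)); apply: nearW => n.
  by rewrite ip_ge0 /=; exact: LB.
have [cr ci] := fourier_mean_cvg (fun n => sL _ (sc n)) (sL _ sf) cL.
have [sr si crf cif] := fourierP sf.
have sct n := sqitg_ct (ic n) (sc n); have sst n := sqitgN (sqitg_st (ic n) (sc n)).
have sM g g' : measurable_fun setT g -> (forall k, `|g k| <= 1) -> sqitg mu2 g' ->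
    sqitg mu2 (fun k => g k * g' k) by move=> mg g1; exact: sqitgM_bounded.
have E n := L12 _ (ic n) (sc n).
split.
- apply: (mean_cvg_unique (fun n => sqitg_fr (sL _ (sc n))) (sqitg_fr (sL _ sf)) _ cr).
    by apply: sqitgB; exact: sM.
  have := @mean_cvgZD (-1) (fun n k => b k * - st (cutoff f n) k) (fun n k => a k * ct (cutoff f n) k)
    (fun k => b k * fi f k) (fun k => a k * fr f k) (fun n => sM _ _ mb b1 (sst n))
    (fun n => sM _ _ ma a1 (sct n)) (sM _ _ mb b1 si) (sM _ _ ma a1 sr)
    (mean_cvgM mb b1 sst si cif) (mean_cvgM ma a1 sct sr crf).
  rewrite (_ : (fun k => -1 * _ + _) = (fun k => a k * fr f k - b k * fi f k)); last first.
    by apply/funext => k; ring.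
  apply: cvg_trans; apply: near_eq_cvg; apply: nearW => n.
  have sX : sqitg mu2 (fun k => -1 * (b k * - st (cutoff f n) k) + a k * ct (cutoff f n) k).
    by apply: sqitgD; [apply: sqitgZ; exact: sM|exact: sM].
  have sY : sqitg mu2 (fun k => a k * fr f k - b k * fi f k) by apply: sqitgB; exact: sM.
  have s1 := sqitgB sX sY; have s2 := sqitgB (sqitg_fr (sL _ (sc n))) sY.
  apply: (ip_ae s1 s1 s2 s2); by apply: aeS (E n).1 => k ->; ring.
- apply: (mean_cvg_unique (fun n => sqitg_fi (sL _ (sc n))) (sqitg_fi (sL _ sf)) _ ci).
    by apply: sqitgD; exact: sM.
  have := @mean_cvgZD 1 (fun n k => b k * ct (cutoff f n) k) (fun n k => a k * - st (cutoff f n) k)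
    (fun k => b k * fr f k) (fun k => a k * fi f k) (fun n => sM _ _ mb b1 (sct n))
    (fun n => sM _ _ ma a1 (sst n)) (sM _ _ mb b1 sr) (sM _ _ ma a1 si)
    (mean_cvgM mb b1 sct sr crf) (mean_cvgM ma a1 sst si cif).
  rewrite (_ : (fun k => 1 * _ + _) = (fun k => b k * fr f k + a k * fi f k)); last first.
    by apply/funext => k; ring.
  apply: cvg_trans; apply: near_eq_cvg; apply: nearW => n.
  have sX : sqitg mu2 (fun k => 1 * (b k * ct (cutoff f n) k) + a k * - st (cutoff f n) k).
    by apply: sqitgD; [apply: sqitgZ; exact: sM|exact: sM].
  have sY : sqitg mu2 (fun k => b k * fr f k + a k * fi f k) by apply: sqitgD; exact: sM.
  have s1 := sqitgB sX sY; have s2 := sqitgB (sqitg_fi (sL _ (sc n))) sY.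
  apply: (ip_ae s1 s1 s2 s2); by apply: aeS (E n).2 => k ->; ring.
Qed.

Lemma ct_translate z f k : itg mu2 f ->
  ct (fun p => f (shift2 z p)) k = cos (dot z k) * ct f k + sin (dot z k) * st f k.
Proof.
move=> ifi; pose g p := cos (dot z k) * (f p * cos (dot p k)) + sin (dot z k) * (f p * sin (dot p k)).
have gi : itg mu2 g by apply: itgD; apply: itgZ; [exact: itg_cos|exact: itg_sin].
transitivity (\int[mu2]_p g (shift2 z p)).
  apply: eq_Rintegral => p _; rewrite /g dot_shift2 cosD sinD.
  set c := cos (dot z k); set s := sin (dot z k).
  have cs : c ^+ 2 + s ^+ 2 = 1 by exact: cos2Dsin2.
  rewrite -[in LHS](mulr1 (cos _)) -cs; ring.
rewrite Rint_translate// RintegralD//; [|by apply: itgZ; exact: itg_cos|by apply: itgZ; exact: itg_sin].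
by rewrite !RintegralZl//; [exact: itg_sin|exact: itg_cos].
Qed.

Lemma st_translate z f k : itg mu2 f ->
  st (fun p => f (shift2 z p)) k = cos (dot z k) * st f k - sin (dot z k) * ct f k.
Proof.
move=> ifi; pose g p := cos (dot z k) * (f p * sin (dot p k)) - sin (dot z k) * (f p * cos (dot p k)).
have gi : itg mu2 g by apply: itgB; apply: itgZ; [exact: itg_sin|exact: itg_cos].
transitivity (\int[mu2]_p g (shift2 z p)).
  apply: eq_Rintegral => p _; rewrite /g dot_shift2 cosD sinD.
  set c := cos (dot z k); set s := sin (dot z k).
  have cs : c ^+ 2 + s ^+ 2 = 1 by exact: cos2Dsin2.
  rewrite -[in LHS](mulr1 (sin _)) -cs; ring.
rewrite Rint_translate// RintegralB//; [|by apply: itgZ; exact: itg_sin|by apply: itgZ; exact: itg_cos].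
by rewrite !RintegralZl//; [exact: itg_cos|exact: itg_sin].
Qed.

(** A translation is an isometry whose action on Fourier integrals is a change of
    variables. *)
Lemma fourier_translate (z : R * R) f : sqitg mu2 f ->
  fr (fun p => f (shift2 z p)) =ae
    (fun k => cos (dot z k) * fr f k - sin (dot z k) * fi f k) /\
  fi (fun p => f (shift2 z p)) =ae
    (fun k => sin (dot z k) * fr f k + cos (dot z k) * fi f k).
Proof.
apply: (@fourier_density (fun f p => f (shift2 z p))).
- by move=> {}f sf; exact: sqitg_translate.
- move=> {}f n sf; have sD := sqitgB (sqitg_cutoff n sf) sf.
  by rewrite (ip_translate z sD sD).
- exact: measurableT_comp (@measurable_cosR R) (measurable_dotr z).
- exact: measurableT_comp (@measurable_sinR R) (measurable_dotr z).
- by move=> k; exact: normr_cos_le1.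
- by move=> k; exact: normr_sin_le1.
- move=> {}f ifi sf; have iz := itg_translate z ifi; have sz := sqitg_translate z sf.
  have [er ei] := fourier_L1L2 iz sz.
  split; first by apply: aeS er => k ->; rewrite ct_translate.
  by apply: aeS ei => k ->; rewrite st_translate//; ring.
Qed.

End FourierCalculus.

(** * Convolution with the Green function of 1 - dx^2 *)

Section MeasurableRint.
Context d1 d2 (T1 : measurableType d1) (T2 : measurableType d2) (R : realType).
Variable m2 : {sigma_finite_measure set T2 -> \bar R}.

Lemma measurable_Rint (h : T1 * T2 -> R) : measurable_fun setT h ->
  measurable_fun setT (fun x => \int[m2]_y h (x, y)).
Proof.
move=> /measurable_EFinP mh; rewrite /Rintegral.
apply: (measurableT_comp (@fine_measurable R setT measurableT)).
under eq_fun do rewrite integralE.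
apply: emeasurable_funB.
  have := @measurable_fun_fubini_tonelli_F _ _ T1 T2 R m2 (EFin \o h)^\+%E
    (measurable_funepos mh) (fun x => funepos_ge0 _ x).
  apply: eq_measurable_fun => x _; apply: eq_integral => y _.
  by rewrite !funeposE.
have := @measurable_fun_fubini_tonelli_F _ _ T1 T2 R m2 (EFin \o h)^\-%E
  (measurable_funeneg mh) (fun x => funeneg_ge0 _ x).
apply: eq_measurable_fun => x _; apply: eq_integral => y _.
by rewrite !funenegE.
Qed.

End MeasurableRint.

Section Domination.
Context d (T : measurableType d) (R : realType) (m : {measure set T -> \bar R}).

Lemma itg_le_ae (f g : T -> R) : measurable_fun setT f -> itg m g ->
  {ae m, forall x, `|f x| <= g x} ->
  itg m f /\ \int[m]_x `|f x| <= \int[m]_x g x.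
Proof.
move=> mf gi fg; have mg := itg_meas gi.
have H : (\int[m]_x (`|f x|)%:E <= \int[m]_x `|(g x)%:E|)%E.
  apply: ae_ge0_le_integral => //.
  - by apply/measurable_EFinP; exact: measurableT_comp.
  - by apply: measurableT_comp => //; exact/measurable_EFinP.
  - by apply: aeS fg => x fgx _; rewrite lee_fin; apply: le_trans fgx (ler_norm _).
have fi0 : itg m f.
  apply/integrableP; split; first exact/measurable_EFinP.
  by apply: le_lt_trans H _; move/integrableP : gi => [].
split=> //; rewrite -lee_fin -Rint_EFin; last exact: integrable_norm.
rewrite -Rint_EFin//; apply: le_trans H _.
rewrite le_eqVlt; apply/orP; left; apply/eqP; apply: ae_eq_integral => //.
- by apply: measurableT_comp => //; exact/measurable_EFinP.
- exact/measurable_EFinP.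
- apply: aeS fg => x fgx _ /=; rewrite ger0_norm//.
  exact: le_trans fgx.
Qed.

End Domination.

Section Convolution.
Context (R : realType).
Local Notation mu := (@lebesgue_measure R).
Local Notation mu2 := (plane_measure R).
Local Notation mu3 := (@plane R \x mu)%E.
Local Notation T1 := (measurableTypeR R).
Local Notation T2 := (measurableTypeR R * measurableTypeR R)%type.
Implicit Types (f g h : R * R -> R) (p k z : R * R).
Local Notation "f =ae g" := {ae mu2, forall p, f p = g p} (at level 70).

Definition green (w : R) : R := 2^-1 * two_sided_exp 1 w.

Lemma green_ge0 w : 0 <= green w.
Proof. by rewrite mulr_ge0// expR_ge0. Qed.

Lemma itg_green : itg mu green.
Proof. by apply: itgZ; exact: itg_two_sided_exp. Qed.

Lemma Rint_green : \int[mu]_w green w = 1.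
Proof.
rewrite RintegralZl//; last exact: itg_two_sided_exp.
by rewrite Rint_two_sided_exp//; field.
Qed.

(** The convolution is a mean of these translates, with weight green. *)
Definition xshift (w : R) p : R * R := shift2 (w, 0) p.

Lemma measurable_xshift :
  measurable_fun (setT : set (T2 * T1)) (fun u => xshift u.2 u.1 : T2).
Proof.
have m1 : measurable_fun (setT : set (T2 * T1)) (fst : T2 * T1 -> T2) by exact: measurable_fst.
have m2 : measurable_fun (setT : set (T2 * T1)) (snd : T2 * T1 -> T1) by exact: measurable_snd.
have f1 : measurable_fun (setT : set T2) (fst : T2 -> R) by exact: measurable_fst.
have f2 : measurable_fun (setT : set T2) (snd : T2 -> R) by exact: measurable_snd.
apply/measurable_fun_pairP; split; rewrite /comp /=.
  apply: (@measurable_funD _ (T2 * T1)%type R setT); last exact: m2.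
  exact: measurableT_comp f1 m1.
apply: (@measurable_funD _ (T2 * T1)%type R setT); last exact: measurable_cst.
exact: measurableT_comp f2 m1.
Qed.

Lemma measurable_green : measurable_fun setT green.
Proof. exact: itg_meas itg_green. Qed.

Lemma measurable_conv_integrand f : measurable_fun setT f ->
  measurable_fun (setT : set (T2 * T1)) (fun u => green u.2 * f (xshift u.2 u.1)).
Proof.
move=> mf; apply: measurable_funM.
  exact: (measurableT_comp measurable_green (@measurable_snd _ _ T2 T1)).
exact: (measurableT_comp mf measurable_xshift).
Qed.

Lemma itg_conv f : itg mu2 f -> itg mu3 (fun u => green u.2 * f (xshift u.2 u.1)).
Proof.
move=> ifi; have mf := itg_meas ifi.
apply/(@integrable21ltyP _ _ _ _ _ (@plane R) mu (EFin \o _)).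
  by apply/measurable_EFinP; exact: measurable_conv_integrand.
rewrite /= (eq_integral (fun w : T1 => (green w * \int[mu2]_p `|f p|)%:E)).
  have : itg mu (fun w => green w * \int[mu2]_z `|f z|).
    by under eq_fun do rewrite mulrC; apply: itgZ; exact: itg_green.
  by move=> i; rewrite (Rint_EFin i) ltry.
move=> w _ /=; rewrite -(Rint_translate (w, 0) (integrable_norm ifi)) -RintegralZl//; last first.
  exact: (itg_translate (w, 0) (integrable_norm ifi)).
rewrite -Rint_EFin; last by apply: itgZ; exact: (itg_translate (w, 0) (integrable_norm ifi)).
by apply: eq_integral => z _; rewrite normrM (ger0_norm (green_ge0 w)).
Qed.

Lemma convGE f p : measurable_fun setT f ->
  convG f p = \int[mu]_w (green w * f (xshift w p)).
Proof.
move=> mf; rewrite /convG.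
have mt : measurable_fun (setT : set T1) (fun z : T1 => z + p.1 : T1).
  exact: (@measurable_funD _ T1 R setT).
rewrite -[LHS](@Rint_preserving _ T1 R mu (fun z : R => (z + p.1)%R) mt).
- apply: eq_Rintegral => w _; rewrite /green /two_sided_exp /xshift /shift2 /=.
  by rewrite addr0 (addrC p.1 w) mul1r opprD addrCA subrr addr0 normrN.
- by move=> A mA; exact: lebesgue_translate.
apply: measurable_funM.
  apply: measurable_funM => //; apply: (measurableT_comp (@measurable_expR R)).
  apply: measurableT_comp => //; apply: (measurableT_comp (@normr_measurable R setT)).
  exact: (@measurable_funB _ T1 R setT).
exact: (measurableT_comp mf (pair2_measurable (p.2 : T1))).
Qed.

Lemma measurable_convG f : measurable_fun setT f -> measurable_fun setT (convG f).
Proof.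
move=> mf; rewrite (_ : convG f = fun p => \int[mu]_w (green w * f (xshift w p))).
  exact: (@measurable_Rint _ _ T2 T1 R mu (fun u => green u.2 * f (xshift u.2 u.1))
    (measurable_conv_integrand mf)).
by apply/funext => p; exact: convGE.
Qed.

Lemma itg_convG f : itg mu2 f -> itg mu2 (convG f).
Proof.
move=> ifi; have := fubini_itg1 (itg_conv ifi).
by congr (itg _ _); apply/funext => p; rewrite convGE//; exact: itg_meas ifi.
Qed.

Lemma itg_weighted_sq (f : R -> R) : measurable_fun setT f ->
  itg mu (fun w => green w * f w ^+ 2) -> itg mu (fun w => green w * f w).
Proof.
move=> mf i2; apply: (itg_le _ _ (itgD itg_green i2)).
  by apply: measurable_funM => //; exact: measurable_green.
move=> w; have g0 := green_ge0 w.
rewrite normrM (ger0_norm g0) -[X in _ <= X + _]mulr1 -mulrDr ler_wpM2l//.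
have := sqr_ge0 (`|f w| - 1); rewrite -[f w ^+ 2]real_normK ?num_real//; have := normr_ge0 (f w); nra.
Qed.

(** Jensen's inequality: integrate (f - t)^2 >= 0 against the probability density
    green, where t is the mean of f. *)
Lemma weighted_jensen (f : R -> R) : measurable_fun setT f ->
  itg mu (fun w => green w * f w ^+ 2) ->
  (\int[mu]_w (green w * f w)) ^+ 2 <= \int[mu]_w (green w * f w ^+ 2).
Proof.
move=> mf i2; have i1 := itg_weighted_sq mf i2.
set t := \int[mu]_w (green w * f w).
have i3 : itg mu (fun w => t ^+ 2 * green w) by apply: itgZ; exact: itg_green.
have i4 : itg mu (fun w => 2 * t * (green w * f w)) by exact: itgZ.
have : 0 <= \int[mu]_w (green w * f w ^+ 2 - (2 * t * (green w * f w) - t ^+ 2 * green w)).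
  apply: Rint_ge0 => w.
  rewrite (_ : _ - _ = green w * (f w - t) ^+ 2); last by ring.
  by rewrite mulr_ge0 ?green_ge0 ?sqr_ge0.
rewrite (RintegralB measurableT i2 (itgB i4 i3)) (RintegralB measurableT i4 i3).
rewrite (RintegralZl _ measurableT i1) (RintegralZl _ measurableT itg_green) Rint_green -/t.
clear i3 i4; clearbody t; move: (\int[mu]_w _) => a; lra.
Qed.

Lemma convG_ae_itg f : sqitg mu2 f ->
  {ae mu2, forall p, itg mu (fun w => green w * f (xshift w p) ^+ 2)}.
Proof. by move=> sf; exact: (fubini_ae1 (itg_conv sf.2)). Qed.

Lemma measurable_xslice f p : measurable_fun setT f ->
  measurable_fun setT (fun w => f (xshift w p)).
Proof.
move=> mf; apply: (measurableT_comp mf).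
exact: (measurableT_comp measurable_xshift (@pair1_measurable _ _ T2 T1 p)).
Qed.

(** Jensen's inequality pointwise, then Fubini's theorem: translates have the same
    norm and green has mass 1. *)
Lemma convG_sqitg f : sqitg mu2 f ->
  sqitg mu2 (convG f) /\ ip mu2 (convG f) (convG f) <= ip mu2 f f.
Proof.
move=> sf; have mf := sqitg_meas sf; have i3 := itg_conv sf.2.
have mc := measurable_convG mf.
have [||i2 le2] := @itg_le_ae _ T2 R mu2 (fun p => convG f p ^+ 2)
   (fun p => \int[mu]_w (green w * f (xshift w p) ^+ 2)) _ (fubini_itg1 i3).
- exact: measurable_funX.
- apply: aeS (convG_ae_itg sf) => p ip2; rewrite ger0_norm ?sqr_ge0// convGE//.
  by apply: weighted_jensen => //; exact: measurable_xslice.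
split; first by [].
rewrite ipE; apply: le_trans (_ : \int[mu2]_p `|convG f p ^+ 2| <= _).
  apply: Rint_le => //; first exact: integrable_norm.
  by move=> p; exact: ler_norm.
apply: le_trans le2 _; rewrite (Rfubini i3) /=.
rewrite (_ : \int[mu]_w _ = \int[mu]_w (green w * ip mu2 f f)).
  by rewrite RintegralZr ?Rint_green ?mul1r//; exact: itg_green.
apply: eq_Rintegral => w _.
rewrite (RintegralZl (green w) measurableT (itg_translate (w, 0) sf.2)).
by rewrite (Rint_translate (w, 0) sf.2) ipE.
Qed.

Lemma convGB f h : sqitg mu2 f -> sqitg mu2 h ->
  convG (fun p => f p - h p) =ae (fun p => convG f p - convG h p).
Proof.
move=> sf sh; have mf := sqitg_meas sf; have mh := sqitg_meas sh.
apply: aeS2 (convG_ae_itg sf) (convG_ae_itg sh) => p /(itg_weighted_sq (measurable_xslice p mf)) i1.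
move=> /(itg_weighted_sq (measurable_xslice p mh)) i2.
rewrite !convGE//; last exact: measurable_funB.
rewrite -RintegralB//; apply: eq_Rintegral => w _; ring.
Qed.

Lemma itg_green_trig (c : R -> R) (a : R) : continuous c -> (forall x, `|c x| <= 1) ->
  itg mu (fun w => green w * c (a * w)).
Proof.
move=> cc c1; apply: (itg_le _ _ itg_green).
  apply: measurable_funM; first exact: measurable_green.
  apply: (measurableT_comp (continuous_measurable_fun cc)).
  exact: (@measurable_funM _ T1 R setT).
by move=> w; rewrite normrM (ger0_norm (green_ge0 w)) ler_piMr ?green_ge0.
Qed.

Lemma Rint_green_cos a : \int[mu]_w (green w * cos (a * w)) = (1 + a ^+ 2)^-1.
Proof.
rewrite (_ : (fun w => _) = fun w => 2^-1 * (two_sided_exp 1 w * cos (a * w))).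
  rewrite RintegralZl//; first by rewrite Rint_exp_cos//; field; rewrite gt_eqF// ltr_pwDl ?sqr_ge0.
  apply: itg_two_sided_expM => //; last by move=> x; exact: normr_cos_le1.
  by apply: continuous_measurable_fun; exact: continuous_cos_lin.
by apply/funext => w; rewrite /green mulrA.
Qed.

Lemma Rint_green_sin a : \int[mu]_w (green w * sin (a * w)) = 0.
Proof.
rewrite (_ : (fun w => _) = fun w => 2^-1 * (two_sided_exp 1 w * sin (a * w))).
  rewrite RintegralZl//; first by rewrite Rint_exp_sin// mulr0.
  apply: itg_two_sided_expM => //; last by move=> x; exact: normr_sin_le1.
  by apply: continuous_measurable_fun; exact: continuous_sin_lin.
by apply/funext => w; rewrite /green mulrA.
Qed.

Lemma convG_wave (c : R -> R) g k : measurable_fun setT c -> (forall x, `|c x| <= 1) ->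
  itg mu2 g -> sqitg mu2 g ->
  \int[mu2]_q (convG g q * c (dot q k)) =
  \int[mu]_w (green w * \int[mu2]_q (g (xshift w q) * c (dot q k))).
Proof.
move=> mc c1 gi sg; have mg := itg_meas gi; have i3 := itg_conv gi.
have mck : measurable_fun (setT : set T2) (fun q => c (dot q k)).
  exact: measurableT_comp mc (measurable_dotl k).
have i3c : itg mu3 (fun u => green u.2 * g (xshift u.2 u.1) * c (dot u.1 k)).
  apply: (itg_le _ _ (integrable_norm i3)).
    apply: measurable_funM; first exact: itg_meas i3.
    exact: (measurableT_comp mck (@measurable_fst _ _ T2 T1)).
  by move=> u /=; rewrite normrM ler_piMr.
transitivity (\int[mu2]_q \int[mu]_w (green w * g (xshift w q) * c (dot q k))).
  apply: Rint_ae_eq.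
  - by apply: measurable_funM => //; exact: measurable_convG.
  - exact: itg_meas (fubini_itg1 i3c).
  - apply: aeS (fubini_ae1 i3) => q iq.
    by rewrite convGE// RintegralZr.
rewrite (Rfubini i3c); apply: eq_Rintegral => w _ /=.
rewrite -RintegralZl//; last first.
  by apply: itg_bounded => //; exact: (itg_translate (w, 0) gi).
by apply: eq_Rintegral => q _; rewrite mulrA.
Qed.

(** The transform of green is 1 / (1 + xi^2), and that of a mean of translates is
    the mean of the phases. *)
Lemma fourier_convG f : sqitg mu2 f ->
  fr (convG f) =ae (fun k => (1 + k.1 ^+ 2)^-1 * fr f k) /\
  fi (convG f) =ae (fun k => (1 + k.1 ^+ 2)^-1 * fi f k).
Proof.
move=> sf.
have a1 k : 1 <= 1 + k.1 ^+ 2 by rewrite lerDl sqr_ge0.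
have [||||||g ifi sg|er ei] := @fourier_density R (@convG R) (fun k => (1 + k.1 ^+ 2)^-1) (fun=> 0) _ _ _ _ _ _ _ f sf.
- by move=> g /convG_sqitg[].
- move=> g n sg; have sc := sqitg_cutoff n sg.
  have [s1 _] := convG_sqitg sc; have [s2 _] := convG_sqitg sg.
  have [s3 le3] := convG_sqitg (sqitgB sc sg); apply: le_trans le3.
  have s4 := sqitgB s1 s2; have E := convGB sc sg.
  by rewrite (ip_ae s3 s3 s4 s4 E E).
- apply: (measurableT_comp (f := fun x : R => (1 + x ^+ 2)^-1) (g := fst : T2 -> R)); last exact: measurable_fst.
  rewrite (_ : (fun x => _) = fun x => 2^-1 * poisson 1 x).
    apply: measurable_funM => //; apply: continuous_measurable_fun.
    exact: continuous_poisson.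
  by apply/funext => x; rewrite /poisson; field; rewrite gt_eqF// ltr_pwDl ?sqr_ge0.
- by [].
- by move=> k; rewrite ger0_norm ?invr_ge0 ?(le_trans ler01)// invf_le1// (lt_le_trans ltr01).
- by move=> k; rewrite normr0.
- have [er ei] := fourier_L1L2 (itg_convG ifi) (convG_sqitg sg).1.
  have dE w k : dot (w, 0) k = k.1 * w by rewrite /dot /= mul0r addr0 mulrC.
  have ic k : itg mu (fun w => green w * cos (k.1 * w)).
    by apply: itg_green_trig; [exact: continuous_cos|exact: normr_cos_le1].
  have isn k : itg mu (fun w => green w * sin (k.1 * w)).
    by apply: itg_green_trig; [exact: continuous_sin|exact: normr_sin_le1].
  have cE k : ct (convG g) k = (1 + k.1 ^+ 2)^-1 * ct g k.
    rewrite [LHS](convG_wave k (@measurable_cosR R) (@normr_cos_le1 R) ifi sg).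
    transitivity (\int[mu]_w (ct g k * (green w * cos (k.1 * w)) + st g k * (green w * sin (k.1 * w)))).
      by apply: eq_Rintegral => w _; rewrite [X in _ * X](ct_translate (w, 0) k ifi) dE; ring.
    rewrite RintegralD//; [|by apply: itgZ; exact: ic|by apply: itgZ; exact: isn].
    rewrite (RintegralZl _ measurableT (ic k)) (RintegralZl _ measurableT (isn k)).
    by rewrite Rint_green_cos Rint_green_sin; ring.
  have sE k : st (convG g) k = (1 + k.1 ^+ 2)^-1 * st g k.
    rewrite [LHS](convG_wave k (@measurable_sinR R) (@normr_sin_le1 R) ifi sg).
    transitivity (\int[mu]_w (st g k * (green w * cos (k.1 * w)) - ct g k * (green w * sin (k.1 * w)))).
      by apply: eq_Rintegral => w _; rewrite [X in _ * X](st_translate (w, 0) k ifi) dE; ring.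
    rewrite RintegralB//; [|by apply: itgZ; exact: ic|by apply: itgZ; exact: isn].
    rewrite (RintegralZl _ measurableT (ic k)) (RintegralZl _ measurableT (isn k)).
    by rewrite Rint_green_cos Rint_green_sin; ring.
  split; first by apply: aeS er => k ->; rewrite cE; ring.
  by apply: aeS ei => k ->; rewrite sE; ring.
split; first by apply: aeS er => k ->; ring.
by apply: aeS ei => k ->; ring.
Qed.

End Convolution.

(** * Weak derivatives and difference quotients *)

Section WeakDerivatives.
Context (R : realType).
Local Notation mu := (@lebesgue_measure R).
Local Notation mu2 := (plane_measure R).
Local Notation T2 := (measurableTypeR R * measurableTypeR R)%type.
Implicit Types (f g h : R * R -> R) (p k z e : R * R).

Let aeC (P Q : R * R -> Prop) : {ae mu2, forall x, P x} -> {ae mu2, forall x, Q x} ->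
  {ae mu2, forall x, P x /\ Q x}.
Proof. exact: aeS2. Qed.
Local Notation "f =ae g" := {ae mu2, forall p, f p = g p} (at level 70).

Lemma eq_cvg_seq (a b : nat -> R) (l : R) : (forall n, a n = b n) ->
  a n @[n --> \oo] --> l -> b n @[n --> \oo] --> l.
Proof. by move=> /funext ->. Qed.

(** The weak derivative in the direction e, of symbol i (e . k): for e = (1, 0) and
    e = (0, 1) it is is_dx and is_dy. *)
Definition wderiv e f h : Prop :=
  [/\ sqitg mu2 f, sqitg mu2 h,
      fr h =ae (fun k => - (dot e k * fi f k)) &
      fi h =ae (fun k => dot e k * fr f k)].

Lemma multiplier_derivP e f h :
  is_multiplier (fun k => Complex 0 (dot e k)) f h <-> wderiv e f h.
Proof.
split.
- move=> [/sqitg_Lfun sf /sqitg_Lfun sh E]; split=> //.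
    by apply: aeS E => k; rewrite !fourierE => -[-> _]; ring.
  by apply: aeS E => k; rewrite !fourierE => -[_ ->]; ring.
- move=> [sf sh Er Ei]; split; [exact/sqitg_Lfun|exact/sqitg_Lfun|].
  apply: aeS2 Er Ei => k Er Ei; rewrite !fourierE.
  by apply/eqP; rewrite eq_complex /= Er Ei; apply/andP; split; apply/eqP; ring.
Qed.

Lemma dot10 k : dot (1, 0) k = k.1 :> R.
Proof. by rewrite /dot /= mul1r mul0r addr0. Qed.

Lemma dot01 k : dot (0, 1) k = k.2 :> R.
Proof. by rewrite /dot /= mul1r mul0r add0r. Qed.

Lemma is_dxP f h : is_dx f h <-> wderiv (1, 0) f h.
Proof.
rewrite -multiplier_derivP /is_dx; split;
  by rewrite (_ : (fun k => Complex 0 k.1) = (fun k => Complex 0 (dot (1, 0) k)));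
  [|apply/funext => k; rewrite dot10].
Qed.

Lemma is_dyP f h : is_dy f h <-> wderiv (0, 1) f h.
Proof.
rewrite -multiplier_derivP /is_dy; split;
  by rewrite (_ : (fun k => Complex 0 k.2) = (fun k => Complex 0 (dot (0, 1) k)));
  [|apply/funext => k; rewrite dot01].
Qed.

Lemma derivZD e a f f' h h' : wderiv e f f' -> wderiv e h h' ->
  wderiv e (fun p => a * f p + h p) (fun p => a * f' p + h' p).
Proof.
move=> [sf sf' Rf If] [sh sh' Rh Ih].
have [r1 i1] := fourierZD a sf sh; have [r2 i2] := fourierZD a sf' sh'.
split; [by apply: sqitgD => //; exact: sqitgZ|by apply: sqitgD => //; exact: sqitgZ| |].
  apply: aeS (aeC (aeC r2 i1) (aeC Rf Rh)) => k [[-> ->] [-> ->]]; ring.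
apply: aeS (aeC (aeC i2 r1) (aeC If Ih)) => k [[-> ->] [-> ->]]; ring.
Qed.

(** The symbol i (e . k) is purely imaginary. *)
Lemma deriv_skew e f f' h h' : wderiv e f f' -> wderiv e h h' ->
  ip mu2 f' h = - ip mu2 f h'.
Proof.
move=> [sf sf' Rf If] [sh sh' Rh Ih].
have srf := sqitg_fr sf; have sif := sqitg_fi sf.
have srh := sqitg_fr sh; have sih := sqitg_fi sh.
have srf' := sqitg_fr sf'; have sif' := sqitg_fi sf'.
have srh' := sqitg_fr sh'; have sih' := sqitg_fi sh'.
have P1 := parseval sf' sh; have P2 := parseval sf sh'.
have E1 : ip mu2 (fr f') (fr h) = - ip mu2 (fi f) (fi h').
  rewrite -(ipNl sif sih'); apply: Rint_ae_eq.
  - exact: measurable_funM (sqitg_meas srf') (sqitg_meas srh).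
  - exact: measurable_funM (sqitg_meas (sqitgN sif)) (sqitg_meas sih').
  - by apply: aeS (aeC Rf Ih) => k [-> ->]; ring.
have E2 : ip mu2 (fi f') (fi h) = - ip mu2 (fr f) (fr h').
  rewrite -(ipNl srf srh'); apply: Rint_ae_eq.
  - exact: measurable_funM (sqitg_meas sif') (sqitg_meas sih).
  - exact: measurable_funM (sqitg_meas (sqitgN srf)) (sqitg_meas srh').
  - by apply: aeS (aeC If Rh) => k [-> ->]; ring.
have c0 : (2 * pi : R) ^+ 2 != 0 by rewrite expf_neq0// mulf_neq0// gt_eqF// pi_gt0.
apply: (mulfI c0); rewrite mulrN -P1 -P2 E1 E2.
by rewrite -opprD addrC.
Qed.

Lemma normr_sin_le (x : R) : `|sin x| <= `|x|.
Proof.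
wlog x0 : x / 0 < x => [H|].
  have [x0|x0|<-] := ltgtP 0 x; first exact: H.
    by rewrite -(normrN x) -(normrN (sin x)) -sinN; apply: H; rewrite oppr_gt0.
  by rewrite sin0.
have [|c _] := @MVT R sin cos 0 x x0 (fun y _ => is_derive_sin y).
  by apply: continuous_subspaceT; exact: continuous_sin.
by rewrite sin0 !subr0 => ->; rewrite normrM ler_piMl// normr_cos_le1.
Qed.

Lemma sin_quotient_cvg (t : R) :
  sin (n.+1%:R^-1 * t) / n.+1%:R^-1 @[n --> \oo] --> t.
Proof.
wlog t0 : t / 0 < t => [H|].
  have [t0|t0|<-] := ltgtP 0 t; first exact: H.
    have t1 : 0 < - t by rewrite oppr_gt0.
    rewrite -[X in _ --> X]opprK; apply: eq_cvg_seq (cvgN (H _ t1)) => n /=.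
    by rewrite mulrN sinN mulNr opprK.
  apply: eq_cvg_seq (cvg_cst (0 : R)) => n; by rewrite mulr0 sin0 mul0r.
have D : h^-1 * sin h @[h --> (0 : R)^'+] --> (1 : R).
  have [d dv] := is_derive_sin (0 : R).
  have : h^-1 *: (sin (h *: 1 + 0) - sin 0) @[h --> (0 : R)^'] --> 'D_1 sin (0 : R) by exact: d.
  rewrite dv cos0 => /cvg_dnbhs_at_right; apply: cvg_trans.
  apply: near_eq_cvg; apply: nearW => h /=.
  by rewrite sin0 subr0 addr0 /GRing.scale /= mulr1.
have u0 (n : nat) : 0 < n.+1%:R^-1 * t by rewrite mulr_gt0// invr_gt0.
have : (n.+1%:R^-1 * t)^-1 * sin (n.+1%:R^-1 * t) @[n --> \oo] --> (1 : R).
  have /cvg_at_rightP := D; apply; split=> //.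
  by rewrite -(mul0r t); apply: cvgM; [exact: cvg_harmonic|exact: cvg_cst].
move=> H; rewrite -[X in _ --> X]mul1r; apply: eq_cvg_seq (cvgM H (cvg_cst t)) => n /=.
have : n.+1%:R^-1 != 0 :> R by rewrite invr_neq0.
by move: (n.+1%:R^-1) => a a0; field; rewrite a0 gt_eqF.
Qed.

(** Dominated convergence, from |sin (t x) / t| <= |x|. *)
Lemma sinc_dct (th W : R * R -> R) : measurable_fun setT th -> measurable_fun setT W ->
  itg mu2 (fun k => th k * W k) ->
  \int[mu2]_k (sin (n.+1%:R^-1 * th k) / n.+1%:R^-1 * W k) @[n --> \oo] -->
  \int[mu2]_k (th k * W k).
Proof.
move=> mth mW i.
have [||||_ //] := @Rint_dct _ T2 R mu2
  (fun n k => sin (n.+1%:R^-1 * th k) / n.+1%:R^-1 * W k) (fun k => th k * W k)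
  (fun k => `|th k * W k|).
- move=> n; apply: measurable_funM => //; apply: measurable_funM => //.
  by apply: (measurableT_comp (@measurable_sinR R)); exact: measurable_funM.
- exact: integrable_norm.
- move=> n k; rewrite !normrM ler_wpM2r// normrV ?unitfE ?pnatr_eq0//.
  have n0 : 0 < n.+1%:R^-1 :> R by rewrite invr_gt0.
  rewrite (gtr0_norm n0) ler_pdivrMr//; apply: le_trans (normr_sin_le _) _.
  by rewrite normrM (gtr0_norm n0) mulrC.
- by move=> k; apply: cvgM; [exact: sin_quotient_cvg|exact: cvg_cst].
Qed.

Definition scale2 (t : R) e : R * R := (t * e.1, t * e.2).

Lemma dot_scale2 t e k : dot (scale2 t e) k = t * dot e k.
Proof. by rewrite /dot /scale2 /=; ring. Qed.

(** The central difference quotient, of symbol i sin(t e . k) / t.  It is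
    skew-symmetric, like the derivative, which the one-sided quotient is not. *)
Definition cdiff (t : R) e f p : R :=
  (2 * t)^-1 * (f (shift2 (scale2 t e) p) - f (shift2 (scale2 (- t) e) p)).

Lemma sqitg_cdiff t e f : sqitg mu2 f -> sqitg mu2 (cdiff t e f).
Proof.
by move=> sf; apply: sqitgZ; apply: sqitgB; exact: sqitg_translate.
Qed.

Lemma fourier_cdiff t e f : t != 0 -> sqitg mu2 f ->
  fr (cdiff t e f) =ae (fun k => - (sin (t * dot e k) / t * fi f k)) /\
  fi (cdiff t e f) =ae (fun k => sin (t * dot e k) / t * fr f k).
Proof.
move=> t0 sf.
have s1 := sqitg_translate (scale2 t e) sf; have s2 := sqitg_translate (scale2 (- t) e) sf.
have sB := sqitgB s1 s2.
have [r1 i1] := fourier_translate (scale2 t e) sf.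
have [r2 i2] := fourier_translate (scale2 (- t) e) sf.
have [rB iB] := fourierB s1 s2.
have [rZ iZ] := fourierZD (2 * t)^-1 sB (sqitg0 mu2).
have [r0 i0] := fourierZD (-1) (sqitg0 mu2) (sqitg0 mu2).
have E0 : (fun p : R * R => -1 * 0 + 0) = (fun=> 0 : R) by apply/funext => p; rewrite mulr0 addr0.
rewrite E0 in r0 i0.
have CE : cdiff t e f = (fun p => (2 * t)^-1 * (f (shift2 (scale2 t e) p) - f (shift2 (scale2 (- t) e) p)) + 0).
  by apply/funext => p; rewrite addr0.
rewrite CE; split.
  apply: aeS (aeC (aeC r1 r2) (aeC rB (aeC rZ r0))) => k [[h1 h2] [hB [-> h0]]].
  rewrite hB h1 h2 !dot_scale2 mulNr cosN sinN.
  have -> : fr (fun=> 0) k = 0 by move: h0; rewrite mulN1r addNr.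
  by field.
apply: aeS (aeC (aeC i1 i2) (aeC iB (aeC iZ i0))) => k [[h1 h2] [hB [-> h0]]].
rewrite hB h1 h2 !dot_scale2 mulNr cosN sinN.
have -> : fi (fun=> 0) k = 0 by move: h0; rewrite mulN1r addNr.
by field.
Qed.

(** The imaginary part of the product of F h with the conjugate of F f. *)
Definition cross f h k : R := fr f k * fi h k - fi f k * fr h k.

Lemma itg_cross f h : sqitg mu2 f -> sqitg mu2 h -> itg mu2 (cross f h).
Proof.
move=> sf sh; apply: itgB; apply: sqitg_mul;
  [exact: sqitg_fr|exact: sqitg_fi|exact: sqitg_fi|exact: sqitg_fr].
Qed.

Lemma measurable_dot_lin (t : R) e : measurable_fun (setT : set T2) (fun k => t * dot e k).
Proof. by apply: (@measurable_funM _ T2 R setT) => //; exact: measurable_dotr. Qed.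

Lemma ip_cdiff t e f h : t != 0 -> sqitg mu2 f -> sqitg mu2 h ->
  (2 * pi) ^+ 2 * ip mu2 (cdiff t e f) h =
  \int[mu2]_k (sin (t * dot e k) / t * cross f h k).
Proof.
move=> t0 sf sh; have sc := sqitg_cdiff t e sf.
rewrite -parseval// /ip -RintegralD//; last 2 first.
- by apply: sqitg_mul; exact: sqitg_fr.
- by apply: sqitg_mul; exact: sqitg_fi.
have [er ei] := fourier_cdiff e t0 sf.
apply: Rint_ae_eq.
- by apply: measurable_funD; apply: measurable_funM;
    [exact: sqitg_meas (sqitg_fr sc)|exact: sqitg_meas (sqitg_fr sh)|
     exact: sqitg_meas (sqitg_fi sc)|exact: sqitg_meas (sqitg_fi sh)].
- apply: measurable_funM; last exact: itg_meas (itg_cross sf sh).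
  apply: measurable_funM => //.
  exact: (measurableT_comp (@measurable_sinR R) (measurable_dot_lin t e)).
- by apply: aeS (aeC er ei) => k [-> ->]; rewrite /cross; ring.
Qed.

(** The symbol is paired with the cross spectrum, so that the derivative may fall on
    either of f and h, or be shared between them. *)
Lemma ip_cdiff_cvg e f h : sqitg mu2 f -> sqitg mu2 h ->
  itg mu2 (fun k => dot e k * cross f h k) ->
  (2 * pi) ^+ 2 * ip mu2 (cdiff n.+1%:R^-1 e f) h @[n --> \oo] -->
  \int[mu2]_k (dot e k * cross f h k).
Proof.
move=> sf sh i.
apply: eq_cvg_seq (sinc_dct (measurable_dotr e) (itg_meas (itg_cross sf sh)) i).
move=> n; rewrite -ip_cdiff//.
Qed.

(** Integrations by parts are made at the level of difference quotients, where they
    are changes of variables, and this limit brings them to derivatives. *)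
Lemma deriv_cdiff_cvg e f f' h : wderiv e f f' -> sqitg mu2 h ->
  ip mu2 (cdiff n.+1%:R^-1 e f) h @[n --> \oo] --> ip mu2 f' h.
Proof.
move=> [sf sf' Rf If] sh.
have i' : itg mu2 (fun k => fr f' k * fr h k + fi f' k * fi h k).
  by apply: itgD; apply: sqitg_mul; [exact: sqitg_fr..|exact: sqitg_fi|exact: sqitg_fi].
have E : {ae mu2, forall k, fr f' k * fr h k + fi f' k * fi h k = dot e k * cross f h k}.
  by apply: aeS (aeC Rf If) => k [-> ->]; rewrite /cross; ring.
have mc : measurable_fun setT (fun k => dot e k * cross f h k).
  by apply: measurable_funM; [exact: measurable_dotr|exact: itg_meas (itg_cross sf sh)].
have i : itg mu2 (fun k => dot e k * cross f h k).
  exact: (@itg_ae_eq _ T2 R mu2 (fun k => fr f' k * fr h k + fi f' k * fi h k) _ mc E i').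
have pi0 : (2 * pi : R) ^+ 2 != 0 by rewrite expf_neq0// mulf_neq0// gt_eqF// pi_gt0.
have I : \int[mu2]_k (dot e k * cross f h k) = (2 * pi) ^+ 2 * ip mu2 f' h.
  rewrite -(@Rint_ae_eq _ T2 R mu2 (fun k => fr f' k * fr h k + fi f' k * fi h k) _ (itg_meas i') mc E) -parseval// /ip RintegralD//.
    by apply: sqitg_mul; exact: sqitg_fr.
  by apply: sqitg_mul; exact: sqitg_fi.
have C := ip_cdiff_cvg sf sh i; rewrite I in C.
rewrite -[X in _ --> X](mulKf pi0).
apply: eq_cvg_seq (cvgM (cvg_cst ((2 * pi) ^+ 2)^-1) C) => n /=.
by rewrite mulrA mulVf// mul1r.
Qed.

(** On the Fourier side this is |sin x| <= |x|. *)
Lemma cdiff_le t e f f' : t != 0 -> wderiv e f f' ->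
  ip mu2 (cdiff t e f) (cdiff t e f) <= ip mu2 f' f'.
Proof.
move=> t0 [sf sf' Rf If]; have sc := sqitg_cdiff t e sf.
have pi0 : 0 < (2 * pi : R) ^+ 2 by rewrite exprn_gt0// mulr_gt0// pi_gt0.
rewrite -(ler_pM2l pi0) -!parseval// !ipE.
have [er ei] := fourier_cdiff e t0 sf.
have msin : measurable_fun (setT : set T2) (fun k => sin (t * dot e k) / t).
  apply: measurable_funM => //.
  exact: (measurableT_comp (@measurable_sinR R) (measurable_dot_lin t e)).
have bd k : (sin (t * dot e k) / t) ^+ 2 <= dot e k ^+ 2.
  rewrite -[leRHS]real_normK ?num_real// -[leLHS]real_normK ?num_real//.
  rewrite lerXn2r ?nnegrE// normrM normfV ler_pdivrMr ?normr_gt0//.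
  by apply: le_trans (normr_sin_le _) _; rewrite normrM mulrC.
have mono (A B C : R * R -> R) : sqitg mu2 A -> sqitg mu2 B ->
    A =ae (fun k => sin (t * dot e k) / t * C k) -> B =ae (fun k => dot e k * C k) ->
    \int[mu2]_k (A k ^+ 2) <= \int[mu2]_k (B k ^+ 2).
  move=> sA sB EA EB.
  have [|||_ le1] := @itg_le_ae _ T2 R mu2 (fun k => A k ^+ 2) (fun k => B k ^+ 2).
  - exact: itg_meas sA.2.
  - exact: sB.2.
  - apply: aeS (aeC EA EB) => k [-> ->]; rewrite ger0_norm ?sqr_ge0// [X in X <= _]exprMn [X in _ <= X]exprMn.
    by apply: ler_wpM2r; [exact: sqr_ge0|exact: bd].
  apply: le_trans le1; apply: Rint_le; [exact: sA.2|exact: integrable_norm sA.2|].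
  by move=> k; exact: ler_norm.
have leR := mono _ _ (fun k => - fi f k) (sqitg_fr sc) (sqitg_fr sf').
have leI := mono _ _ (fr f) (sqitg_fi sc) (sqitg_fi sf').
apply: lerD; [apply: leR|exact: leI].
  by apply: aeS er => k ->; ring.
by apply: aeS Rf => k ->; ring.
Qed.

End WeakDerivatives.

(** * Vanishing of the flux outside a strip *)

Section NonlocalVanishing.
Context (R : realType).
Local Notation mu := (@lebesgue_measure R).
Local Notation mu2 := (plane_measure R).
Local Notation T1 := (measurableTypeR R).
Local Notation T2 := (measurableTypeR R * measurableTypeR R)%type.
Implicit Types (f g h : R * R -> R) (p : R * R).

Lemma ae_interval (P : R -> Prop) (c d : R) : c < d -> {ae mu, forall x, P x} ->
  exists x, [/\ c < x, x < d & P x].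
Proof.
move=> cd aeP; apply: contrapT => /forallNP nP.
have neg : mu.-negligible (~` P : set T1) by exact: aeP.
have : mu.-negligible (`]c, d[%classic : set T1).
  apply: negligibleS neg => x /=; rewrite in_itv/= => /andP[cx xd] Px.
  by apply: (nP x).
case=> B [mB B0 sB].
have : (mu (`]c, d[%classic : set R) <= mu B)%E by apply: le_measure; rewrite ?inE.
by rewrite [X in (_ <= X)%E]B0 lebesgue_measure_itv/= lte_fin cd lee_fin leNgt subr_gt0 cd.
Qed.

Lemma sqitg_prod (a b : R -> R) : sqitg mu a -> sqitg mu b ->
  sqitg mu2 (fun p => a p.1 * b p.2) /\
  ip mu2 (fun p => a p.1 * b p.2) (fun p => a p.1 * b p.2) = ip mu a a * ip mu b b.
Proof.
move=> sa sb.
have E : (fun p : R * R => (a p.1 * b p.2) ^+ 2) = (fun p => a p.1 ^+ 2 * b p.2 ^+ 2).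
  by apply/funext => p; rewrite exprMn.
split; last by rewrite !ipE E (Rint_prod sa.2 sb.2).
split; last by rewrite E; exact: itg_prod sa.2 sb.2.
apply: (@measurable_funM _ T2 R setT).
  by apply: (measurableT_comp (sqitg_meas sa)); exact: measurable_fst.
by apply: (measurableT_comp (sqitg_meas sb)); exact: measurable_snd.
Qed.

Lemma measurable_two_sided_exp (e : R) : measurable_fun setT (two_sided_exp e).
Proof. by apply: continuous_measurable_fun; exact: continuous_two_sided_exp. Qed.

Lemma two_sided_exp_sq (e x : R) : two_sided_exp e x ^+ 2 = two_sided_exp (2 * e) x.
Proof. by rewrite expr2 -expRD; congr expR; ring. Qed.

Lemma sqitg_two_sided_exp (e : R) : 0 < e -> sqitg mu (two_sided_exp e) /\
  ip mu (two_sided_exp e) (two_sided_exp e) = e^-1.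
Proof.
move=> e0; have e2 : 0 < 2 * e by rewrite mulr_gt0.
have E : (fun x => two_sided_exp e x ^+ 2) = two_sided_exp (2 * e).
  by apply/funext => x; rewrite two_sided_exp_sq.
split; last by rewrite ipE E Rint_two_sided_exp// invfM mulrA divff ?mul1r.
split; first exact: measurable_two_sided_exp.
by rewrite E; exact: itg_two_sided_exp.
Qed.

Lemma measurable_green_sub (x : R) : measurable_fun (setT : set T1) (fun z => green (x - z)).
Proof.
apply: (measurableT_comp (@measurable_green R)).
by apply: measurable_funB => //; exact: measurable_id.
Qed.

Lemma sqitg_green (x : R) : sqitg mu (fun z => green (x - z)).
Proof.
apply: (@sqitg_le _ T1 R mu _ (fun z => 2^-1 * expR `|x| * two_sided_exp 1 z)).
- exact: measurable_green_sub.
- move=> z; rewrite /green /two_sided_exp [leLHS]ger0_norm ?[leRHS]ger0_norm ?mulr_ge0 ?expR_ge0// ?invr_ge0//.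
  rewrite -mulrA ler_wpM2l ?invr_ge0// -expRD ler_expR !mul1r.
  have hh := ler_normD (z - x) x; rewrite subrK (distrC z) in hh; lra.
- by apply: sqitgZ; exact: (sqitg_two_sided_exp _).1.
Qed.

(** Fubini's theorem: integrating first in z produces the convolution on the line
    of abscissa x. *)
Lemma ip_green_slice f (x e : R) : sqitg mu2 f -> 0 < e ->
  itg mu (fun y => two_sided_exp e y * convG f (x, y)) /\
  ip mu2 f (fun p => green (x - p.1) * two_sided_exp e p.2) =
  \int[mu]_y (two_sided_exp e y * convG f (x, y)).
Proof.
move=> sf e0.
have sK := (sqitg_prod (sqitg_green x) (sqitg_two_sided_exp e0).1).1.
have i := sqitg_mul sf sK.
have E (y : R) : (fun z => f (z, y) * (green (x - z) * two_sided_exp e y)) =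
    (fun z => two_sided_exp e y * (2^-1 * expR (- `|x - z|) * f (z, y))).
  by apply/funext => z; rewrite /green {1}/two_sided_exp mul1r; ring.
have aeE : {ae mu, forall y : R, \int[mu]_z (f (z, y) * (green (x - z) * two_sided_exp e y)) =
    two_sided_exp e y * convG f (x, y)}.
  have := @fubini_ae2 _ _ T1 T1 R mu mu _ i; apply: aeS => y /= iy.
  rewrite E /convG/= RintegralZl//.
  have ye : two_sided_exp e y != 0 by rewrite gt_eqF// expR_gt0.
  rewrite E in iy; have := itgZ (two_sided_exp e y)^-1 iy; congr (itg mu _).
  by apply/funext => z /=; rewrite mulKf.
have m1 : measurable_fun (setT : set T1) (fun y => two_sided_exp e y * convG f (x, y)).
  apply: measurable_funM; first exact: measurable_two_sided_exp.
  apply: (measurableT_comp (measurable_convG (sqitg_meas sf))).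
  exact: measurable_pair1.
have i2 := @fubini_itg2 _ _ T1 T1 R mu mu _ i.
split; first exact: itg_ae_eq m1 aeE i2.
by rewrite /ip (@Rfubini2 _ _ T1 T1 R mu mu _ i); exact: Rint_ae_eq (itg_meas i2) m1 aeE.
Qed.

(** A potential with two opposite poles, decaying like exp(-|z|) on both sides. *)
Definition dipole (x1 x2 z : R) : R := green (x1 - z) - green (x2 - z).

Lemma sqitg_dipole x1 x2 : sqitg mu (dipole x1 x2).
Proof. by apply: sqitgB; exact: sqitg_green. Qed.

Lemma dipole_left x1 x2 z : x1 <= x2 -> z <= x1 ->
  dipole x1 x2 z = 2^-1 * (expR (- x1) - expR (- x2)) * expR z.
Proof.
move=> x12 zx; rewrite /dipole /green /two_sided_exp !mul1r !ger0_norm ?subr_ge0//.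
  by rewrite !opprB !expRD; ring.
exact: le_trans zx x12.
Qed.

Lemma dipole_right x1 x2 z : x1 <= x2 -> x2 <= z ->
  dipole x1 x2 z = - (2^-1 * (expR x2 - expR x1) * expR (- z)).
Proof.
move=> x12 zx; rewrite /dipole /green /two_sided_exp !mul1r !ler0_norm ?subr_le0//.
  by rewrite !opprK !expRD; ring.
exact: le_trans x12 zx.
Qed.

(** The quotient is at least 1; half of that follows from the tangent of exp at 0. *)
Lemma expR_cdiff_ge (t : R) : 0 < t -> 2^-1 <= (2 * t)^-1 * (expR t - expR (- t)).
Proof.
move=> t0; rewrite invfM -mulrA ler_peMr ?invr_ge0// ler_pdivlMl// mulr1.
have h1 := expR_ge1Dx t; have h2 : expR (- t) <= 1 by rewrite expR_le1 oppr_le0 ltW.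
lra.
Qed.

(** The dipole is a positive multiple of exp z on the left of its poles and a
    negative multiple of exp(-z) on their right, hence increasing on both sides:
    this is what gives both sides of the strip the same sign below. *)
Lemma dipole_cdiff x1 x2 z (t : R) : x1 < x2 -> 0 < t ->
  z <= x1 - t \/ x2 + t <= z ->
  0 < `|dipole x1 x2 z| /\
  2^-1 * `|dipole x1 x2 z| <= (2 * t)^-1 * (dipole x1 x2 (z + t) - dipole x1 x2 (z - t)).
Proof.
move=> x12 t0; have h := expR_cdiff_ge t0; have x12' := ltW x12.
move=> [zx|zx].
  rewrite !dipole_left//; [|lra..].
  have c0 : 0 < 2^-1 * (expR (- x1) - expR (- x2)).
    by rewrite mulr_gt0 ?invr_gt0// subr_gt0 ltr_expR ltrN2.
  move: (2^-1 * (expR (- x1) - expR (- x2))) c0 => c c0.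
  rewrite gtr0_norm ?mulr_gt0 ?expR_gt0//; split=> //.
  rewrite !expRD [leRHS](_ : _ = (c * expR z) * ((2 * t)^-1 * (expR t - expR (- t)))); last by ring.
  by rewrite mulrC ler_pM2l// mulr_gt0 ?expR_gt0.
rewrite !dipole_right//; [|lra..].
have c0 : 0 < 2^-1 * (expR x2 - expR x1) by rewrite mulr_gt0 ?invr_gt0// subr_gt0 ltr_expR.
move: (2^-1 * (expR x2 - expR x1)) c0 => c c0.
rewrite normrN gtr0_norm ?mulr_gt0 ?expR_gt0//; split=> //.
rewrite !opprD !opprK !expRD.
rewrite [leRHS](_ : _ = (c * expR (- z)) * ((2 * t)^-1 * (expR t - expR (- t)))); last by ring.
by rewrite mulrC ler_pM2l// mulr_gt0 ?expR_gt0.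
Qed.

Lemma Rint_le_ae d (T : measurableType d) (m : {measure set T -> \bar R}) (f g : T -> R) :
  itg m f -> itg m g -> {ae m, forall x, f x <= g x} ->
  \int[m]_x f x <= \int[m]_x g x.
Proof.
move=> fi gi fg; rewrite -subr_ge0 -RintegralB//.
have i := itgB gi fi.
rewrite (@Rint_ae_eq _ T R m _ (fun x => `|g x - f x|)) ?Rint_ge0//.
- exact: itg_meas i.
- exact: itg_meas (integrable_norm i).
- by apply: aeS fg => x h; rewrite ger0_norm// subr_ge0.
Qed.

Lemma shift2N e p : shift2 (scale2 (-1) e) (shift2 e p) = p.
Proof. by case: p => x y; rewrite /shift2 /scale2 /= !mulN1r !addrK. Qed.

Lemma ip_shiftC e f g : sqitg mu2 f -> sqitg mu2 g ->
  ip mu2 (fun p => f (shift2 e p)) g = ip mu2 f (fun p => g (shift2 (scale2 (-1) e) p)).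
Proof.
move=> sf sg; have sg' := sqitg_translate (scale2 (-1) e) sg.
rewrite -(ip_translate e sf sg'); congr (ip mu2 _ _); apply/funext => p.
by rewrite shift2N.
Qed.

Lemma scale2A (s t : R) e : scale2 s (scale2 t e) = scale2 (s * t) e.
Proof. by rewrite /scale2 /= !mulrA. Qed.

Lemma ip_cdiffC (t : R) e f g : sqitg mu2 f -> sqitg mu2 g ->
  ip mu2 (cdiff t e f) g = - ip mu2 f (cdiff t e g).
Proof.
move=> sf sg.
have sft := sqitg_translate (scale2 t e) sf; have sft' := sqitg_translate (scale2 (- t) e) sf.
have sgt := sqitg_translate (scale2 t e) sg; have sgt' := sqitg_translate (scale2 (- t) e) sg.
rewrite /cdiff ipZl ?ipZr ?ipBl ?ipBr ?ip_shiftC//; try exact: sqitgB.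
by rewrite !scale2A !mulN1r opprK -mulrN opprB.
Qed.

(** The cut-off in y has a slope O(e) times itself, whereas its norm only grows
    like e^(-1/2): this beats the lack of decay in y. *)
Lemma two_sided_exp_cdiff_le (e t y : R) : 0 < e <= 1 -> 0 < t <= 1 ->
  `|(2 * t)^-1 * (two_sided_exp e (y + t) - two_sided_exp e (y - t))| <=
  e * expR 1 * two_sided_exp e y.
Proof.
move=> /andP[e0 e1] /andP[t0 t1].
have expB (A B : R) : expR A - expR B <= expR A * (A - B).
  have := ler_wpM2l (expR_ge0 A) (expR_ge1Dx (B - A)).
  by rewrite mulrDr mulr1 -expRD subrKC mulrBr mulrBr; move: (expR A) (expR B) => x z; lra.
have key (r s : R) : r \in [:: y + t; y - t] -> s \in [:: y + t; y - t] ->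
    two_sided_exp e r - two_sided_exp e s <= 2 * t * (e * expR 1 * two_sided_exp e y).
  move=> hr hs; apply: le_trans (expB _ _) _.
  have rs : `|s| - `|r| <= 2 * t.
    have := lerB_dist s r; move: hr hs; rewrite !inE => /orP[] /eqP-> /orP[] /eqP-> h;
    apply: le_trans h _.
    - by rewrite subrr normr0; lra.
    - by rewrite (_ : _ - _ = - (2 * t)) ?normrN ?gtr0_norm ?mulr_gt0//; ring.
    - by rewrite (_ : _ - _ = (2 * t)) ?gtr0_norm ?mulr_gt0//; ring.
    - by rewrite subrr normr0; lra.
  have ry : `|y| - `|r| <= t.
    have := lerB_dist y r; move: hr; rewrite !inE => /orP[] /eqP-> h; apply: le_trans h _.
      by rewrite (_ : _ - _ = - t) ?normrN ?gtr0_norm//; ring.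
    by rewrite (_ : _ - _ = t) ?gtr0_norm//; ring.
  rewrite [leRHS](_ : _ = (expR 1 * two_sided_exp e y) * (2 * t * e)); last by ring.
  apply: le_trans (_ : _ <= expR (- (e * `|r|)) * (2 * t * e)) _.
    by rewrite ler_wpM2l ?expR_ge0//; nra.
  rewrite /two_sided_exp -expRD; apply: ler_wpM2r; first by rewrite !mulr_ge0 ?(ltW e0) ?(ltW t0).
  by rewrite ler_expR; nra.
rewrite normrM gtr0_norm ?invr_gt0 ?mulr_gt0// ler_pdivrMl ?mulr_gt0//.
by rewrite ler_norml; apply/andP; split; [rewrite lerNl opprB|]; apply: key;
  rewrite !inE eqxx ?orbT.
Qed.

Let K x1 x2 e p : R := dipole x1 x2 p.1 * two_sided_exp e p.2.

Let sqitg_K x1 x2 e : 0 < e -> sqitg mu2 (K x1 x2 e) /\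
  ip mu2 (K x1 x2 e) (K x1 x2 e) = ip mu (dipole x1 x2) (dipole x1 x2) / e.
Proof.
move=> e0; have [s1 i1] := sqitg_two_sided_exp e0.
by have [s2 i2] := sqitg_prod (sqitg_dipole x1 x2) s1; rewrite i1 in i2.
Qed.

Let ip_K f x1 x2 e : sqitg mu2 f -> 0 < e ->
  itg mu (fun y => two_sided_exp e y * (convG f (x1, y) - convG f (x2, y))) /\
  ip mu2 f (K x1 x2 e) =
  \int[mu]_y (two_sided_exp e y * (convG f (x1, y) - convG f (x2, y))).
Proof.
move=> sf e0; have [s1 _] := sqitg_two_sided_exp e0.
have [i1 E1] := ip_green_slice x1 sf e0; have [i2 E2] := ip_green_slice x2 sf e0.
have EE : (fun y => two_sided_exp e y * (convG f (x1, y) - convG f (x2, y))) =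
  (fun y => two_sided_exp e y * convG f (x1, y) - two_sided_exp e y * convG f (x2, y)).
  by apply/funext => y; rewrite mulrBr.
split; first by rewrite EE; exact: (itgB i1 i2).
rewrite EE (RintegralB measurableT i1 i2) -E1 -E2.
have sg1 := (sqitg_prod (sqitg_green x1) s1).1.
have sg2 := (sqitg_prod (sqitg_green x2) s1).1.
rewrite -(ipBr sg1 sg2 sf); congr (ip mu2 f _); apply/funext => p.
by rewrite /K /dipole mulrBl.
Qed.

Lemma harmonic_le (d : R) : 0 < d -> \forall n \near \oo, (n.+1%:R^-1 : R) <= d.
Proof.
by move=> d0; near=> n; rewrite ltW//; near: n; exact: near_infty_natSinv_lt (PosNum d0).
Unshelve. all: by end_near. Qed.

Lemma eq0_of_sq_le (A C : R) : 0 <= C -> (forall e, 0 < e -> e <= 1 -> A ^+ 2 <= C * e) -> A = 0.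
Proof.
move=> C0 H; apply/eqP; rewrite -sqrf_eq0; apply/negPn/negP => A0.
have A2 : 0 < A ^+ 2 by rewrite lt_def A0 sqr_ge0.
move: (A ^+ 2) A2 H {A0} => B B0 H.
have := H (B / (B + C + 1)); have D0 : 0 < B + C + 1 by lra.
rewrite divr_gt0// ler_pdivrMr// mul1r mulrA ler_pdivlMr//.
have -> : B <= B + C + 1 by lra.
by move=> /(_ isT isT); nra.
Qed.

Lemma sq_le_of_half (A B C D e : R) : 0 <= A -> A <= B -> - D <= - (2^-1 * B) ->
  D ^+ 2 <= C * e -> A ^+ 2 <= 4 * C * e.
Proof.
move=> A0 AB DB DC; apply: (@le_trans _ _ ((2 * D) ^+ 2)); last by rewrite exprMn; lra.
by rewrite lerXn2r ?nnegrE//; lra.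
Qed.

Lemma outside_strip (a b x1 x2 t x : R) : ~~ (a < x < b) -> t <= x1 - a -> t <= b - x2 ->
  x <= x1 - t \/ x2 + t <= x.
Proof.
by rewrite negb_and -!leNgt => /orP[h|h] h1 h2; [left|right]; lra.
Qed.

(** Testing with the dipole, whose poles lie in the strip, and a cut-off in y: the
    values of the convolution at the poles are zero; by parts in x, N is paired with
    the slope of the dipole on both sides of the strip, without cancellation; by
    parts in y, v is paired with the slope of the cut-off, which is negligible as
    e tends to 0. *)
Lemma nonlocal_vanish (a b : R) (N dN v vy : R * R -> R) : a < b ->
  wderiv (1, 0) N dN -> wderiv (0, 1) v vy -> (forall p, 0 <= N p) ->
  {ae mu2, forall p, a < p.1 < b -> N p = 0} ->
  {ae mu2, forall p, a < p.1 < b -> convG dN p + convG vy p = 0} ->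
  {ae mu2, forall p, N p = 0}.
Proof.
move=> ab dNP dvP N0 Nab Qab.
have [sN sdN _ _] := dNP; have [sv svy _ _] := dvP.
have aeQ := @ae_prod1 _ _ T1 T1 R mu mu _ Qab.
have [x1 [ax1 x1b Q1]] := ae_interval ab aeQ.
have [x2 [x12 x2b Q2]] := ae_interval x1b aeQ.
(* Both convolutions are evaluated at the poles, where their sum is zero. *)
have tested e : 0 < e -> ip mu2 dN (K x1 x2 e) = - ip mu2 vy (K x1 x2 e).
  move=> e0; have [i1 ->] := ip_K x1 x2 sdN e0; have [i2 ->] := ip_K x1 x2 svy e0.
  apply/eqP; rewrite -addr_eq0 -RintegralD//; apply/eqP.
  transitivity (\int[mu]_y (0 : R)); last by rewrite /Rintegral integral0_eq.
  apply: Rint_ae_eq => //; first exact: itg_meas (itgD i1 i2).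
  apply: aeS2 Q1 Q2 => y /= q1 q2.
  have h1 := q1 _; rewrite ax1 x1b in h1; have {h1} h1 := h1 isT.
  have h2 := q2 _; rewrite (lt_trans ax1 x12) x2b in h2; have {h2} h2 := h2 isT.
  by rewrite -mulrDr addrACA -opprD h1 h2 subrr mulr0.
(* The slope of the dipole is at least half its modulus wherever N lives. *)
have oneside e : 0 < e -> ip mu2 dN (K x1 x2 e) <= - (2^-1 * ip mu2 N (fun p => `|K x1 x2 e p|)).
  move=> e0; have [sK _] := sqitg_K x1 x2 e0.
  have sKn : sqitg mu2 (fun p => `|K x1 x2 e p|).
    apply: (sqitg_le _ _ sK); last by move=> p; rewrite normr_id.
    by apply: (measurableT_comp (@normr_measurable R setT)); exact: sqitg_meas sK.
  apply: (cvgr_to_le (deriv_cdiff_cvg dNP sK)).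
  have d1 : 0 < x1 - a by rewrite subr_gt0.
  have d2 : 0 < b - x2 by rewrite subr_gt0.
  near=> n.
  have n1 : n.+1%:R^-1 <= x1 - a by near: n; exact: harmonic_le.
  have n2 : n.+1%:R^-1 <= b - x2 by near: n; exact: harmonic_le.
  have n0 : 0 < n.+1%:R^-1 :> R by rewrite invr_gt0.
  move: (n.+1%:R^-1) n0 n1 n2 => t t0 t1 t2.
  rewrite ip_cdiffC// lerN2 -ipZr//.
  have sc := sqitg_cdiff t (1, 0) sK.
  apply: Rint_le_ae; [exact: (sqitg_mul sN (sqitgZ _ sKn))|exact: sqitg_mul|].
  apply: aeS Nab => p Np.
  case: (boolP (a < p.1 < b)) => [/Np ->|out]; first by rewrite !mul0r.
  rewrite ler_wpM2l// /cdiff /scale2 /shift2 /K /= !mulr1 !mulr0 !addr0.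
  rewrite normrM (ger0_norm (two_sided_exp_ge0 _ _)).
  have [|_ h] := @dipole_cdiff x1 x2 p.1 t x12 t0.
    exact: outside_strip out t1 t2.
  by rewrite -mulrBl !mulrA ler_wpM2r ?two_sided_exp_ge0.
(* The squared slope of the cut-off is O(e^2), its squared norm 1/e. *)
have small e : 0 < e -> e <= 1 -> ip mu2 vy (K x1 x2 e) ^+ 2 <=
    (expR 1 ^+ 2 * ip mu (dipole x1 x2) (dipole x1 x2) * ip mu2 v v) * e.
  move=> e0 e1; have [sK EK] := sqitg_K x1 x2 e0.
  have C := deriv_cdiff_cvg dvP sK.
  have C2 : ip mu2 (cdiff n.+1%:R^-1 (0, 1) v) (K x1 x2 e) ^+ 2 @[n --> \oo] --> ip mu2 vy (K x1 x2 e) ^+ 2.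
    by rewrite expr2; exact: (cvgM C C).
  apply: (cvgr_to_le C2); apply: nearW => n.
  have n0 : 0 < (n.+1%:R^-1 : R) <= 1 by rewrite invr_gt0 ltr0n/= invf_le1// ler1n.
  move: (n.+1%:R^-1) n0 => t t0.
  have sc := sqitg_cdiff t (0, 1) sK.
  rewrite ip_cdiffC// sqrrN; apply: le_trans (ip_CS sv sc) _.
  have ringE (A B C' D : R) : A * B * C' * D = C' * (D * (A * B)) by ring.
  rewrite [leRHS]ringE; apply: ler_wpM2l; first exact: ip_ge0.
  have -> : e * (expR 1 ^+ 2 * ip mu (dipole x1 x2) (dipole x1 x2)) =
      (e * expR 1) ^+ 2 * ip mu2 (K x1 x2 e) (K x1 x2 e).
    rewrite EK exprMn (expr2 e); move: (ip mu _ _) (expR 1 ^+ 2) => A B.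
    by field; rewrite gt_eqF.
  have e00 : 0 <= e * expR 1 by rewrite mulr_ge0 ?expR_ge0// ltW.
  rewrite expr2 -mulrA -ipZr// -ipZl//; last exact: sqitgZ.
  apply: ip_le => // [|p]; first exact: sqitgZ.
  rewrite /cdiff /scale2 /shift2 /K /= !mulr1 !mulr0 !addr0.
  rewrite -mulrBr mulrCA (mulrCA (e * expR 1)) !(normrM (dipole _ _ _)) ler_wpM2l//.
  rewrite [leRHS]ger0_norm; last by rewrite mulr_ge0// two_sided_exp_ge0.
  by apply: two_sided_exp_cdiff_le; rewrite ?e0.
have s1 := (sqitg_K x1 x2 (@ltr01 R)).1.
have sKn e : 0 < e -> sqitg mu2 (fun p => `|K x1 x2 e p|).
  move=> /(sqitg_K x1 x2)[sK _].
  apply: (sqitg_le _ _ sK); last by move=> p; rewrite normr_id.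
  by apply: (measurableT_comp (@normr_measurable R setT)); exact: sqitg_meas sK.
(* The cut-off at e = 1 is the smallest one, so that N paired with it inherits
   all the bounds. *)
have z : ip mu2 N (fun p => `|K x1 x2 1 p|) = 0.
  pose C := expR 1 ^+ 2 * ip mu (dipole x1 x2) (dipole x1 x2) * ip mu2 v v.
  apply: (@eq0_of_sq_le _ (4 * C)) => [|e e0 e1].
    by rewrite !mulr_ge0 ?ip_ge0 ?sqr_ge0.
  have h0 : 0 <= ip mu2 N (fun p => `|K x1 x2 1 p|).
    by apply: Rint_ge0 => p; rewrite mulr_ge0.
  have h1 : ip mu2 N (fun p => `|K x1 x2 1 p|) <= ip mu2 N (fun p => `|K x1 x2 e p|).
    apply: Rint_le => [||p]; [by apply: sqitg_mul => //; exact: sKn..|].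
    rewrite ler_wpM2l// /K !normrM ler_wpM2l// !ger0_norm ?two_sided_exp_ge0//.
    by rewrite ler_expR lerN2 ler_wpM2r.
  have h2 := oneside e e0; rewrite (tested e e0) in h2.
  have h3 := small e e0 e1; rewrite -/C in h3.
  exact: sq_le_of_half h0 h1 h2 h3.
have := Rint_ge0_eq0 (sqitg_mul sN (sKn _ ltr01)) _ z.
move=> /(_ (fun p => mulr_ge0 (N0 p) (normr_ge0 _))) NK.
apply: aeS2 NK Nab => p NK Np.
case: (boolP (a < p.1 < b)) => [/Np //|out].
have d0 : 0 < Num.min (x1 - a) (b - x2) by rewrite lt_min !subr_gt0 ax1.
have [|k0 _] := @dipole_cdiff x1 x2 p.1 _ x12 d0.
  by apply: outside_strip out _ _; rewrite ge_min lexx ?orbT.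
move/eqP: NK; rewrite mulf_eq0 normr_eq0 mulf_eq0 (gt_eqF (expR_gt0 _)) orbF.
by case/orP => [/eqP//|/eqP k00]; move: k0; rewrite k00 normr0 ltxx.
Unshelve. all: by end_near. Qed.

End NonlocalVanishing.

(** * From the spectrum to the supremum *)

Section SupBound.
Context (R : realType).
Local Notation mu := (@lebesgue_measure R).
Local Notation mu2 := (plane_measure R).
Local Notation T2 := (measurableTypeR R * measurableTypeR R)%type.
Implicit Types (f g h : R * R -> R) (p k : R * R).

Lemma normr_Rint_le (f g : T2 -> R) : measurable_fun setT f -> itg mu2 g ->
  (forall p, `|f p| <= g p) -> `|\int[mu2]_p f p| <= \int[mu2]_p g p.
Proof.
move=> mf ig fg; have fi := itg_le mf fg ig.
apply: le_trans (le_normr_Rintegral measurableT fi) _.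
by apply: Rint_le; [exact: integrable_norm|exact: ig|].
Qed.

(** Tested against the indicator of {u > c}, u would have a mean greater than c on
    that set; by Parseval the mean is at most (2 pi)^-2 times the integral of
    |fr u| + |fi u|. *)
Lemma spectrum_bound_above (u : R * R -> R) (c : R) : sqitg mu2 u ->
  itg mu2 (fun k => `|fr u k| + `|fi u k|) ->
  \int[mu2]_k (`|fr u k| + `|fi u k|) <= c -> 0 < c ->
  {ae mu2, forall p, u p <= c}.
Proof.
move=> su iF Ic c0.
pose A : set T2 := [set p | c < u p].
have mA : measurable A.
  have := @measurable_fun_ltr _ T2 R setT (fun=> c) u (measurable_cst _) (sqitg_meas su).
  by move=> /(_ measurableT [set true] I); rewrite setTI.
pose phi : T2 -> R := \1_A.
have mphi : measurable_fun setT phi by exact: measurable_indic.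
have phi_ge0 p : 0 <= phi p by rewrite /phi indicE ler0n.
have phi1 p : `|phi p| <= (c ^+ 2)^-1 * u p ^+ 2.
  rewrite /phi indicE; case: (boolP (p \in A)) => [|_]; last first.
    by rewrite normr0 mulr_ge0 ?invr_ge0 ?sqr_ge0.
  rewrite inE => pA; rewrite normr1 ler_pdivlMl ?exprn_gt0// mulr1.
  by apply: lerXn2r; rewrite ?nnegrE ltW//; exact: lt_trans pA.
have iphi : itg mu2 phi := itg_le mphi phi1 (itgZ _ su.2).
have sphi : sqitg mu2 phi.
  split=> //; apply: (itg_le _ _ iphi); first exact: measurable_funX.
  by move=> p; rewrite /phi indicE; case: (p \in A) => /=; rewrite ?expr0n ?expr1n ?normr1 ?normr0.
pose m := \int[mu2]_p phi p.
have m0 : 0 <= m by exact: Rint_ge0.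
have [Er Ei] := fourier_L1L2 iphi sphi.
have ctm k : `|ct phi k| <= m.
  apply: normr_Rint_le => //; first exact: itg_meas (itg_cos k iphi).
  by move=> p; rewrite normrM (ger0_norm (phi_ge0 p)) ler_piMr// normr_cos_le1.
have stm k : `|st phi k| <= m.
  apply: normr_Rint_le => //; first exact: itg_meas (itg_sin k iphi).
  by move=> p; rewrite normrM (ger0_norm (phi_ge0 p)) ler_piMr// normr_sin_le1.
have mF := itg_meas iF.
(* fr phi and fi phi are at most the mass m of phi. *)
have upper : (2 * pi) ^+ 2 * ip mu2 u phi <= m * c.
  have sru := sqitg_fr su; have siu := sqitg_fi su.
  have sct := sqitg_ct iphi sphi; have sst := sqitg_st iphi sphi.
  rewrite -parseval//.
  have -> : ip mu2 (fr u) (fr phi) = ip mu2 (fr u) (ct phi).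
    by apply: (ip_ae sru (sqitg_fr sphi) sru sct _ Er); exact: aeT.
  have -> : ip mu2 (fi u) (fi phi) = ip mu2 (fi u) (fun k => - st phi k).
    by apply: (ip_ae siu (sqitg_fi sphi) siu (sqitgN sst) _ Ei); exact: aeT.
  rewrite /ip -RintegralD//; last 2 first.
  - exact: (sqitg_mul sru sct).
  - exact: (sqitg_mul siu (sqitgN sst)).
  apply: le_trans (ler_norm _) _.
  apply: le_trans (_ : _ <= \int[mu2]_k (m * (`|fr u k| + `|fi u k|))) _; last first.
    by rewrite RintegralZl//; exact: ler_wpM2l.
  apply: normr_Rint_le.
  - by apply: measurable_funD; [exact: itg_meas (sqitg_mul sru sct)|exact: itg_meas (sqitg_mul siu (sqitgN sst))].
  - exact: itgZ.
  - move=> k; apply: le_trans (ler_normD _ _) _; rewrite !normrM normrN mulrDr.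
    by apply: lerD; rewrite mulrC ler_wpM2r.
(* phi lives where u > c. *)
have lower : c * m <= ip mu2 u phi.
  rewrite /m -RintegralZl//; apply: Rint_le; [exact: itgZ|exact: sqitg_mul|].
  move=> p; rewrite /phi indicE; case: (boolP (p \in A)) => [|_]; last by rewrite !mulr0.
  by rewrite inE => pA; rewrite !mulr1 ltW.
have pi1 : 1 <= (2 * pi : R) ^+ 2.
  by rewrite exprn_ege1//; have := @pi_ge2 R; lra.
have ip0 : 0 <= ip mu2 u phi by apply: le_trans lower; rewrite mulr_ge0// ltW.
have z : \int[mu2]_p ((u p - c) * phi p) = 0.
  have -> : (fun p => (u p - c) * phi p) = (fun p => u p * phi p - c * phi p).
    by apply/funext => p; rewrite mulrBl.
  rewrite (RintegralB measurableT (sqitg_mul su sphi) (itgZ c iphi)) RintegralZl//.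
  have up2 : ip mu2 u phi <= m * c.
    by apply: le_trans upper; rewrite ler_peMl.
  by apply/eqP; rewrite subr_eq0 eq_le -/(ip mu2 u phi) -/m lower mulrC up2.
have i3 : itg mu2 (fun p => (u p - c) * phi p).
  rewrite (_ : (fun p => _) = (fun p => u p * phi p - c * phi p)).
    by apply: itgB; [exact: sqitg_mul|exact: itgZ].
  by apply/funext => p; rewrite mulrBl.
apply: aeS (Rint_ge0_eq0 i3 _ z) => p.
  rewrite leNgt => zp; apply/negP => cu; move: zp; rewrite /phi indicE.
  by rewrite mem_set// mulr1 => /eqP; rewrite subr_eq0 gt_eqF.
rewrite /phi indicE; case: (boolP (p \in A)) => [|_]; last by rewrite mulr0.
by rewrite inE => pA; rewrite mulr1 subr_ge0 ltW.
Qed.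

Lemma spectrum_bound (u : R * R -> R) (c : R) : sqitg mu2 u ->
  itg mu2 (fun k => `|fr u k| + `|fi u k|) ->
  \int[mu2]_k (`|fr u k| + `|fi u k|) <= c -> 0 < c ->
  {ae mu2, forall p, `|u p| <= c}.
Proof.
move=> su iF Ic c0.
have su' := sqitgN su.
have [er ei] := fourierZD (-1) su (sqitg0 mu2).
have [er0 ei0] := fourierZD (-1) (sqitg0 mu2) (sqitg0 mu2).
have E0 : (fun p : R * R => -1 * 0 + 0) = (fun=> 0 : R) by apply/funext => p; rewrite mulr0 addr0.
rewrite E0 in er0 ei0.
have E1 : (fun p => -1 * u p + 0) = (fun p => - u p) by apply/funext => p; rewrite addr0 mulN1r.
rewrite E1 in er ei.
have E : {ae mu2, forall k, `|fr u k| + `|fi u k| =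
    `|fr (fun p => - u p) k| + `|fi (fun p => - u p) k|}.
  apply: aeS2 (aeS2 (fun _ a b => conj a b) er ei) (aeS2 (fun _ a b => conj a b) er0 ei0) => k [-> ->] [a b].
  have -> : fr (fun=> 0) k = 0 by move: a; rewrite mulN1r addNr.
  have -> : fi (fun=> 0) k = 0 by move: b; rewrite mulN1r addNr.
  by rewrite !addr0 !mulN1r !normrN.
have m' : measurable_fun (setT : set T2) (fun k => `|fr (fun p => - u p) k| + `|fi (fun p => - u p) k|).
  by apply: measurable_funD; apply: (measurableT_comp (@normr_measurable R setT));
    apply: sqitg_meas; [exact: sqitg_fr|exact: sqitg_fi].
have i' := @itg_ae_eq _ T2 R mu2 (fun k => `|fr u k| + `|fi u k|) _ m' E iF.
have I' := @Rint_ae_eq _ T2 R mu2 (fun k => `|fr u k| + `|fi u k|) _ (itg_meas iF) m' E.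
have b1 := spectrum_bound_above su iF Ic c0; rewrite I' in Ic.
have b2 := spectrum_bound_above su' i' Ic c0.
by apply: aeS2 b1 b2 => p h1 h2; rewrite ler_norml h1 lerNl h2.
Qed.

(** The symbol of 1 - dx^2 - dy^2. *)
Definition bessel k : R := 1 + k.1 ^+ 2 + k.2 ^+ 2.

Lemma bessel_ge1 k : 1 <= bessel k.
Proof. by rewrite /bessel -addrA lerDl addr_ge0 ?sqr_ge0. Qed.

Lemma measurable_bessel : measurable_fun (setT : set T2) bessel.
Proof.
by apply: measurable_funD; [apply: measurable_funD => //|]; apply: measurable_funX;
  [exact: measurable_fst|exact: measurable_snd].
Qed.

Lemma bessel_inv_le k : (bessel k ^+ 2)^-1 <= poisson2 1 k.
Proof.
have h1 : 0 < 1 + k.1 ^+ 2 by rewrite ltr_pwDl ?sqr_ge0.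
have h2 : 0 < 1 + k.2 ^+ 2 by rewrite ltr_pwDl ?sqr_ge0.
rewrite /poisson2 /poisson !mulr1 expr1n.
have b0 : 0 < bessel k ^+ 2 by rewrite exprn_gt0// (lt_le_trans ltr01 (bessel_ge1 k)).
apply: (@le_trans _ _ ((1 + k.1 ^+ 2) * (1 + k.2 ^+ 2))^-1).
  rewrite lef_pV2 ?posrE; [rewrite /bessel|exact: b0|exact: mulr_gt0].
  move: (k.1 ^+ 2) (k.2 ^+ 2) (sqr_ge0 k.1) (sqr_ge0 k.2) => x y x0 y0; nra.
rewrite invfM mulrACA ler_peMl ?mulr_ge0 ?invr_ge0 ?(ltW h1) ?(ltW h2)//; lra.
Qed.

Definition sup_const : R := 1 + \int[mu2]_k poisson2 1 k.

(** The spectrum is summable because |a| <= P/2 + (b a)^2 for the symbol b of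
    1 - dx^2 - dy^2 and the summable majorant P = poisson2 1 of b^-2. *)
Lemma sobolev_sup (u : R * R -> R) : sqitg mu2 u ->
  sqitg mu2 (fun k => bessel k * fr u k) -> sqitg mu2 (fun k => bessel k * fi u k) ->
  {ae mu2, forall p, `|u p| <= sup_const +
     ip mu2 (fun k => bessel k * fr u k) (fun k => bessel k * fr u k) +
     ip mu2 (fun k => bessel k * fi u k) (fun k => bessel k * fi u k)}.
Proof.
move=> su sr si.
have amgm k (a : R) : `|a| <= 2^-1 * poisson2 1 k + (bessel k * a) ^+ 2.
  have := bessel_inv_le k; have b0 := lt_le_trans ltr01 (bessel_ge1 k).
  move: (poisson2 1 k) => P; move: (bessel k) b0 => b b0 bP.
  apply: (@le_trans _ _ (2^-1 * (b ^+ 2)^-1 + (b * a) ^+ 2)); last by rewrite lerD2r ler_wpM2l.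
  rewrite -(ler_pM2l b0) mulrDr.
  have -> : b * (2^-1 * (b ^+ 2)^-1) = 2^-1 * b^-1 by field; rewrite gt_eqF.
  rewrite -(ler_pM2l b0) [leRHS]mulrDr.
  have -> : b * (2^-1 * b^-1) = 2^-1 by field; rewrite gt_eqF.
  have E1 : b * (b * `|a|) = b * `|b * a| by rewrite normrM (gtr0_norm b0).
  rewrite E1 -(real_normK (num_real (b * a))); move: (`|b * a|) => x.
  have -> : b * (b * x ^+ 2) = (b * x) ^+ 2 by ring.
  by move: (b * x) => y; have := sqr_ge0 (y - 2^-1); nra.
have bound k : `|fr u k| + `|fi u k| <= poisson2 1 k + ((bessel k * fr u k) ^+ 2 + (bessel k * fi u k) ^+ 2).
  have := amgm k (fr u k); have := amgm k (fi u k).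
  move: (fr u k) (fi u k) (bessel k) (poisson2 1 k) => a b w P; lra.
have mF : measurable_fun (setT : set T2) (fun k => `|fr u k| + `|fi u k|).
  by apply: measurable_funD; apply: (measurableT_comp (@normr_measurable R setT));
    apply: sqitg_meas; [exact: sqitg_fr|exact: sqitg_fi].
have ib : itg mu2 (fun k => poisson2 1 k + ((bessel k * fr u k) ^+ 2 + (bessel k * fi u k) ^+ 2)).
  by apply: itgD; [exact: itg_poisson2|apply: itgD; [exact: sr.2|exact: si.2]].
have iF : itg mu2 (fun k => `|fr u k| + `|fi u k|).
  by apply: (itg_le mF _ ib) => k; rewrite ger0_norm ?addr_ge0.
apply: (spectrum_bound su iF); last first.
  rewrite -addrA /sup_const; apply: ltr_wpDr; first by rewrite addr_ge0 ?ip_ge0.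
  by rewrite ltr_pwDl// Rint_ge0// => k; rewrite mulr_ge0// poisson_ge0.
apply: le_trans (Rint_le iF ib bound) _.
rewrite (RintegralD measurableT (itg_poisson2 ltr01) (itgD sr.2 si.2)).
rewrite (RintegralD measurableT sr.2 si.2) -!ipE addrA /sup_const.
by rewrite !lerD2r lerDr.
Qed.

End SupBound.

(** * Strips at a fixed time *)

Section StripVanishing.
Context (R : realType).
Local Notation mu := (@lebesgue_measure R).
Local Notation mu2 := (plane_measure R).
Local Notation T1 := (measurableTypeR R).
Local Notation T2 := (measurableTypeR R * measurableTypeR R)%type.
Implicit Types (f g h : R * R -> R) (p k : R * R).

Definition strip (a b : R) : set T2 := [set p | a < p.1 < b].

Lemma measurable_strip a b : measurable (strip a b).
Proof.
have -> : strip a b = `]a, b[%classic `*` setT.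
  by apply/seteqP; split => p /=; rewrite in_itv//= => -[].
by apply: measurableX.
Qed.

Lemma sqitg_strip a b f : sqitg mu2 f -> sqitg mu2 (fun p => \1_(strip a b) p * f p).
Proof.
move=> sf; apply: (@sqitgM_bounded _ T2 R mu2 1) => //; last by move=> p; exact: indic_le1.
exact: measurable_indic (measurable_strip a b).
Qed.

Lemma ip_strip a b f : sqitg mu2 f ->
  ip mu2 f (fun p => \1_(strip a b) p * f p) =
  ip mu2 (fun p => \1_(strip a b) p * f p) (fun p => \1_(strip a b) p * f p).
Proof.
move=> sf; congr (Rintegral _ _ _); apply/funext => p.
by rewrite indicE; case: (p \in _); rewrite ?mul1r ?mul0r ?mulr0.
Qed.

Lemma strip_eq0 a b f : sqitg mu2 f ->
  ip mu2 (fun p => \1_(strip a b) p * f p) (fun p => \1_(strip a b) p * f p) = 0 ->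
  {ae mu2, forall p, a < p.1 < b -> f p = 0}.
Proof.
move=> sf /(ip_eq0 (sqitg_strip a b sf)); apply: aeS => p + pab.
by rewrite indicE mem_set// mul1r.
Qed.

(** Differentiation is local, since difference quotients are; the strip is narrowed
    to leave room for their step. *)
Lemma deriv_local (a b a' b' : R) f f' : a < a' -> b' < b -> wderiv (1, 0) f f' ->
  (forall p, a < p.1 < b -> f p = 0) ->
  {ae mu2, forall p, a' < p.1 < b' -> f' p = 0}.
Proof.
move=> aa bb df f0; have [sf sf' _ _] := df.
have sh := sqitg_strip a' b' sf'.
apply: strip_eq0 => //; apply/eqP; rewrite eq_le ip_ge0 andbT -ip_strip//.
apply: (cvgr_to_le (deriv_cdiff_cvg df sh)).
have d1 : 0 < a' - a by rewrite subr_gt0.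
have d2 : 0 < b - b' by rewrite subr_gt0.
near=> n.
have n1 : n.+1%:R^-1 <= a' - a by near: n; exact: harmonic_le.
have n2 : n.+1%:R^-1 <= b - b' by near: n; exact: harmonic_le.
have n0 : 0 < n.+1%:R^-1 :> R by rewrite invr_gt0.
move: (n.+1%:R^-1) n0 n1 n2 => t t0 t1 t2.
rewrite le_eqVlt; apply/orP; left; apply/eqP.
transitivity (\int[mu2]_p (0 : R)); last by rewrite /Rintegral integral0_eq.
congr (Rintegral _ _ _); apply/funext => p; rewrite indicE.
case: (boolP (p \in _)) => [|_]; last by rewrite mul0r mulr0.
rewrite inE /strip/= => /andP[p1 p2].
rewrite /cdiff /shift2 /scale2/= !mulr1 !f0/= ?subr0 ?mulr0 ?mul0r//; apply/andP; split; lra.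
Unshelve. all: by end_near. Qed.

(** On a strip where u and its time derivative vanish the equation says that the
    nonlocal term vanishes too.  The flux N, which vanishes on that strip as well,
    is then zero everywhere, and it controls both u and ux. *)
Lemma strip_forces_zero (gamma : R) (g : R -> R) (a b : R)
    (u ux v vy dN ut : R * R -> R) :
  0 < gamma -> g 0 = 0 -> (forall r, gamma * r ^+ 2 <= g r) ->
  (forall r, r != 0 -> gamma * r ^+ 2 < g r) -> a < b ->
  wderiv (1, 0) u ux -> wderiv (0, 1) v vy ->
  wderiv (1, 0) (fun p => 2^-1 * g (u p) + gamma / 2 * ux p ^+ 2 - gamma / 2 * u p ^+ 2) dN ->
  {ae mu2, forall p, ut p + gamma * u p * ux p + convG dN p + convG vy p = 0} ->
  (forall p, a < p.1 < b -> u p = 0) ->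
  {ae mu2, forall p, a < p.1 < b -> ut p = 0} ->
  {ae mu2, forall p, u p = 0 /\ ux p = 0}.
Proof.
move=> gam0 g00 g_ge g_gt ab du dv dNP eq u0 ut0.
(* ux is only known to vanish on a narrower strip, and N with it. *)
pose a' := (2 * a + b) / 3; pose b' := (a + 2 * b) / 3.
have aa : a < a' by rewrite /a'; lra.
have bb : b' < b by rewrite /b'; lra.
have ab' : a' < b' by rewrite /a' /b'; lra.
have inside x : a' < x < b' -> a < x < b by move=> /andP[? ?]; apply/andP; split; lra.
have ux0 := deriv_local aa bb du u0.
have NE (r w : R) : 2^-1 * g r + gamma / 2 * w ^+ 2 - gamma / 2 * r ^+ 2 =
    2^-1 * (g r - gamma * r ^+ 2) + gamma / 2 * w ^+ 2 by field.
have gam2 : 0 < gamma / 2 by rewrite divr_gt0.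
have Npos (r w : R) : 0 <= 2^-1 * g r + gamma / 2 * w ^+ 2 - gamma / 2 * r ^+ 2.
  by rewrite NE addr_ge0// mulr_ge0 ?sqr_ge0 ?invr_ge0 ?subr_ge0// ltW.
have N0 := nonlocal_vanish ab' dNP dv (fun p => Npos (u p) (ux p)).
have {N0} : {ae mu2, forall p, 2^-1 * g (u p) + gamma / 2 * ux p ^+ 2 - gamma / 2 * u p ^+ 2 = 0}.
  apply: N0.
    apply: aeS ux0 => p uxp pab; rewrite (u0 _ (inside _ pab)) (uxp pab) g00.
    by rewrite expr0n/= !mulr0 addr0 subr0.
  apply: aeS2 eq ut0 => p ep utp pab; move: ep.
  by rewrite (utp (inside _ pab)) (u0 _ (inside _ pab)) mulr0 mul0r !add0r.
apply: aeS => p; rewrite NE => /eqP.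
rewrite paddr_eq0; last 2 first.
- by rewrite mulr_ge0 ?invr_ge0 ?subr_ge0.
- by rewrite mulr_ge0 ?sqr_ge0// ltW.
rewrite (mulf_eq0 2^-1) invr_eq0 pnatr_eq0/= (mulf_eq0 (gamma / 2)) (gt_eqF gam2) sqrf_eq0/=.
move=> /andP[gu /eqP ->]; split=> //; apply/eqP/negPn/negP => un0.
by move: gu; rewrite subr_eq0 gt_eqF// g_gt.
Qed.

End StripVanishing.

(** * The energy rate *)

Section EnergyRate.
Context (R : realType).
Local Notation mu := (@lebesgue_measure R).
Local Notation mu2 := (plane_measure R).
Local Notation T2 := (measurableTypeR R * measurableTypeR R)%type.
Implicit Types (f g h : R * R -> R) (p k : R * R).
Local Notation "f =ae g" := {ae mu2, forall p, f p = g p} (at level 70).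

Lemma normr_Rint_le_ae (f g : T2 -> R) : measurable_fun setT f -> itg mu2 g ->
  {ae mu2, forall p, `|f p| <= g p} -> `|\int[mu2]_p f p| <= \int[mu2]_p g p.
Proof.
move=> mf ig fg; have [fi h] := itg_le_ae mf ig fg.
exact: le_trans (le_normr_Rintegral measurableT fi) h.
Qed.

(** The energy of f when g is its x-derivative. *)
Definition sq_sum f g : R := ip mu2 f f + ip mu2 g g.

Lemma sq_sum_bound (f a b : T2 -> R) (c : R) : measurable_fun setT f ->
  sqitg mu2 a -> sqitg mu2 b ->
  {ae mu2, forall p, `|f p| <= c * (a p ^+ 2 + b p ^+ 2)} ->
  `|\int[mu2]_p f p| <= c * sq_sum a b.
Proof.
move=> mf sa sb fab; have i := itgD sa.2 sb.2.
have := normr_Rint_le_ae mf (itgZ c i) fab.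
by rewrite (RintegralZl _ measurableT i) (RintegralD measurableT sa.2 sb.2) -!ipE.
Qed.

Lemma sqitg_le_ae (f g : T2 -> R) (M : R) : measurable_fun setT f -> sqitg mu2 g ->
  {ae mu2, forall p, `|f p| <= M * `|g p|} -> sqitg mu2 f.
Proof.
move=> mf sg fg; split=> //.
apply: (@itg_le_ae _ T2 R mu2 _ (fun p => M ^+ 2 * g p ^+ 2) _ (itgZ _ sg.2) _).1.
  exact: measurable_funX.
apply: aeS fg => p h; rewrite ger0_norm ?sqr_ge0// -exprMn -(real_normK (num_real (f p))).
rewrite -(real_normK (num_real (M * g p))) lerXn2r ?nnegrE// normrM.
by apply: le_trans h _; rewrite ler_wpM2r// ler_norm.
Qed.

Lemma trilinear_le (a b c M : R) : 0 <= a -> a <= M ->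
  2^-1 * (a * (b * c)) <= 4^-1 * M * (b ^+ 2 + c ^+ 2).
Proof.
move=> a0 aM; have : 0 <= a * (b - c) ^+ 2 by rewrite mulr_ge0 ?sqr_ge0.
have : 0 <= (M - a) * (b ^+ 2 + c ^+ 2) by rewrite mulr_ge0 ?subr_ge0 ?addr_ge0 ?sqr_ge0.
by rewrite !expr2 => h1 h2; lra.
Qed.

Lemma half_mul_le (M x d : R) : M * d <= M * x -> 4^-1 * M * (x + d) <= 2^-1 * M * x.
Proof. by move=> h; rewrite -!mulrA mulrDr; move: (M * x) (M * d) h => a b; lra. Qed.

(** The second derivative of u in the difference quotient of ux is harmless when
    paired with u ux: after a shift of one of its two terms, what remains is a
    product of two values of ux with a difference quotient of u itself. *)
Lemma transport_cdiff (t M : R) u ux : 0 < t -> 0 <= M -> wderiv (1, 0) u ux ->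
  {ae mu2, forall p, `|ux p| <= M} -> sqitg mu2 (fun p => u p * ux p) ->
  `|ip mu2 (cdiff t (1, 0) ux) (fun p => u p * ux p)| <= 2^-1 * M * ip mu2 ux ux.
Proof.
move=> t0 M0 du uxM sw; have [su sux _ _] := du.
pose s := scale2 t ((1, 0) : R * R).
have th0 : t / 2 != 0 by rewrite gt_eqF// divr_gt0.
pose D p := t^-1 * (u (shift2 s p) - u p).
have DE : D = fun p => cdiff (t / 2) (1, 0) u (shift2 (scale2 (t / 2) (1, 0)) p).
  apply/funext => -[x y]; rewrite /D /cdiff /shift2 /s /scale2 /= !mulr1 !mulr0 !addr0.
  have -> : x + t / 2 + t / 2 = x + t by field.
  have -> : x + t / 2 + - (t / 2) = x by ring.
  by rewrite [2 * _]mulrC divfK.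
have sc := sqitg_cdiff (t / 2) (1, 0) su.
have sD : sqitg mu2 D by rewrite DE; exact: sqitg_translate.
have DD : ip mu2 D D <= ip mu2 ux ux.
  by rewrite DE ip_translate//; exact: cdiff_le.
have ss := sqitg_translate s sux.
have E : ip mu2 (cdiff t (1, 0) ux) (fun p => u p * ux p) =
    \int[mu2]_p (- (2^-1 * (ux p * (ux (shift2 s p) * D p)))).
  rewrite /cdiff -/s ipZl//; last by apply: sqitgB => //; exact: sqitg_translate.
  rewrite ipBl//; last exact: sqitg_translate.
  rewrite (ip_shiftC (scale2 (- t) (1, 0)) sux sw) scale2A mulN1r opprK -/s.
  have i1 := sqitg_mul ss sw; have i2 := sqitg_mul sux (sqitg_translate s sw).
  rewrite /ip -(RintegralB measurableT i1 i2) -(RintegralZl _ measurableT (itgB i1 i2)).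
  congr (Rintegral _ _ _); apply/funext => p; rewrite /D.
  move: (ux p) (ux (shift2 s p)) (u p) (u (shift2 s p)) => a b c d.
  by field; rewrite gt_eqF.
rewrite E; have := @sq_sum_bound (fun p => - (2^-1 * (ux p * (ux (shift2 s p) * D p))))
  (fun p => ux (shift2 s p)) D (4^-1 * M) _ ss sD.
rewrite /sq_sum ip_translate// => H; apply: le_trans (H _ _) _.
- apply: (measurableT_comp (@oppr_measurable R setT)); apply: measurable_funM => //; apply: measurable_funM.
    exact: sqitg_meas sux.
  by apply: measurable_funM; [exact: sqitg_meas ss|exact: sqitg_meas sD].
- apply: aeS uxM => p; rewrite normrN (normrM 2^-1) (normrM (ux p)) (normrM (ux _)) (@ger0_norm _ 2^-1)// -(real_normK (num_real (D p))).
  rewrite -(real_normK (num_real (ux (shift2 s p)))).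
  by move=> aM; apply: trilinear_le.
- by apply: half_mul_le; exact: ler_wpM2l.
Qed.

Lemma fourier0 : fr (fun=> 0) =ae (fun=> 0 : R) /\ fi (fun=> 0) =ae (fun=> 0 : R).
Proof.
have [r i] := fourierZD (-1) (sqitg0 mu2) (sqitg0 mu2).
have E0 : (fun p : R * R => -1 * 0 + 0) = (fun=> 0 : R) by apply/funext => p; rewrite mulr0 addr0.
rewrite E0 in r i.
by split; [apply: aeS r|apply: aeS i] => k; rewrite mulN1r addNr.
Qed.

Definition dx_symbol (F : R * R -> R) k : R := k.1 * F k.

(** The polarized energy, times (2 pi)^2 and read on the Fourier side, where it has
    the symbol 1 + xi^2. *)
Definition energy_ip f h : R :=
  ip mu2 (fr f) (fr h) + ip mu2 (fi f) (fi h) +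
  (ip mu2 (dx_symbol (fr f)) (dx_symbol (fr h)) +
   ip mu2 (dx_symbol (fi f)) (dx_symbol (fi h))).

Lemma wderiv_sqitg_symbol u ux : wderiv (1, 0) u ux ->
  sqitg mu2 (dx_symbol (fr u)) /\ sqitg mu2 (dx_symbol (fi u)).
Proof.
move=> [su sux Er Ei].
have m1 : measurable_fun (setT : set T2) (fun k : T2 => k.1) by exact: measurable_fst.
split.
  apply: (sqitg_ae_eq _ _ (sqitg_fi sux)).
    by apply: measurable_funM => //; exact: sqitg_meas (sqitg_fr su).
  by apply: aeS Ei => k ->; rewrite dot10.
apply: (sqitg_ae_eq _ _ (sqitgN (sqitg_fr sux))).
  by apply: measurable_funM => //; exact: sqitg_meas (sqitg_fi su).
by apply: aeS Er => k ->; rewrite dot10 opprK.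
Qed.

Lemma energy_ipE u ux : wderiv (1, 0) u ux ->
  energy_ip u u = (2 * pi) ^+ 2 * sq_sum u ux.
Proof.
move=> du; have [s1 s2] := wderiv_sqitg_symbol du; have [su sux Er Ei] := du.
have srx := sqitg_fr sux; have six := sqitg_fi sux.
rewrite /energy_ip (plancherel su) /sq_sum [RHS]mulrDr -(plancherel sux) [X in _ + X]addrC.
congr (_ + (_ + _)).
  rewrite -[RHS]opprK -(ipNl srx srx) -(ipNr srx (sqitgN srx)).
  have srxN := sqitgN srx.
  apply: (ip_ae s2 s2 srxN srxN);
  by apply: aeS Er => k ->; rewrite dot10 opprK.
by apply: (ip_ae s1 s1 six six); apply: aeS Ei => k ->; rewrite dot10.
Qed.

Lemma parseval_itg f h : sqitg mu2 f -> sqitg mu2 h ->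
  itg mu2 (fun k => fr f k * fr h k + fi f k * fi h k) /\
  \int[mu2]_k (fr f k * fr h k + fi f k * fi h k) = (2 * pi) ^+ 2 * ip mu2 f h.
Proof.
move=> sf sh; have i1 := sqitg_mul (sqitg_fr sf) (sqitg_fr sh).
have i2 := sqitg_mul (sqitg_fi sf) (sqitg_fi sh).
by split; [exact: itgD|rewrite (RintegralD measurableT i1 i2) -parseval].
Qed.

(** The symbol 1 + xi^2 of the pairing cancels the one of G, so that dN and vy are
    paired with u itself; the factor xi^2 of the transport term w is shared between
    ux and w. *)
Lemma energy_ip_equation (gamma : R) u ux w dN vy ut :
  wderiv (1, 0) u ux -> sqitg mu2 w -> sqitg mu2 dN -> sqitg mu2 vy -> sqitg mu2 ut ->
  sqitg mu2 (dx_symbol (fr ut)) -> sqitg mu2 (dx_symbol (fi ut)) ->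
  itg mu2 (fun k => dot (1, 0) k * cross ux w k) ->
  {ae mu2, forall p, ut p + gamma * w p + convG dN p + convG vy p = 0} ->
  energy_ip u ut = gamma * \int[mu2]_k (dot (1, 0) k * cross ux w k) -
    (2 * pi) ^+ 2 * (gamma * ip mu2 u w + ip mu2 u dN + ip mu2 u vy).
Proof.
move=> du sw sdN svy sut sut1 sut2 icr eq.
have [s1 s2] := wderiv_sqitg_symbol du; have [su sux Er Ei] := du.
have [scN _] := convG_sqitg sdN; have [scV _] := convG_sqitg svy.
have [cr1 ci1] := fourier_convG sdN; have [cr2 ci2] := fourier_convG svy.
have sS := sqitgD (sqitgZ 1 scN) scV; have sA := sqitgD (sqitgZ gamma sw) sut.
have sB := sqitgD (sqitgZ 1 sA) sS.
have [rS iS] := fourierZD 1 scN scV; have [rA iA] := fourierZD gamma sw sut.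
have [rB iB] := fourierZD 1 sA sS.
have [rz iz] : fr (fun p => 1 * (gamma * w p + ut p) + (1 * convG dN p + convG vy p)) =ae (fun=> 0) /\
    fi (fun p => 1 * (gamma * w p + ut p) + (1 * convG dN p + convG vy p)) =ae (fun=> 0).
  have [r0 i0] := fourier0.
  have [|r i] := fourier_ae sB (sqitg0 mu2).
    apply: aeS eq => p; move: (ut p) (w p) (convG dN p) (convG vy p) => a b c d h.
    by rewrite !mul1r -[RHS]h; ring.
  by split; [apply: aeS2 r r0|apply: aeS2 i i0] => k -> ->.
(* The equation on the Fourier side, for the real and the imaginary part. *)
have re : {ae mu2, forall k, gamma * fr w k + fr ut k + ((1 + k.1 ^+ 2)^-1 * fr dN k + (1 + k.1 ^+ 2)^-1 * fr vy k) = 0}.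
  apply: aeS2 (aeS2 (fun _ a b => conj a b) cr1 cr2) (aeS2 (fun _ a b => conj a b)
    (aeS2 (fun _ a b => conj a b) rz rB) (aeS2 (fun _ a b => conj a b) rS rA)).
  by move=> k [<- <-] [[E1 E2] [E3 E4]]; rewrite -E1 E2 E3 E4 !mul1r.
have im : {ae mu2, forall k, gamma * fi w k + fi ut k + ((1 + k.1 ^+ 2)^-1 * fi dN k + (1 + k.1 ^+ 2)^-1 * fi vy k) = 0}.
  apply: aeS2 (aeS2 (fun _ a b => conj a b) ci1 ci2) (aeS2 (fun _ a b => conj a b)
    (aeS2 (fun _ a b => conj a b) iz iB) (aeS2 (fun _ a b => conj a b) iS iA)).
  by move=> k [<- <-] [[E1 E2] [E3 E4]]; rewrite -E1 E2 E3 E4 !mul1r.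
have [j1 J1] := parseval_itg su sw; have [j2 J2] := parseval_itg su sdN.
have [j3 J3] := parseval_itg su svy; have [j0 J0] := parseval_itg su sut.
have k1 := sqitg_mul s1 sut1; have k2 := sqitg_mul s2 sut2.
have jL := itgD j0 (itgD k1 k2).
have jR := itgB (itgZ gamma icr) (itgD (itgD (itgZ gamma j1) j2) j3).
have -> : energy_ip u ut = \int[mu2]_k (fr u k * fr ut k + fi u k * fi ut k +
   (dx_symbol (fr u) k * dx_symbol (fr ut) k + dx_symbol (fi u) k * dx_symbol (fi ut) k)).
  by rewrite (RintegralD measurableT j0 (itgD k1 k2)) (RintegralD measurableT k1 k2) J0 -parseval.
transitivity (\int[mu2]_k (gamma * (dot (1, 0) k * cross ux w k) -
    (gamma * (fr u k * fr w k + fi u k * fi w k) + (fr u k * fr dN k + fi u k * fi dN k) +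
     (fr u k * fr vy k + fi u k * fi vy k)))).
  apply: Rint_ae_eq; [exact: itg_meas jL|exact: itg_meas jR|].
  apply: aeS2 (aeS2 (fun _ a b => conj a b) re im) (aeS2 (fun _ a b => conj a b) Er Ei) => k [e1 e2] [e3 e4].
  rewrite /cross e3 e4 dot10 /dx_symbol.
  have b0 : 1 + k.1 ^+ 2 != 0 by rewrite gt_eqF// ltr_pwDl ?sqr_ge0.
  move: (fr u k) (fi u k) (fr w k) (fi w k) (fr dN k) (fi dN k) (fr vy k) (fi vy k) e1 e2
    => a a' b b' c c' d d'.
  move: (fr ut k) (fi ut k) k.1 b0 => x x' xi b0 h h'.
  have -> : x = - (gamma * b + ((1 + xi ^+ 2)^-1 * c + (1 + xi ^+ 2)^-1 * d)).
    by apply/eqP; rewrite -addr_eq0 -[X in _ == X]h; apply/eqP; ring.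
  have -> : x' = - (gamma * b' + ((1 + xi ^+ 2)^-1 * c' + (1 + xi ^+ 2)^-1 * d')).
    by apply/eqP; rewrite -addr_eq0 -[X in _ == X]h'; apply/eqP; ring.
  by field.
rewrite (RintegralB measurableT (itgZ gamma icr) (itgD (itgD (itgZ gamma j1) j2) j3)).
rewrite (RintegralD measurableT (itgD (itgZ gamma j1) j2) j3) (RintegralD measurableT (itgZ gamma j1) j2).
rewrite (RintegralZl _ measurableT icr) (RintegralZl _ measurableT j1) J1 J2 J3.
by rewrite [gamma * (_ * ip _ _ _)]mulrCA -!mulrDr.
Qed.

Lemma le_of_cvg_normr (a : nat -> R) (l c : R) : (forall n, `|a n| <= c) ->
  a n @[n --> \oo] --> l -> `|l| <= c.
Proof. by move=> ac al; apply: (cvgr_to_le (cvg_norm al)); exact: nearW. Qed.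

Lemma transport_term (M : R) u ux : 0 <= M -> wderiv (1, 0) u ux ->
  {ae mu2, forall p, `|ux p| <= M} -> sqitg mu2 (fun p => u p * ux p) ->
  sqitg mu2 (dx_symbol (fr ux)) -> sqitg mu2 (dx_symbol (fi ux)) ->
  let w p := u p * ux p in
  itg mu2 (fun k => dot (1, 0) k * cross ux w k) /\
  `|\int[mu2]_k (dot (1, 0) k * cross ux w k)| <= (2 * pi) ^+ 2 * (2^-1 * M * ip mu2 ux ux).
Proof.
move=> M0 du uxM sw s1 s2 w; have [su sux _ _] := du.
have i1 := sqitg_mul s1 (sqitg_fi sw); have i2 := sqitg_mul s2 (sqitg_fr sw).
have i : itg mu2 (fun k => dot (1, 0) k * cross ux w k).
  have := itgB i1 i2; congr (itg mu2 _); apply/funext => k.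
  by rewrite /cross /dx_symbol dot10 mulrBr !mulrA.
split=> //; apply: le_of_cvg_normr (ip_cdiff_cvg sux sw i) => n.
have pi0 : 0 <= (2 * pi : R) ^+ 2 by rewrite sqr_ge0.
rewrite normrM (ger0_norm pi0) ler_wpM2l//.
by apply: transport_cdiff => //; rewrite invr_gt0.
Qed.

Lemma flux_bound (gamma C M r w : R) : 0 <= gamma -> 0 <= C -> `|r| <= M -> `|w| <= M ->
  forall y, `|y| <= C * `|r| ->
  `|w * (2^-1 * y + gamma / 2 * w ^+ 2 - gamma / 2 * r ^+ 2)| <=
  (C + gamma * M) * (r ^+ 2 + w ^+ 2).
Proof.
move=> gam0 C0 rM wM y yC.
have M0 : 0 <= M by apply: le_trans rM.
have q (x : R) : 0 <= gamma / 2 * x ^+ 2 by rewrite mulr_ge0 ?divr_ge0 ?sqr_ge0.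
rewrite normrM -(real_normK (num_real r)) -(real_normK (num_real w)).
apply: (@le_trans _ _ (`|w| * (2^-1 * (C * `|r|) + gamma / 2 * `|w| ^+ 2 + gamma / 2 * `|r| ^+ 2))).
  rewrite ler_wpM2l//; apply: le_trans (ler_normB _ _) _; apply: lerD.
    apply: le_trans (ler_normD _ _) _; apply: lerD; first by rewrite normrM ger0_norm// ler_wpM2l.
    by rewrite (ger0_norm (q _)).
  by rewrite (ger0_norm (q _)).
move: `|r| `|w| (normr_ge0 r) (normr_ge0 w) rM wM => a b a0 b0 aM bM.
have ab : a * b <= 2^-1 * (a ^+ 2 + b ^+ 2) by have := sqr_ge0 (a - b); rewrite sqrrB; lra.
have h1 : C * (a * b) <= C * (2^-1 * (a ^+ 2 + b ^+ 2)) by exact: ler_wpM2l.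
have h2 : gamma * (b * b ^+ 2) <= gamma * (M * b ^+ 2) by rewrite !ler_wpM2l ?sqr_ge0// ler_wpM2r ?sqr_ge0.
have h3 : gamma * (b * a ^+ 2) <= gamma * (M * a ^+ 2) by rewrite !ler_wpM2l ?sqr_ge0// ler_wpM2r ?sqr_ge0.
have h4 : 0 <= C * (a ^+ 2 + b ^+ 2) by rewrite mulr_ge0// addr_ge0 ?sqr_ge0.
have h5 : 0 <= gamma * (M * a ^+ 2) by rewrite !mulr_ge0 ?sqr_ge0.
have h6 : 0 <= gamma * (M * b ^+ 2) by rewrite !mulr_ge0 ?sqr_ge0.
rewrite mulrDl [leLHS](_ : _ = 2^-1 * (C * (a * b)) + 2^-1 * (gamma * (b * b ^+ 2)) + 2^-1 * (gamma * (b * a ^+ 2))); last by field.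
rewrite [X in _ <= _ + X](_ : _ = gamma * (M * a ^+ 2) + gamma * (M * b ^+ 2)); last by ring.
by lra.
Qed.

Lemma energy_arith (gamma C M P a b x E1 E : R) : 0 <= gamma -> 0 <= M -> 0 <= P ->
  `|x| <= P * (2^-1 * M * E1) -> `|a| <= 2^-1 * M * E ->
  `|b| <= (C + gamma * M) * E -> E1 <= E ->
  `|gamma * x - P * (gamma * a + b)| <= (2 * gamma * M + C) * (P * E).
Proof.
move=> gam0 M0 P0 xE aE bE EE.
apply: (@le_trans _ _ (gamma * `|x| + P * (gamma * `|a| + `|b|))).
  apply: le_trans (ler_normB _ _) _; rewrite !normrM (ger0_norm gam0) (ger0_norm P0).
  by rewrite lerD2l ler_wpM2l//; apply: le_trans (ler_normD _ _) _; rewrite normrM (ger0_norm gam0).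
apply: (@le_trans _ _ (gamma * (P * (2^-1 * M * E)) + P * (gamma * (2^-1 * M * E) + (C + gamma * M) * E))); last first.
  by rewrite le_eqVlt; apply/orP; left; apply/eqP; field.
apply: lerD; apply: ler_wpM2l => //; last by apply: lerD => //; exact: ler_wpM2l.
apply: le_trans xE _; apply: ler_wpM2l => //; apply: ler_wpM2l => //.
by rewrite mulr_ge0.
Qed.

(** The term in vy disappears because uy = vx is an x-derivative of v, and dN is
    paired with u by parts.  What remains is at most quadratic in u and ux, with
    coefficients bounded by M and C. *)
Lemma energy_rate (gamma C M : R) (g : R -> R) u ux uy v vx vy dN ut :
  0 < gamma -> 0 <= C -> 0 <= M -> (forall r, `|r| <= M -> `|g r| <= C * `|r|) ->
  wderiv (1, 0) u ux -> wderiv (0, 1) u uy ->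
  wderiv (1, 0) v vx -> wderiv (0, 1) v vy -> uy =ae vx ->
  wderiv (1, 0) (fun p => 2^-1 * g (u p) + gamma / 2 * ux p ^+ 2 - gamma / 2 * u p ^+ 2) dN ->
  {ae mu2, forall p, ut p + gamma * u p * ux p + convG dN p + convG vy p = 0} ->
  {ae mu2, forall p, `|u p| <= M} -> {ae mu2, forall p, `|ux p| <= M} ->
  sqitg mu2 (dx_symbol (fr ux)) -> sqitg mu2 (dx_symbol (fi ux)) ->
  sqitg mu2 ut -> sqitg mu2 (dx_symbol (fr ut)) -> sqitg mu2 (dx_symbol (fi ut)) ->
  `|energy_ip u ut| <= (2 * gamma * M + C) * energy_ip u u.
Proof.
move=> gam0 C0 M0 gC du duy dvx dvy uyvx dNP eq uM uxM sx1 sx2 sut st1 st2.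
have [su sux _ _] := du; have [_ suy _ _] := duy; have [sv svx _ _] := dvx.
have [_ svy _ _] := dvy; have [sN sdN _ _] := dNP.
pose w p := u p * ux p.
have sw : sqitg mu2 w.
  apply: (@sqitg_le_ae _ ux M) => //.
    by apply: measurable_funM; [exact: sqitg_meas su|exact: sqitg_meas sux].
  by apply: aeS uM => p h; rewrite normrM ler_wpM2r.
have [icr X] := transport_term M0 du uxM sw sx1 sx2.
have {}eq : {ae mu2, forall p, ut p + gamma * w p + convG dN p + convG vy p = 0}.
  by apply: aeS eq => p; rewrite /w mulrA.
rewrite (energy_ip_equation du sw sdN svy sut st1 st2 icr eq) (energy_ipE du).
(* (u, vy) = -(uy, v) = -(vx, v), and dx is skew-symmetric. *)
have z : ip mu2 u vy = 0.
  have e1 : ip mu2 u vy = - ip mu2 uy v by rewrite (deriv_skew duy dvy) opprK.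
  have e2 : ip mu2 uy v = ip mu2 vx v by apply: (ip_ae suy sv svx sv uyvx); exact: aeT.
  have e3 := deriv_skew dvx dvx; rewrite (ipC mu2 v vx) in e3.
  rewrite e1 e2; move: (ip mu2 vx v) e3 => a e3; lra.
have b1 : `|ip mu2 u w| <= 2^-1 * M * sq_sum u ux.
  apply: sq_sum_bound => //; first exact: itg_meas (sqitg_mul su sw).
  apply: aeS uM => p h; rewrite /w !normrM -(real_normK (num_real (u p))) -(real_normK (num_real (ux p))).
  move: `|u p| `|ux p| (normr_ge0 (u p)) (normr_ge0 (ux p)) h => a b a0 b0 aM.
  have : 0 <= (M - a) * (a * b) by rewrite mulr_ge0 ?subr_ge0// mulr_ge0.
  have : 0 <= M * (a - b) ^+ 2 by rewrite mulr_ge0 ?sqr_ge0.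
  rewrite !expr2; nra.
have b2 : `|ip mu2 u dN| <= (C + gamma * M) * sq_sum u ux.
  rewrite -[ip mu2 u dN]opprK -(deriv_skew du dNP) normrN.
  apply: sq_sum_bound => //; first exact: itg_meas (sqitg_mul sux sN).
  by apply: aeS2 uM uxM => p h1 h2; apply: flux_bound => //; [exact: ltW|exact: gC].
have b3 : ip mu2 ux ux <= sq_sum u ux by rewrite /sq_sum lerDr ip_ge0.
rewrite z addr0; apply: energy_arith X b1 b2 b3 => //; [exact: ltW|exact: sqr_ge0].
Qed.

End EnergyRate.

(** * The spaces X^s in terms of the spectrum *)

Section SpectralNorms.
Context (R : realType).
Local Notation mu := (@lebesgue_measure R).
Local Notation mu2 := (plane_measure R).
Local Notation T2 := (measurableTypeR R * measurableTypeR R)%type.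
Implicit Types (f g h : R * R -> R) (p k : R * R).
Local Notation "f =ae g" := {ae mu2, forall p, f p = g p} (at level 70).

(** The square root of the weight that u and its x-derivative receive together in
    the norm of X^s. *)
Definition rho_x (s : R) k : R := Num.sqrt (bessel k `^ s * (1 + k.1 ^+ 2)).

Lemma rho_x_sq s k : rho_x s k ^+ 2 = bessel k `^ s * (1 + k.1 ^+ 2).
Proof. by rewrite sqr_sqrtr// mulr_ge0 ?powR_ge0// addr_ge0 ?sqr_ge0. Qed.

Lemma rho_x_ge0 s k : 0 <= rho_x s k.
Proof. exact: sqrtr_ge0. Qed.

Lemma measurable_bessel_pow s : measurable_fun (setT : set T2) (fun k => bessel k `^ s).
Proof. exact: (measurableT_comp (@measurable_powR R s) (@measurable_bessel R)). Qed.

Lemma measurable_fst_sq : measurable_fun (setT : set T2) (fun k : T2 => k.1 ^+ 2 : R).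
Proof. by apply: measurable_funX; exact: measurable_fst. Qed.

Lemma measurable_rho_x s : measurable_fun (setT : set T2) (rho_x s).
Proof.
apply: (measurableT_comp (continuous_measurable_fun (@sqrt_continuous R))).
apply: measurable_funM; first exact: measurable_bessel_pow.
by apply: measurable_funD => //; exact: measurable_fst_sq.
Qed.

Definition hdens (s : R) f k : R := bessel k `^ s * (fr f k ^+ 2 + fi f k ^+ 2).

Lemma hdens_ge0 s f k : 0 <= hdens s f k.
Proof. by rewrite mulr_ge0 ?powR_ge0// addr_ge0 ?sqr_ge0. Qed.

Lemma measurable_hdens s f : sqitg mu2 f -> measurable_fun (setT : set T2) (hdens s f).
Proof.
move=> sf; apply: measurable_funM; first exact: measurable_bessel_pow.
by apply: measurable_funD; apply: measurable_funX;
  [exact: sqitg_meas (sqitg_fr sf)|exact: sqitg_meas (sqitg_fi sf)].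
Qed.

Lemma HnormE s f : Hnorm s f = ((\int[mu2]_k (hdens s f k)%:E) `^ 2^-1)%E.
Proof.
rewrite /Hnorm; congr (poweR _ _); apply: eq_integral => k _.
by rewrite normc_sq fourierE.
Qed.

Lemma int_hdens_ge0 s f : (0 <= \int[mu2]_k (hdens s f k)%:E)%E.
Proof. by apply: integral_ge0 => k _; rewrite lee_fin hdens_ge0. Qed.

Lemma Hnorm_sq s f : (Hnorm s f `^ 2)%E = (\int[mu2]_k (hdens s f k)%:E)%E.
Proof. by rewrite HnormE -poweRrM mulVf// poweRe1// int_hdens_ge0. Qed.

Lemma in_H_itg s f : in_H s f -> sqitg mu2 f /\ itg mu2 (hdens s f).
Proof.
move=> [/sqitg_Lfun sf]; rewrite HnormE => /lty_poweRy h; split=> //.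
apply: itg_ge0P; [exact: measurable_hdens|exact: hdens_ge0|].
by apply: h; rewrite invr_eq0.
Qed.

Lemma hdens_dx s f h : is_dx f h -> hdens s h =ae (fun k => k.1 ^+ 2 * hdens s f k).
Proof.
move=> /is_dxP[_ _ Er Ei]; apply: aeS2 Er Ei => k Er Ei.
by rewrite /hdens Er Ei dot10; ring.
Qed.

(** Membership of f and its x-derivative in H^s.  In terms of rho_x it is
    visibly a vector space, and convergence in it is mean-square convergence. *)
Definition XF (s : R) f : Prop :=
  [/\ sqitg mu2 f, exists h, is_dx f h,
      sqitg mu2 (fun k => rho_x s k * fr f k) & sqitg mu2 (fun k => rho_x s k * fi f k)].

Definition Xsq (s : R) f : R :=
  ip mu2 (fun k => rho_x s k * fr f k) (fun k => rho_x s k * fr f k) +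
  ip mu2 (fun k => rho_x s k * fi f k) (fun k => rho_x s k * fi f k).

Lemma Xsq_ge0 s f : 0 <= Xsq s f.
Proof. by rewrite addr_ge0 ?ip_ge0. Qed.

Lemma rho_x_hdens s f k :
  (rho_x s k * fr f k) ^+ 2 + (rho_x s k * fi f k) ^+ 2 = hdens s f k + k.1 ^+ 2 * hdens s f k.
Proof. by rewrite !exprMn rho_x_sq /hdens; ring. Qed.

Lemma in_X_XF s f : in_X s f -> XF s f.
Proof.
move=> [/in_H_itg[sf i] _ [h dh /in_H_itg[sh ih]]].
have m := measurable_hdens s sf.
have i2 : itg mu2 (fun k => k.1 ^+ 2 * hdens s f k).
  apply: itg_ae_eq (hdens_dx s dh) ih.
  by apply: measurable_funM => //; exact: measurable_fst_sq.
have i3 := itgD i i2.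
have c (F : R * R -> R) : sqitg mu2 F -> (forall k, (rho_x s k * F k) ^+ 2 <=
    (rho_x s k * fr f k) ^+ 2 + (rho_x s k * fi f k) ^+ 2) -> sqitg mu2 (fun k => rho_x s k * F k).
  move=> sF Fb; have mF : measurable_fun (setT : set T2) (fun k => rho_x s k * F k).
    by apply: measurable_funM; [exact: measurable_rho_x|exact: sqitg_meas sF].
  split=> //; apply: (itg_le _ _ i3); first exact: measurable_funX.
  by move=> k; rewrite ger0_norm ?sqr_ge0// -rho_x_hdens.
split=> //; [by exists h|apply: c; first exact: sqitg_fr|apply: c; first exact: sqitg_fi].
  by move=> k; rewrite lerDl sqr_ge0.
by move=> k; rewrite lerDr sqr_ge0.
Qed.

Lemma XF_ZD s a f h : XF s f -> XF s h -> XF s (fun p => a * f p + h p).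
Proof.
move=> [sf [f' df] rf jf] [sh [h' dh] rh jh].
have [er ei] := fourierZD a sf sh.
split.
- by apply: sqitgD => //; exact: sqitgZ.
- by exists (fun p => a * f' p + h' p); apply/is_dxP; apply: derivZD; exact/is_dxP.
- apply: sqitg_ae_eq (sqitgD (sqitgZ a rf) rh).
    apply: measurable_funM; first exact: measurable_rho_x.
    by apply: sqitg_meas; apply: sqitg_fr; apply: sqitgD => //; exact: sqitgZ.
  by apply: aeS er => k ->; ring.
- apply: sqitg_ae_eq (sqitgD (sqitgZ a jf) jh).
    apply: measurable_funM; first exact: measurable_rho_x.
    by apply: sqitg_meas; apply: sqitg_fi; apply: sqitgD => //; exact: sqitgZ.
  by apply: aeS ei => k ->; ring.
Qed.

Lemma XF_B s f h : XF s f -> XF s h -> XF s (fun p => f p - h p).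
Proof.
move=> Ff Fh; have := XF_ZD (-1) Fh Ff; congr (XF s _).
by apply/funext => p; rewrite mulN1r addrC.
Qed.

Lemma XF_Z s a f : XF s f -> XF s (fun p => a * f p).
Proof.
move=> Ff; have := XF_ZD (a - 1) Ff Ff; congr (XF s _).
by apply/funext => p; ring.
Qed.

Lemma lee_drop_middle (a c : \bar R) (b : \bar R) : (0 <= b)%E -> (a + c <= a + b + c)%E.
Proof. by move=> b0; rewrite leeD2r// leeDl. Qed.

Lemma lee_add_fin (A B : \bar R) (a b x : R) : A = a%:E -> B = b%:E -> x = a + b ->
  (x%:E <= A + B)%E.
Proof. by move=> -> -> ->. Qed.

(** The norm of X^s has a further nonnegative term, in the x-antiderivative. *)
Lemma Xsq_le_Xnorm s f : XF s f -> ((Xsq s f)%:E <= Xnorm s f `^ 2)%E.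
Proof.
move=> [sf [h dh] r j].
rewrite /Xnorm -poweRrM mulVf// poweRe1; last by rewrite !adde_ge0 ?poweR_ge0.
have dhx : is_dx f (xget (fun=> 0%R) [set h | is_dx f h]) by apply: xgetPex; exists h.
move: (xget _ [set h | is_dx f h]) dhx => hx dhx.
have [_ shx _ _] := (is_dxP f hx).1 dhx.
have i := itgD r.2 j.2.
have i1 : itg mu2 (hdens s f).
  apply: (itg_le (measurable_hdens s sf) _ i) => k; rewrite rho_x_hdens ger0_norm ?hdens_ge0//.
  by rewrite lerDl mulr_ge0 ?sqr_ge0 ?hdens_ge0.
have i2 : itg mu2 (fun k => k.1 ^+ 2 * hdens s f k).
  have := itgB i i1; congr (itg mu2 _); apply/funext => k.
  by rewrite rho_x_hdens addrC addKr.
have i3 : itg mu2 (hdens s hx).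
  apply: itg_ae_eq (measurable_hdens s shx) _ i2.
  by apply: aeS (hdens_dx s dhx) => k ->.
have Ef := Hnorm_sq s f; rewrite (Rint_EFin i1) in Ef.
have Eh := Hnorm_sq s hx; rewrite (Rint_EFin i3) in Eh.
apply: le_trans (lee_drop_middle _ _ (poweR_ge0 _ _)).
apply: (lee_add_fin Ef Eh).
have -> : \int[mu2]_k hdens s hx k = \int[mu2]_k (k.1 ^+ 2 * hdens s f k).
  by apply: Rint_ae_eq (itg_meas i3) (itg_meas i2) _; exact: hdens_dx.
rewrite /Xsq !ipE -(RintegralD measurableT r.2 j.2) -(RintegralD measurableT i1 i2).
by congr (Rintegral _ _ _); apply/funext => k; exact: rho_x_hdens.
Qed.

Lemma Xsq_cvg0 (I : Type) (F : set_system I) (FF : Filter F) s (f : I -> R * R -> R) :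
  (\forall i \near F, XF s (f i)) -> Xnorm s (f i) @[i --> F] --> 0%E ->
  Xsq s (f i) @[i --> F] --> 0.
Proof.
move=> Xf X0; apply/cvgrPdist_le => e e0.
have /fine_cvgP[Xfin Xc] := X0.
have e1 : 0 < Num.min e 1 by rewrite lt_min e0 ltr01.
move/cvgrPdist_le : Xc => /(_ _ e1) Xc.
near=> i; rewrite sub0r normrN ger0_norm ?Xsq_ge0// -lee_fin.
have Xi : XF s (f i) by near: i.
have Xfi : Xnorm s (f i) \is a fin_num by near: i.
have h : `|0 - fine (Xnorm s (f i))| <= Num.min e 1 by near: i.
apply: le_trans (Xsq_le_Xnorm Xi) _.
have x0 : 0 <= fine (Xnorm s (f i)) by rewrite fine_ge0// poweR_ge0.
rewrite -(fineK Xfi) poweR_EFin lee_fin; move: h x0; move: (fine _) => x.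
rewrite sub0r normrN le_min => /andP[xe x1] x0; rewrite ger0_norm// in xe x1.
rewrite (powR_mulrn 2 x0) expr2; apply: le_trans xe.
by rewrite ler_piMl.
Unshelve. all: by end_near. Qed.

(** Multipliers dominated by rho_x are bounded on X^s. *)
Lemma XF_component s f (m : R * R -> R) : measurable_fun (setT : set T2) m ->
  (forall k, `|m k| <= rho_x s k) -> XF s f ->
  [/\ sqitg mu2 (fun k => m k * fr f k), sqitg mu2 (fun k => m k * fi f k) &
      ip mu2 (fun k => m k * fr f k) (fun k => m k * fr f k) +
      ip mu2 (fun k => m k * fi f k) (fun k => m k * fi f k) <= Xsq s f].
Proof.
move=> mm mr [sf _ r j].
have b (F : R * R -> R) k : `|m k * F k| <= `|rho_x s k * F k|.
  by rewrite !normrM ler_wpM2r// (ger0_norm (rho_x_ge0 _ _)).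
have s1 : sqitg mu2 (fun k => m k * fr f k).
  by apply: (@sqitg_le _ T2 R mu2 _ _ _ (b _) r); apply: measurable_funM => //; exact: sqitg_meas (sqitg_fr sf).
have s2 : sqitg mu2 (fun k => m k * fi f k).
  by apply: (@sqitg_le _ T2 R mu2 _ _ _ (b _) j); apply: measurable_funM => //; exact: sqitg_meas (sqitg_fi sf).
by split=> //; apply: lerD; exact: ip_le.
Qed.

End SpectralNorms.

(** * Gronwall's inequality *)

Section Gronwall.
Context (R : realType).

Lemma near_within_dnbhsP (I P : set R) (t : R) :
  (\forall x \near within I t^', P x) <->
  exists2 d, 0 < d & forall x, `|x - t| < d -> x != t -> I x -> P x.
Proof.
split.
  move=> [/= d d0 dP]; exists d => // x xd xt Ix.
  by apply: dP => //=; rewrite distrC.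
move=> [d d0 dP]; exists d => //= x xd xt Ix.
by apply: dP => //; rewrite distrC.
Qed.

Lemma cvg_within_dnbhsP (I : set R) (f : R -> R) (t l : R) :
  f x @[x --> within I t^'] --> l <->
  forall e, 0 < e -> exists2 d, 0 < d &
    forall x, `|x - t| < d -> x != t -> I x -> `|l - f x| <= e.
Proof.
split.
  move=> /cvgrPdist_le h e e0; exact/near_within_dnbhsP/(h _ e0).
move=> h; apply/cvgrPdist_le => e e0; exact/near_within_dnbhsP/(h _ e0).
Qed.

(** f is differentiable on [0, T] with derivative f', one-sided at the end points. *)
Definition has_rate (T : R) (f f' : R -> R) := forall t, t \in `[0, T] ->
  (t' - t)^-1 * (f t' - f t) @[t' --> within `[0, T] t^'] --> f' t.

Lemma has_rate_continuous T f f' : has_rate T f f' ->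
  {within `[0, T], continuous f}.
Proof.
move=> H; apply/subspace_continuousP => t tI; apply/cvgrPdist_le => e e0.
have [d d0 dP] := (cvg_within_dnbhsP _ _ _ _).1 (H t tI) 1 ltr01.
have c0 : 0 < `|f' t| + 1 by rewrite ltr_wpDl.
exists (Num.min d (e / (`|f' t| + 1))) => /=; first by rewrite lt_min d0 divr_gt0.
move=> x /=; rewrite distrC lt_min => /andP[xd xe] xI.
have [->|xt] := eqVneq x t; first by rewrite subrr normr0 ltW.
have q := dP x xd xt xI.
have x0 : x - t != 0 by rewrite subr_eq0.
have -> : f t - f x = - ((x - t) * ((x - t)^-1 * (f x - f t))) by rewrite mulVKf// opprB.
rewrite normrN normrM; move: ((x - t)^-1 * _) q => r q.
have r1 : `|r| <= `|f' t| + 1.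
  by have := lerB_dist r (f' t); rewrite distrC; lra.
apply: (@le_trans _ _ (e / (`|f' t| + 1) * (`|f' t| + 1))); last by rewrite divfK// gt_eqF.
by apply: ler_pM => //; exact: ltW.
Qed.

Lemma has_rate_is_derive T f f' t : has_rate T f f' -> t \in `]0, T[ ->
  is_derive t 1 f (f' t).
Proof.
move=> H tI; have tI' : t \in `[0, T] by exact: subset_itv_oo_cc.
have C : h^-1 *: ((f \o shift t) (h *: 1) - f t) @[h --> (0 : R)^'] --> f' t.
  apply/cvgrPdist_le => e e0.
  have [d d0 dP] := (cvg_within_dnbhsP _ _ _ _).1 (H t tI') e e0.
  move: tI; rewrite in_itv/= => /andP[t0 tT].
  exists (Num.min d (Num.min t (T - t))) => /=; first by rewrite !lt_min d0 t0 subr_gt0.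
  move=> h /=; rewrite sub0r normrN !lt_min => /and3P[hd ht hT] h0.
  have := dP (h + t); rewrite addrK /GRing.scale /= mulr1; apply=> //.
    by rewrite -subr_eq0 addrK.
  by rewrite in_itv/=; move: ht hT; rewrite !ltr_norml => /andP[? ?] /andP[? ?]; apply/andP; split; lra.
by apply: DeriveDef; [exact: cvgP C|exact: cvg_lim C].
Qed.

Lemma is_derive_expR_lin (c t : R) : is_derive t 1 (fun x => expR (c * x)) (c * expR (c * t)).
Proof.
have h : is_derive t 1 (fun x : R => c * x) c.
  by have := is_deriveZ c (is_derive_id t (1 : R)); rewrite /GRing.scale/= mulr1.
by apply: (is_derive_eq (is_derive1_comp (is_derive_expR (c * t)) h)); rewrite mulrC.
Qed.

(** f exp(-K t) decreases and f exp(K t) increases; both are nonnegative and vanish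
    at t0. *)
Lemma gronwall_zero (T K t0 : R) (f f' : R -> R) : has_rate T f f' ->
  (forall t, t \in `[0, T] -> 0 <= f t) ->
  (forall t, t \in `[0, T] -> `|f' t| <= K * f t) ->
  t0 \in `[0, T] -> f t0 = 0 -> forall t, t \in `[0, T] -> f t = 0.
Proof.
move=> H f0 fK t0I ft0 t tI.
pose F c x := f x * expR (c * x).
have dF c x : x \in `]0, T[ -> is_derive x 1 (F c) ((f' x + c * f x) * expR (c * x)).
  move=> xI; apply: (is_derive_eq (is_deriveM (has_rate_is_derive H xI) (is_derive_expR_lin c x))).
  by rewrite /GRing.scale/=; ring.
have cF c : {within `[0, T], continuous (F c)}.
  have cf := has_rate_continuous H.
  move=> x; apply: cvgM; first exact: cf.
  have ce : {within `[0, T], continuous (fun x : R => expR (c * x))}.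
    apply: continuous_subspaceT => y; apply: differentiable_continuous.
    by apply/derivable1_diffP; exact: (@ex_derive _ _ _ _ _ _ _ (is_derive_expR_lin c y)).
  exact: ce.
have [tt|tt] := leP t0 t.
(* After t0, f exp(-K t) is at most its value 0 at t0. *)
- have D := @ler0_derive1_le_cc _ (F (- K)) 0 T.
  have := D _ _ (cF _) t t0 tI t0I tt; rewrite /F ft0 mul0r => h.
  apply/eqP; rewrite eq_le f0// andbT -(pmulr_lle0 _ (expR_gt0 (- K * t))); apply: h.
    by move=> x xI; have [] := dF (- K) x xI.
  move=> x xI; rewrite derive1E (@derive_val _ _ _ _ _ _ _ (dF (- K) x xI)).
  rewrite pmulr_lle0 ?expR_gt0// mulNr subr_le0.
  exact: le_trans (ler_norm _) (fK _ (subset_itv_oo_cc xI)).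
(* Before t0, f exp(K t) is at most its value 0 at t0. *)
- have D := @ger0_derive1_le_cc _ (F K) 0 T.
  have := D _ _ (cF _) t t0 tI t0I (ltW tt); rewrite /F ft0 mul0r => h.
  apply/eqP; rewrite eq_le f0// andbT -(pmulr_lle0 _ (expR_gt0 (K * t))); apply: h.
    by move=> x xI; have [] := dF K x xI.
  move=> x xI; rewrite derive1E (@derive_val _ _ _ _ _ _ _ (dF K x xI)).
  rewrite mulr_ge0 ?expR_ge0// -lerBlDr sub0r lerNl.
  by apply: le_trans (fK _ (subset_itv_oo_cc xI)); rewrite -normrN ler_norm.
Qed.

End Gronwall.

(** * Quadratic forms along paths *)

Section Paths.
Context (R : realType).
Local Notation mu := (@lebesgue_measure R).
Local Notation mu2 := (plane_measure R).
Local Notation T2 := (measurableTypeR R * measurableTypeR R)%type.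
Implicit Types (f g h : R * R -> R) (k : R * R).
Local Notation "f =ae g" := {ae mu2, forall p, f p = g p} (at level 70).

Lemma near_eq_cvgR (I : Type) (F : set_system I) (FF : Filter F) (a b : I -> R) (l : R) :
  (\forall i \near F, a i = b i) -> a i @[i --> F] --> l -> b i @[i --> F] --> l.
Proof. by move=> ab; apply: cvg_trans; apply: near_eq_cvg. Qed.

Lemma ip_sq_cvg (I : Type) (F : set_system I) (FF : Filter F)
    (phi : I -> R * R -> R) f :
  (\forall i \near F, sqitg mu2 (phi i)) -> sqitg mu2 f ->
  ip mu2 (fun k => phi i k - f k) (fun k => phi i k - f k) @[i --> F] --> 0 ->
  ip mu2 (phi i) (phi i) @[i --> F] --> ip mu2 f f.
Proof.
move=> sphi sf c0; have c1 := ip_cvg FF sf sf sphi c0.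
have c2 := cvgB (cvgD c0 (cvgD c1 c1)) (cvg_cst (ip mu2 f f)).
rewrite add0r addrK in c2; do ![have {}c2 := c2 FF].
apply: (near_eq_cvgR FF _ c2); near=> i; rewrite !fctE.
have si : sqitg mu2 (phi i) by near: i.
have sB := sqitgB si sf.
rewrite (ipBl si sf sB) (ipBr si sf si) (ipBr si sf sf) (ipC mu2 f (phi i)).
move: (ip mu2 (phi i) (phi i)) (ip mu2 (phi i) f) (ip mu2 f f) => a b c.
by ring.
Unshelve. all: by end_near. Qed.

(** With the difference quotient q, the quotient of the squared norms is
    2 (q, phi t) + (t' - t) (q, q), where the last product stays bounded. *)
Lemma ip_sq_rate (F : set_system R) (FF : Filter F) (t : R) (phi : R -> R * R -> R) psi :
  (\forall t' \near F, sqitg mu2 (phi t')) -> (\forall t' \near F, t' != t) ->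
  t' - t @[t' --> F] --> 0 -> sqitg mu2 (phi t) -> sqitg mu2 psi ->
  ip mu2 (fun k => (t' - t)^-1 * (phi t' k - phi t k) - psi k)
         (fun k => (t' - t)^-1 * (phi t' k - phi t k) - psi k) @[t' --> F] --> 0 ->
  (t' - t)^-1 * (ip mu2 (phi t') (phi t') - ip mu2 (phi t) (phi t)) @[t' --> F] -->
  2 * ip mu2 (phi t) psi.
Proof.
move=> sphi neq tt st spsi c0.
pose q t' k := (t' - t)^-1 * (phi t' k - phi t k).
have sq : \forall t' \near F, sqitg mu2 (q t').
  by near=> t'; apply: sqitgZ; apply: sqitgB => //; near: t'.
have c1 := ip_cvg FF spsi st sq c0.
have c2 := ip_sq_cvg FF sq spsi c0.
have c3 := cvgD (cvgD c1 c1) (cvgM tt c2).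
rewrite mul0r addr0 (ipC mu2 psi) in c3; rewrite mulr_natl mulr2n.
do ![have {}c3 := c3 FF].
apply: (near_eq_cvgR FF _ c3); near=> t'; rewrite !fctE /=.
have si : sqitg mu2 (phi t') by near: t'.
have sqi : sqitg mu2 (q t') by near: t'.
have n0 : t' - t != 0 by rewrite subr_eq0; near: t'.
have sB := sqitgB si st.
have -> : ip mu2 (q t') (q t') = (t' - t)^-1 * ip mu2 (q t') (fun k => phi t' k - phi t k).
  by rewrite -(ipZr _ sB sqi).
have qE h : sqitg mu2 h -> ip mu2 (q t') h = (t' - t)^-1 * ip mu2 (fun k => phi t' k - phi t k) h.
  by move=> sh; rewrite -(ipZl _ sB sh).
rewrite !qE// (ipBl si st st) (ipBl si st sB) (ipBr si st si) (ipBr si st st) (ipC mu2 (phi t) (phi t')).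
move: (ip mu2 (phi t') (phi t')) (ip mu2 (phi t') (phi t)) (ip mu2 (phi t) (phi t)) => a b c.
by field.
Unshelve. all: by end_near. Qed.

(** The quadratic forms of Fourier multipliers; the energy and the norms that bound
    u and ux are of this type. *)
Definition mform (m : R * R -> R) f h : R :=
  ip mu2 (fun k => m k * fr f k) (fun k => m k * fr h k) +
  ip mu2 (fun k => m k * fi f k) (fun k => m k * fi h k).

Section Multiplier.
Variables (s : R) (m : R * R -> R).
Hypothesis mm : measurable_fun (setT : set T2) m.
Hypothesis mr : forall k, `|m k| <= rho_x s k.

Lemma mform_cvg (I : Type) (F : set_system I) (FF : Filter F) (u : I -> R * R -> R) f :
  (\forall i \near F, XF s (u i)) -> XF s f ->
  Xsq s (fun p => u i p - f p) @[i --> F] --> 0 ->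
  mform m (u i) (u i) @[i --> F] --> mform m f f.
Proof.
move=> Xu Xf c0; have [s1 s2 _] := XF_component mm mr Xf.
have key (G : (R * R -> R) -> R * R -> R) : sqitg mu2 (fun k => m k * G f k) ->
    (forall h, XF s h -> sqitg mu2 (fun k => m k * G h k) /\
       ip mu2 (fun k => m k * G h k) (fun k => m k * G h k) <= Xsq s h) ->
    (forall h h', XF s h -> XF s h' -> G (fun p => h p - h' p) =ae (fun k => G h k - G h' k)) ->
    ip mu2 (fun k => m k * G (u i) k) (fun k => m k * G (u i) k) @[i --> F] -->
    ip mu2 (fun k => m k * G f k) (fun k => m k * G f k).
  move=> sf GX GB; apply: (ip_sq_cvg FF _ sf).
    by near=> i; apply: (GX _ _).1; near: i.
  apply: (squeeze_cvgr _ (cvg_cst 0) c0); near=> i; rewrite ip_ge0/=.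
  have Xi : XF s (u i) by near: i.
  have [sB le] := GX _ (XF_B Xi Xf); apply: le_trans le.
  have sBB := sqitgB (GX _ Xi).1 sf.
  have E : (fun k => m k * G (u i) k - m k * G f k) =ae (fun k => m k * G (fun p => u i p - f p) k).
    by apply: aeS (GB _ _ Xi Xf) => k ->; rewrite mulrBr.
  by rewrite (ip_ae sBB sBB sB sB E E).
apply: cvgD; apply: key => //.
- move=> h Xh; have [sa sb le] := XF_component mm mr Xh; split=> //.
  by apply: le_trans le; rewrite lerDl ip_ge0.
- by move=> h h' [sh _ _ _] [sh' _ _ _]; have [] := fourierB sh sh'.
- move=> h Xh; have [sa sb le] := XF_component mm mr Xh; split=> //.
  by apply: le_trans le; rewrite lerDr ip_ge0.
- by move=> h h' [sh _ _ _] [sh' _ _ _]; have [] := fourierB sh sh'.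
Unshelve. all: by end_near. Qed.

(** Differentiability of u in X^s passes through multipliers dominated by rho_x. *)
Lemma mform_rate (F : set_system R) (FF : Filter F) (t : R) (u : R -> R * R -> R) w :
  (\forall t' \near F, XF s (u t')) -> (\forall t' \near F, t' != t) ->
  t' - t @[t' --> F] --> 0 -> XF s (u t) -> XF s w ->
  Xsq s (fun p => (t' - t)^-1 * (u t' p - u t p) - w p) @[t' --> F] --> 0 ->
  (t' - t)^-1 * (mform m (u t') (u t') - mform m (u t) (u t)) @[t' --> F] -->
  2 * mform m (u t) w.
Proof.
move=> Xu neq tt Xt Xw c0.
have key (G : (R * R -> R) -> R * R -> R) :
    (forall h, XF s h -> sqitg mu2 (fun k => m k * G h k) /\
       ip mu2 (fun k => m k * G h k) (fun k => m k * G h k) <= Xsq s h) ->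
    (forall a h h', XF s h -> XF s h' ->
       G (fun p => a * h p + h' p) =ae (fun k => a * G h k + G h' k)) ->
    (t' - t)^-1 * (ip mu2 (fun k => m k * G (u t') k) (fun k => m k * G (u t') k) -
                   ip mu2 (fun k => m k * G (u t) k) (fun k => m k * G (u t) k)) @[t' --> F] -->
    2 * ip mu2 (fun k => m k * G (u t) k) (fun k => m k * G w k).
  move=> GX GL; have st := (GX _ Xt).1; have sw := (GX _ Xw).1.
  apply: (@ip_sq_rate F FF t (fun t' k => m k * G (u t') k)) => //.
    by near=> i; apply: (GX _ _).1; near: i.
  apply: (squeeze_cvgr _ (cvg_cst 0) c0); near=> t'; rewrite ip_ge0/=.
  have Xi : XF s (u t') by near: t'.
  have si := (GX _ Xi).1.
  have XB : XF s (fun p => -1 * u t p + u t' p) by exact: XF_ZD.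
  have QE : (fun p => (t' - t)^-1 * (u t' p - u t p) - w p) =
      (fun p => (t' - t)^-1 * (-1 * u t p + u t' p) + -1 * w p).
    by apply/funext => p; ring.
  have XW : XF s (fun p => -1 * w p) := XF_Z (-1) Xw.
  have [sQ le] := GX _ (XF_ZD (t' - t)^-1 XB XW).
  rewrite QE; apply: le_trans le.
  have sBB := sqitgB (sqitgZ (t' - t)^-1 (sqitgB si st)) sw.
  have E : (fun k => (t' - t)^-1 * (m k * G (u t') k - m k * G (u t) k) - m k * G w k) =ae
      (fun k => m k * G (fun p => (t' - t)^-1 * (-1 * u t p + u t' p) + -1 * w p) k).
    have z := GL (-2) w w Xw Xw.
    have E1 : (fun p => -2 * w p + w p) = (fun p => -1 * w p) by apply/funext => p; ring.
    rewrite E1 in z.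
    apply: aeS2 (aeS2 (fun _ a b => conj a b) (GL (t' - t)^-1 _ _ XB XW) z) (GL (-1) _ _ Xt Xi) => k [-> ->] ->.
    by ring.
  by rewrite (ip_ae sBB sBB sQ sQ E E).
have FR : (t' - t)^-1 * (mform m (u t') (u t') - mform m (u t) (u t)) @[t' --> F] -->
    2 * ip mu2 (fun k => m k * fr (u t) k) (fun k => m k * fr w k) +
    2 * ip mu2 (fun k => m k * fi (u t) k) (fun k => m k * fi w k).
  apply: (near_eq_cvgR FF _ (cvgD (key (fun f => fr f) _ _) (key (fun f => fi f) _ _))).
  - by apply: nearW => t' /=; rewrite /mform -mulrDr opprD addrACA.
  - move=> h Xh; have [sa sb le] := XF_component mm mr Xh; split=> //.
    by apply: le_trans le; rewrite lerDl ip_ge0.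
  - by move=> a h h' [sh _ _ _] [sh' _ _ _]; have [] := fourierZD a sh sh'.
  - move=> h Xh; have [sa sb le] := XF_component mm mr Xh; split=> //.
    by apply: le_trans le; rewrite lerDr ip_ge0.
  - by move=> a h h' [sh _ _ _] [sh' _ _ _]; have [] := fourierZD a sh sh'.
by rewrite /mform mulrDr.
Unshelve. all: by end_near. Qed.

End Multiplier.
End Paths.

(** * The evolution *)

Section Evolution.
Context (R : realType).
Local Notation mu := (@lebesgue_measure R).
Local Notation mu2 := (plane_measure R).
Local Notation T2 := (measurableTypeR R * measurableTypeR R)%type.
Implicit Types (f g h : R * R -> R) (k : R * R).
Local Notation "f =ae g" := {ae mu2, forall p, f p = g p} (at level 70).

Definition xi_mult k : R := k.1.
Definition one_mult k : R := 1.
Definition bessel_xi k : R := bessel k * k.1.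

Lemma measurable_xi : measurable_fun (setT : set T2) xi_mult.
Proof. exact: measurable_fst. Qed.

Lemma measurable_one : measurable_fun (setT : set T2) one_mult.
Proof. exact: measurable_cst. Qed.

Lemma measurable_bessel_xi : measurable_fun (setT : set T2) bessel_xi.
Proof. by apply: measurable_funM; [exact: measurable_bessel|exact: measurable_fst]. Qed.

Lemma normr_le_rho (s a : R) k : a ^+ 2 <= bessel k `^ s * (1 + k.1 ^+ 2) -> `|a| <= rho_x s k.
Proof. by move=> h; rewrite -sqrtr_sqr ler_wsqrtr. Qed.

Lemma bessel_pow_ge1 (s : R) k : 0 <= s -> 1 <= bessel k `^ s.
Proof. by move=> s0; rewrite -(powRr0 (bessel k)) ler_powR// bessel_ge1. Qed.

Lemma bessel_pow_ge_sq (s : R) k : 2 <= s -> bessel k ^+ 2 <= bessel k `^ s.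
Proof.
move=> s2; have b1 := bessel_ge1 k; rewrite -powR_mulrn ?(le_trans ler01 b1)//.
by rewrite ler_powR.
Qed.

Lemma one_le_rho (s : R) k : 0 <= s -> `|one_mult k| <= rho_x s k.
Proof.
move=> s0; apply: normr_le_rho; rewrite /one_mult expr1n.
by have := bessel_pow_ge1 k s0; have := sqr_ge0 k.1; move: (k.1 ^+ 2) (bessel k `^ s) => x b; nra.
Qed.

Lemma xi_le_rho (s : R) k : 0 <= s -> `|xi_mult k| <= rho_x s k.
Proof.
move=> s0; apply: normr_le_rho; rewrite /xi_mult.
by have := bessel_pow_ge1 k s0; have := sqr_ge0 k.1; move: (k.1 ^+ 2) (bessel k `^ s) => x b; nra.
Qed.

Lemma bessel_le_rho (s : R) k : 2 <= s -> `|bessel k| <= rho_x s k.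
Proof.
move=> s2; apply: normr_le_rho; apply: le_trans (bessel_pow_ge_sq k s2) _.
by rewrite ler_peMr ?powR_ge0// lerDl sqr_ge0.
Qed.

Lemma bessel_xi_le_rho (s : R) k : 2 <= s -> `|bessel_xi k| <= rho_x s k.
Proof.
move=> s2; apply: normr_le_rho; rewrite /bessel_xi exprMn; apply: ler_pM; rewrite ?sqr_ge0//.
  exact: bessel_pow_ge_sq.
by rewrite lerDr.
Qed.

Lemma energy_mform f h : energy_ip f h = mform one_mult f h + mform xi_mult f h.
Proof.
rewrite /energy_ip /mform; congr (_ + _).
have E (F : R * R -> R) : (fun k => one_mult k * F k) = F by apply/funext => k; rewrite mul1r.
by rewrite !E.
Qed.

(** The squared norms of f and of its x-derivative in H^2, up to a constant factor. *)
Definition high_norm f : R := mform (@bessel R) f f + mform bessel_xi f f.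

(** The Sobolev bound for u and for ux: their spectra, weighted by the symbol of
    1 - dx^2 - dy^2, are square integrable when s >= 2. *)
Lemma XF_bounded (s : R) u ux : 2 <= s -> XF s u -> wderiv (1, 0) u ux ->
  [/\ {ae mu2, forall p, `|u p| <= sup_const R + high_norm u},
      {ae mu2, forall p, `|ux p| <= sup_const R + high_norm u},
      sqitg mu2 (dx_symbol (fr ux)) & sqitg mu2 (dx_symbol (fi ux))].
Proof.
move=> s2 Xu du; have [su sux Er Ei] := du.
have [b1 b2 _] := XF_component (@measurable_bessel R) (fun k => bessel_le_rho k s2) Xu.
have [c1 c2 _] := XF_component measurable_bessel_xi (fun k => bessel_xi_le_rho k s2) Xu.
have E1 : (fun k => - (bessel_xi k * fi u k)) =ae (fun k => bessel k * fr ux k).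
  by apply: aeS Er => k ->; rewrite dot10 /bessel_xi; ring.
have E2 : (fun k => bessel_xi k * fr u k) =ae (fun k => bessel k * fi ux k).
  by apply: aeS Ei => k ->; rewrite dot10 /bessel_xi; ring.
have srx := sqitg_fr sux; have six := sqitg_fi sux.
have d1 : sqitg mu2 (fun k => bessel k * fr ux k).
  apply: sqitg_ae_eq E1 (sqitgN c2).
  by apply: measurable_funM; [exact: measurable_bessel|exact: sqitg_meas srx].
have d2 : sqitg mu2 (fun k => bessel k * fi ux k).
  apply: sqitg_ae_eq E2 c1.
  by apply: measurable_funM; [exact: measurable_bessel|exact: sqitg_meas six].
have xb k : `|k.1| <= `|bessel k|.
  have := bessel_ge1 k; rewrite (ger0_norm (le_trans ler01 (bessel_ge1 k))) /bessel => _.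
  rewrite ler_norml; have := sqr_ge0 k.2; have := sqr_ge0 (k.1 - 1); have := sqr_ge0 (k.1 + 1).
  rewrite sqrrB sqrrD; move: (k.1 ^+ 2) (k.2 ^+ 2) k.1 => a b x *; apply/andP; split; lra.
have lift (F : R * R -> R) : sqitg mu2 F -> sqitg mu2 (fun k => bessel k * F k) -> sqitg mu2 (dx_symbol F).
  move=> sF sbF; apply: (@sqitg_le _ T2 R mu2 _ (fun k => bessel k * F k)) => //.
    by apply: measurable_funM; [exact: measurable_fst|exact: sqitg_meas sF].
  by move=> k; rewrite /dx_symbol !normrM ler_wpM2r.
split; [| |exact: lift|exact: lift].
- apply: aeS (sobolev_sup su b1 b2) => p h; apply: le_trans h _.
  by rewrite -addrA lerD2l /high_norm lerDl addr_ge0 ?ip_ge0.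
- apply: aeS (sobolev_sup sux d1 d2) => p h; apply: le_trans h _.
  rewrite -addrA lerD2l /high_norm.
  have sN := sqitgN c2.
  rewrite -(ip_ae sN sN d1 d1 E1 E1) -(ip_ae c1 c1 d2 d2 E2 E2) (ipNl c2 sN) (ipNr c2 c2) opprK.
  by rewrite addrC [leRHS]addrC lerDl addr_ge0 ?ip_ge0.
Qed.

(** The mean value theorem on [-M, M]. *)
Lemma smooth_lipschitz0 (g : R -> R) (M : R) : smooth g -> g 0 = 0 -> 0 <= M ->
  exists2 C, 0 <= C & forall r, `|r| <= M -> `|g r| <= C * `|r|.
Proof.
move=> sg g0 M0.
have dg (x : R) : is_derive x 1 g ((derive1 g) x).
  by apply: DeriveDef; [exact: (sg 0%N x)|rewrite derive1E].
have cont (h : R -> R) : (forall x : R, derivable h x 1) -> continuous h.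
  by move=> dh x; apply: differentiable_continuous; exact/derivable1_diffP.
have cg : continuous g by apply: cont => x; exact: (sg 0%N x).
have cg' : continuous (fun x => `|(derive1 g) x|).
  by move=> x; apply: cvg_norm; apply: cont => y; exact: (sg 1%N y).
have NM : - M <= M by lra.
have [c _ cM] := EVT_max NM (continuous_subspaceT cg').
exists `|(derive1 g) c| => // r rM.
have bd x : x \in `[- M, M] -> `|(derive1 g) x| <= `|(derive1 g) c| by exact: cM.
have [r0|r0] := leP 0 r.
  have [|e eI] := @MVT_segment R g (derive1 g) 0 r r0 (fun x _ => dg x).
    exact: continuous_subspaceT.
  rewrite g0 !subr0 => ->; rewrite normrM ler_wpM2r// bd//.
  move: eI rM; rewrite !in_itv/= (ger0_norm r0) => /andP[e0 er] rM; apply/andP; split; lra.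
have [|e eI] := @MVT_segment R g (derive1 g) r 0 (ltW r0) (fun x _ => dg x).
  exact: continuous_subspaceT.
rewrite g0 !sub0r => H; rewrite -(normrN (g r)) H normrM (normrN r) ler_wpM2r// bd//.
move: eI rM; rewrite !in_itv/= (ltr0_norm r0) => /andP[e0 er] rM; apply/andP; split; lra.
Qed.

Lemma itv_other_point (T t d : R) : 0 < T -> t \in `[0, T] -> 0 < d ->
  exists t', [/\ t' \in `[0, T], `|t' - t| < d & t' != t].
Proof.
rewrite in_itv/= => T0 /andP[t0 tT] d0.
pose e := Num.min (d / 2) (T / 2).
have e0 : 0 < e by rewrite lt_min !divr_gt0.
have ed : e < d by rewrite gt_min; apply/orP; left; lra.
have eT : e <= T / 2 by rewrite ge_min lexx orbT.
have [h|h] := leP t (T / 2).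
  exists (t + e); split; first by rewrite in_itv/=; apply/andP; split; lra.
    by rewrite addrAC subrr add0r gtr0_norm.
  by rewrite -subr_eq0 addrAC subrr add0r gt_eqF.
exists (t - e); split; first by rewrite in_itv/=; apply/andP; split; lra.
  by rewrite addrAC subrr add0r normrN gtr0_norm.
by rewrite -subr_eq0 addrAC subrr add0r oppr_eq0 gt_eqF.
Qed.

Section Path.
Variables (s T : R) (u ut : R -> R * R -> R).
Hypothesis s_ge2 : 2 <= s.
Hypothesis T_gt0 : 0 < T.
Hypothesis u_CX : in_CX s T u.
Hypothesis u_CX2 : in_CX (s - 2) T u.
Hypothesis ut_CX : in_CX (s - 2) T ut.
Hypothesis u_rate : is_dt_X (s - 2) T u ut.

Let s2 : 0 <= s - 2. Proof. by rewrite subr_ge0. Qed.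

Lemma path_XF t : t \in `[0, T] -> [/\ XF s (u t), XF (s - 2) (u t) & XF (s - 2) (ut t)].
Proof.
by move=> tI; split; apply: in_X_XF; [have [] := u_CX tI|have [] := u_CX2 tI|have [] := ut_CX tI].
Qed.

Lemma near_within_in (F : set_system R) (FF : Filter F) (I P : set R) :
  (forall x, I x -> P x) -> \forall x \near within I F, P x.
Proof. by move=> IP; apply: filterS (withinT I FF) => x; exact: IP. Qed.

Lemma quotient_cvg t : t \in `[0, T] ->
  Xsq (s - 2) (fun p => (t' - t)^-1 * (u t' p - u t p) - ut t p)
    @[t' --> within `[0, T] t^'] --> 0.
Proof.
move=> tI; have [_ Xt Xut] := path_XF tI.
apply: Xsq_cvg0 (u_rate tI); apply: near_within_in => t' t'I.
have [_ Xt' _] := path_XF t'I.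
by apply: XF_B => //; apply: XF_Z; exact: XF_B.
Qed.

Lemma dist_cvg0 (I : set R) (t : R) : t' - t @[t' --> within I t^'] --> 0.
Proof.
apply/cvg_within_dnbhsP => e e0; exists e => // x xe _ _.
by rewrite sub0r normrN ltW.
Qed.

(** The multipliers 1 and xi of the energy are dominated by rho_x as soon as the
    exponent, here s - 2, is nonnegative. *)
Lemma energy_has_rate : has_rate T (fun t => energy_ip (u t) (u t))
  (fun t => 2 * energy_ip (u t) (ut t)).
Proof.
move=> t tI; have [_ Xt Xut] := path_XF tI.
have neq : \forall t' \near within `[0, T]%classic t^', t' != t.
  by apply/near_within_dnbhsP; exists 1.
have Xn : \forall t' \near within `[0, T]%classic t^', XF (s - 2) (u t').
  by apply: near_within_in => t' t'I; have [] := path_XF t'I.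
have q := quotient_cvg tI.
have FF : Filter (within `[0, T]%classic t^') by exact: within_filter.
have c1 := mform_rate measurable_one (fun k => one_le_rho k s2) FF Xn neq (dist_cvg0 _ _) Xt Xut q.
have c2 := mform_rate measurable_xi (fun k => xi_le_rho k s2) FF Xn neq (dist_cvg0 _ _) Xt Xut q.
rewrite (energy_mform (u t) (ut t)) [X in _ --> X]mulrDr.
have c3 := cvgD c1 c2; do ?[have {}c3 := c3 FF].
apply: (near_eq_cvgR FF _ c3).
apply: nearW => t'; rewrite ?fctE /= !energy_mform.
by move: (mform one_mult _ _) (mform one_mult _ _) (mform xi_mult _ _) (mform xi_mult _ _) => a b c d; ring.
Qed.

(** high_norm is dominated by the norm of X^s, hence continuous on the compact
    interval [0, T]. *)
Lemma high_norm_bounded : exists2 B, 0 <= B & forall t, t \in `[0, T] -> high_norm (u t) <= B.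
Proof.
have c : {within `[0, T], continuous (fun t => high_norm (u t))}.
  apply/subspace_continuousP => t tI; have [Xt _ _] := path_XF tI.
  have FF : Filter (within `[0, T]%classic (nbhs t)) by exact: within_filter.
  have Xn : \forall t' \near within `[0, T]%classic (nbhs t), XF s (u t').
    by apply: near_within_in => t' t'I; have [] := path_XF t'I.
  have q : Xsq s (fun p => u t' p - u t p) @[t' --> within `[0, T]%classic (nbhs t)] --> 0.
    apply: Xsq_cvg0 (u_CX tI).2; apply: near_within_in => t' t'I.
    by have [Xt' _ _] := path_XF t'I; exact: XF_B.
  apply: cvgD.
    exact: (mform_cvg (@measurable_bessel R) (fun k => bessel_le_rho k s_ge2) FF Xn Xt q).
  exact: (mform_cvg measurable_bessel_xi (fun k => bessel_xi_le_rho k s_ge2) FF Xn Xt q).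
have [c0 _ cM] := EVT_max (ltW T_gt0) c.
by exists (high_norm (u c0)) => //; rewrite !addr_ge0 ?ip_ge0.
Qed.

(** The difference quotients at t0 vanish on the strip, and they converge to ut t0
    in mean square. *)
Lemma rate_strip_zero (t0 a b d : R) : t0 \in `[0, T] -> 0 < d ->
  (forall t p, t \in `[0, T] -> `|t - t0| < d -> a < p.1 < b -> u t p = 0) ->
  {ae mu2, forall p, a < p.1 < b -> ut t0 p = 0}.
Proof.
move=> tI d0 uz; have [_ Xt Xut] := path_XF tI; have [sut _ _ _] := Xut.
apply: strip_eq0 => //; apply/eqP; rewrite eq_le ip_ge0 andbT; apply/ler_addgt0Pl => e e0.
rewrite addr0.
have [d' d'0 dP] := (cvg_within_dnbhsP _ _ _ _).1 (quotient_cvg tI) e e0.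
have dd : 0 < Num.min d d' by rewrite lt_min d0.
(* Any time t' <> t0 close to t0 serves, on whichever side [0, T] allows. *)
have [t' [t'I]] := itv_other_point T_gt0 tI dd.
rewrite lt_min => /andP[td td'] tt.
have := dP t' td' tt t'I; rewrite sub0r normrN (ger0_norm (Xsq_ge0 _ _)); apply: le_trans.
have [_ Xt' _] := path_XF t'I.
have XQ : XF (s - 2) (fun p => (t' - t0)^-1 * (u t' p - u t0 p) - ut t0 p).
  by apply: XF_B => //; apply: XF_Z; exact: XF_B.
have [sQ _ _ _] := XQ.
have [_ _] := XF_component measurable_one (fun k => one_le_rho k s2) XQ.
apply: le_trans.
have E (F : R * R -> R) : (fun k => one_mult k * F k) = F by apply/funext => k; rewrite mul1r.
rewrite !E plancherel//.
apply: (@le_trans _ _ (ip mu2 (fun p => (t' - t0)^-1 * (u t' p - u t0 p) - ut t0 p)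
   (fun p => (t' - t0)^-1 * (u t' p - u t0 p) - ut t0 p))).
  apply: ip_le => //; first exact: sqitg_strip.
  move=> p; rewrite indicE; case: (boolP (p \in _)) => [|_]; last by rewrite mul0r normr0.
  rewrite inE => pab; rewrite (uz t' p)// (uz t0 p)//; last by rewrite subrr normr0.
  by rewrite subrr mulr0 sub0r mul1r normrN.
rewrite ler_peMl ?ip_ge0// exprn_ege1//; have := @pi_ge2 R; lra.
Qed.

End Path.
End Evolution.

(** * Unique continuation *)

Lemma ip_ae0 (R : realType) (f : R * R -> R) : sqitg (plane_measure R) f ->
  {ae plane_measure R, forall p, f p = 0} -> ip (plane_measure R) f f = 0.
Proof.
move=> sf f0; have s0 := sqitg0 (plane_measure R).
rewrite (ip_ae sf sf s0 s0 f0 f0) /ip.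
transitivity (\int[plane_measure R]_p (0 : R)); last by rewrite /Rintegral integral0_eq.
by congr (Rintegral _ _ _); apply/funext => p; rewrite mulr0.
Qed.

Theorem theorem5p1 (R : realType) (gamma s T : R) (g : R -> R)
    (u0 : R * R -> R) (u v : R -> R * R -> R)
    (gamma_gt0 : 0 < gamma) (s_ge2 : 2 <= s) (T_gt0 : 0 < T)
    (g_smooth : smooth g) (g0 : g 0 = 0)
    (g_ge : forall r, gamma * r ^+ 2 <= g r)
    (g_gt : forall r, r != 0 -> gamma * r ^+ 2 < g r)
    (u_sol : is_solution gamma g s T u0 u v)
    (u_nontrivial : ~ forall t, t \in `[0, T] -> ae_eq2 (u t) (fun=> 0)) :
  ~ exists W : set (R * R),
      [/\ W !=set0,
          (exists2 O : set (R * R), open O &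
             W = O `&` (`[0, T]%classic `*` [set: R])) &
          forall t x y, W (t, x) -> u t (x, y) = 0].
Proof.
case=> W [[[t0 x0] W0] [ O oO WE] Wz]; apply: u_nontrivial.
have [Cu _ [ut [Cu2 Cut dt sys]]] := u_sol.
have [Otx [t0I _]] : (O `&` (`[0, T]%classic `*` [set: R])) (t0, x0) by rewrite -WE.
have [d /= d0 dO] := (nbhs_ballP _ _).1 (open_nbhs_nbhs (conj oO Otx)).
(* An open box around a point of W: a time interval times a strip. *)
have uz t p : t \in `[0, T] -> `|t - t0| < d -> x0 - d < p.1 < x0 + d -> u t p = 0.
  case: p => x y tI td /= /andP[x1 x2]; apply: Wz; rewrite WE; split=> //.
  apply: dO; split=> /=; first by rewrite /ball/= distrC.
  by rewrite /ball/= distrC ltr_norml; apply/andP; split; lra.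
have rate := energy_has_rate s_ge2 Cu Cu2 Cut dt.
have [B B0 BP] := high_norm_bounded s_ge2 T_gt0 Cu Cu2 Cut.
pose M := sup_const R + B.
have M0 : 0 <= M.
  by rewrite addr_ge0// addr_ge0// Rint_ge0// => k; rewrite mulr_ge0// poisson_ge0.
have [C C0 CP] := smooth_lipschitz0 g_smooth g0 M0.
(* Rigidity at the time t0. *)
have E0 : energy_ip (u t0) (u t0) = 0.
  have [ux [uy [vx [vy [dN [[/is_dxP du _] _ [_ /is_dyP dvy] /is_dxP dNP [eq _]]]]]]] := sys t0 t0I.
  have [su sux _ _] := du.
  have ut0 := rate_strip_zero s_ge2 T_gt0 Cu Cu2 Cut dt t0I d0 uz.
  have xd : x0 - d < x0 + d by lra.
  have uz0 p : x0 - d < p.1 < x0 + d -> u t0 p = 0.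
    by apply: uz => //; rewrite subrr normr0.
  have z := strip_forces_zero gamma_gt0 g0 g_ge g_gt xd du dvy dNP eq uz0 ut0.
  rewrite (energy_ipE du) /sq_sum (ip_ae0 su) ?(ip_ae0 sux) ?addr0 ?mulr0//.
    by apply: aeS z => p [].
  by apply: aeS z => p [].
(* The energy estimate, with constants that do not depend on the time. *)
have bound t : t \in `[0, T] -> `|2 * energy_ip (u t) (ut t)| <= 2 * (2 * gamma * M + C) * energy_ip (u t) (u t).
  move=> tI; have [ux [uy [vx [vy [dN [[/is_dxP du /is_dyP duy] _ [/is_dxP dvx /is_dyP dvy] /is_dxP dNP [eq uyvx]]]]]]] := sys t tI.
  have [Xt _ Xut] := path_XF Cu Cu2 Cut tI.
  have [b1 b2 s1 s2] := XF_bounded s_ge2 Xt du.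
  have le : sup_const R + high_norm (u t) <= M by rewrite lerD2l BP.
  have {}b1 := aeS (fun p h => le_trans h le) b1.
  have {}b2 := aeS (fun p h => le_trans h le) b2.
  have [sut [utx /is_dxP dut] _ _] := Xut.
  have [st1 st2] := wderiv_sqitg_symbol dut.
  rewrite normrM ger0_norm// -mulrA ler_wpM2l//.
  exact: energy_rate gamma_gt0 C0 M0 CP du duy dvx dvy uyvx dNP eq b1 b2 s1 s2 sut st1 st2.
have Epos t : t \in `[0, T] -> 0 <= energy_ip (u t) (u t).
  by move=> _; rewrite /energy_ip !addr_ge0 ?ip_ge0.
have Ez := gronwall_zero rate Epos bound t0I E0.
move=> t tI.
have [ux [uy [vx [vy [dN [[/is_dxP du _] _ _ _ _]]]]]] := sys t tI.
have [su _ _ _] := du.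
apply: (ip_eq0 su); have := Ez t tI; rewrite (energy_ipE du) => /eqP.
rewrite mulf_eq0 expf_eq0/= mulf_eq0 pnatr_eq0/= (gt_eqF (pi_gt0 R))/=.
by rewrite paddr_eq0 ?ip_ge0// => /andP[/eqP].
Qed.
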